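(* Let $r\geq 1$ be an integer, let $(\bm{a},\bm{j})=\big((a_i,j_i)\big)_{i=0}^{r-1}\in\mathcal{P}^r$, and let $\bm{\varepsilon}\in\mathcal{X}_r(\bm{a},\bm{j})$. For every integer $i$ with $0\leq i\leq w-\mathcal{W}(\bm{\varepsilon})$, $$\mathrm{rad}^i_{\mathcal{A}_r}\big(\mathcal{A}_r\cdot B^{(\bm{\varepsilon})}(\bm{a},\bm{j})\big)=\mathrm{soc}^{\,w+1-\mathcal{W}(\bm{\varepsilon})-i}_{\mathcal{A}_r}\big(\mathcal{A}_r\cdot B^{(\bm{\varepsilon})}(\bm{a},\bm{j})\big).$$ In particular, the socle of the $\mathcal{A}_r$-module $\mathcal{A}_r\cdot B^{(\bm{\varepsilon})}(\bm{a},\bm{j})$ is isomorphic to $S_{(\bm{a},\bm{j})}$.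
   Context: Let $k$ be an algebraically closed field of characteristic $p>0$. The hyperalgebra. Let $X,Y,H$ be the standard basis of $\mathfrak{sl}_2(\mathbb{C})$ ($X$ upper triangular nilpotent, $Y$ lower triangular nilpotent, $H=\mathrm{diag}(1,-1)$). Let $\mathcal{U}_{\mathbb{Z}}$ be the subring of the universal enveloping algebra of $\mathfrak{sl}_2(\mathbb{C})$ generated by $X^{(m)}=X^m/m!$ and $Y^{(m)}=Y^m/m!$ ($m\geq 0$). Put $\binom{H+c}{m}=\frac{(H+c)(H+c-1)\cdots(H+c-m+1)}{m!}$ for $c\in\mathbb{Z}$, $m\geq 0$. The elements $Y^{(m)}\binom{H}{n}X^{(m')}$ ($m,n,m'\geq 0$) form a $\mathbb{Z}$-basis of $\mathcal{U}_{\mathbb{Z}}$. Let $\mathcal{U}=\mathcal{U}_{\mathbb{Z}}\otimes_{\mathbb{Z}}k$ (the hyperalgebra of $\mathrm{SL}_2(k)$); the same notation is used for images in $\mathcal{U}$. For $r\geq 1$, $\mathcal{U}_r$ is the subalgebra of $\mathcal{U}$ generated by $X^{(p^i)},Y^{(p^i)}$ with $0\leq i\leq r-1$. Let $\mathcal{A}$ be the subalgebra of $\mathcal{U}$ generated by all $\binom{H}{p^i}$ and $Y^{(p^i)}X^{(p^i)}$ ($i\geq 0$), and $\mathcal{A}_r=\mathcal{A}\cap\mathcal{U}_r$; $\mathcal{A}_r$ is commutative, is generated by $\binom{H}{p^i}$ and $Y^{(p^i)}X^{(p^i)}$ with $0\leq i\leq r-1$, and has the $k$-basis $Y^{(m)}\binom{H}{n}X^{(m)}$,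 $0\leq m,n\leq p^r-1$. Let $\mathrm{Fr}':\mathcal{U}\to\mathcal{U}$ be the $k$-linear map with $Y^{(m)}\binom{H}{n}X^{(m')}\mapsto Y^{(mp)}\binom{H}{np}X^{(m'p)}$. For $a\in\mathbb{Z}$ put $\mu_a=\binom{H-a-1}{p-1}\in\mathcal{U}$. The elements $B^{(\varepsilon)}(a,j)$, $\varepsilon\in\{0,1\}$. If $p$ is odd: $\mathcal{S}=\{0,1,\dots,(p-1)/2\}$ (also identified with its image in $\mathbb{F}_p$), $\mathcal{P}=\{0,1,\dots,p-1\}\times\mathcal{S}$. In $\mathbb{F}_p[x]$ put $\psi(x)=\prod_{i\in\mathbb{F}_p}(x-i^2)$, $\psi^{(1)}_j(x)=\psi(x)/(x-j^2)$ for $j\in\mathcal{S}$, $\psi^{(0)}_0(x)=\prod_{i\in\mathbb{F}_p^\times}(x-i^2)$, and $\psi^{(0)}_s(x)=2x(x+s^2)\prod_{i\in\mathbb{F}_p^\times\setminus\{s,p-s\}}(x-i^2)$ for $s\in\mathcal{S}\setminus\{0\}$. Set $B^{(\varepsilon)}(a,j)=\psi^{(\varepsilon)}_j\big(\mu_aYX+((a+1)/2)^2\big)\cdot\mu_a$ for $(a,j)\in\mathcal{P}$. If $p=2$: $\mathcal{P}=\{(0,1/2),(1,0),(1,1)\}$ and $B^{(0)}(0,1/2)=\mu_0$, $B^{(1)}(0,1/2)=\mu_0YX$, $B^{(0)}(1,0)=B^{(1)}(1,0)=\mu_1YX$, $B^{(0)}(1,1)=B^{(1)}(1,1)=\mu_1YX+\mu_1$.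 Types. $(a,j)\in\mathcal{P}$ is of type (A) if $a$ is even and $(p-a+1)/2\leq j\leq(p-1)/2$; (B) if $a$ is even and $0\leq j\leq(p-a-1)/2$; (C) if $a$ is odd and $0\leq j\leq(a-1)/2$; (D) if $a$ is odd and $(a+1)/2\leq j\leq(p-1)/2$. For $p=2$ the pairs $(0,1/2),(1,0),(1,1)$ are of type (B), (C), (D) respectively. For types (A) and (C) put $s(a,j)=(p-a+1)/2$ if $p$ is odd and $a$ is even, $s(a,j)=(p-a)/2$ if $p$ and $a$ are odd, and $s(a,j)=1$ if $p=2$. The maps $Z^{(\varepsilon)}$. Each $B^{(\varepsilon)}(a,j)$ can be written uniquely as $\mu_a\sum_{m=0}^{p-1}c^{(\varepsilon)}_mY^mX^m$ with $c^{(\varepsilon)}_m\in\mathbb{F}_p$; for types (A), (C) one has $c_m^{(\varepsilon)}=0$ for $m<s(a,j)$. For $z\in\mathcal{U}$ define $Z^{(\varepsilon)}(z;(a,j))=\mu_a\sum_{m=s(a,j)}^{p-1}c^{(\varepsilon)}_mY^mX^{m-s(a,j)}\,\mathrm{Fr}'(z)\,X^{s(a,j)}$ for types (A), (C), and $Z^{(\varepsilon)}(z;(a,j))=\mathrm{Fr}'(z)B^{(\varepsilon)}(a,j)$ for types (B), (D). The elements $B^{(\bm{\varepsilon})}(\bm{a},\bm{j})$. For $\bm{\varepsilon}=(\varepsilon_0,\dots,\varepsilon_{r-1})\in\{0,1\}^r$ and $(\bm{a},\bm{j})=\big((a_i,j_i)\big)_{i=0}^{r-1}\in\mathcal{P}^r$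 (with $\bm{a}=(a_0,\dots,a_{r-1})$, $\bm{j}=(j_0,\dots,j_{r-1})$), define recursively $B^{(\bm{\varepsilon})}(\bm{a},\bm{j})=B^{(\varepsilon_0)}(a_0,j_0)$ if $r=1$, and $B^{(\bm{\varepsilon})}(\bm{a},\bm{j})=Z^{(\varepsilon_0)}\big(B^{(\varepsilon_1,\dots,\varepsilon_{r-1})}((a_1,\dots,a_{r-1}),(j_1,\dots,j_{r-1}));(a_0,j_0)\big)$ if $r\geq 2$. These lie in $\mathcal{A}_r$. Index sets. $\mathcal{X}_r(\bm{a},\bm{j})$ is the set of $(\varepsilon_0,\dots,\varepsilon_{r-1})\in\{0,1\}^r$ such that $\varepsilon_i=0$ whenever $j_i=0$ (if $p$ is odd), respectively $\varepsilon_i=0$ whenever $a_i=1$ (if $p=2$). $\mathcal{W}(\bm{m})$ is the number of nonzero entries of $\bm{m}$ (Hamming weight). $w$ is the number of $s\in\{0,\dots,r-1\}$ with $j_s\neq 0$ (if $p$ is odd), respectively with $a_s\neq 1$ (if $p=2$). $\bm{\tau}=(\tau_0,\dots,\tau_{r-1})\in\mathcal{X}_r(\bm{a},\bm{j})$ is the unique element of Hamming weight $w$: $\tau_s=0$ if $j_s=0$ ($p$ odd), resp. $a_s=1$ ($p=2$), and $\tau_s=1$ otherwise. $S_{(\bm{a},\bm{j})}=\mathcal{A}_r\cdot B^{(\bm{\tau})}(\bm{a},\bm{j})=k\cdot B^{(\bm{\tau})}(\bm{a},\bm{j})$, a simple $\mathcal{A}_r$-module. Radicals and socles. For a finite-dimensional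 $k$-algebra $R$ with Jacobson radical $\mathrm{rad}R$ and a finite-dimensional left $R$-module $M$: $\mathrm{rad}^n_RM=(\mathrm{rad}R)^nM$ for $n\geq 1$ and $\mathrm{rad}^0_RM=M$; $\mathrm{soc}^n_RM$ is the submodule of elements of $M$ annihilated by $(\mathrm{rad}R)^n$ for $n\geq 1$, and $\mathrm{soc}^0_RM=0$. The socle of $M$ is $\mathrm{soc}^1_RM$. *)

(* Defs.v *)
From HB Require Import structures.
From mathcomp Require Import all_boot all_order all_algebra.
From mathcomp Require Import boolp classical_sets functions.
From mathcomp Require Import generic_quotient complex Rstruct.
From Stdlib Require Rdefinitions.

Set Implicit Arguments.
Unset Strict Implicit.
Unset Printing Implicit Defensive.

Import GRing.Theory Num.Theory.

Local Open Scope ring_scope.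
Local Open Scope classical_set_scope.
Local Open Scope quotient_scope.

(* Noncommutative polynomial expressions in the generators G over K. *)
Inductive term (K G : Type) : Type :=
| Gen of G
| Scal of K
| Add of term K G & term K G
| Mul of term K G & term K G.

Arguments Gen {K G}.
Arguments Scal {K G}.

HB.instance Definition _ (K G : Type) := gen_eqMixin (term K G).
HB.instance Definition _ (K G : Type) := gen_choiceMixin (term K G).

Section Congruence.
Variables (K : comNzRingType) (G : Type).
Variable rel : term K G -> term K G -> Prop.

(* The least congruence containing rel whose quotient is a K-algebra. *)
Inductive cong : term K G -> term K G -> Prop :=
| cong_rel s t : rel s t -> cong s t
| cong_refl t : cong t t
| cong_sym s t : cong s t -> cong t s
| cong_trans s t u : cong s t -> cong t u -> cong s u
| cong_add s s' t t' : cong s s' -> cong t t' -> cong (Add s t) (Add s' t')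
| cong_mul s s' t t' : cong s s' -> cong t t' -> cong (Mul s t) (Mul s' t')
| cong_addA s t u : cong (Add s (Add t u)) (Add (Add s t) u)
| cong_addC s t : cong (Add s t) (Add t s)
| cong_add0 t : cong (Add (Scal 0) t) t
| cong_addN t : cong (Add (Mul (Scal (-1)) t) t) (Scal 0)
| cong_mulA s t u : cong (Mul s (Mul t u)) (Mul (Mul s t) u)
| cong_mul1 t : cong (Mul (Scal 1) t) t
| cong_mulDl s t u : cong (Mul (Add s t) u) (Add (Mul s u) (Mul t u))
| cong_mulDr s t u : cong (Mul s (Add t u)) (Add (Mul s t) (Mul s u))
| cong_scalC c t : cong (Mul (Scal c) t) (Mul t (Scal c))
| cong_scalD c d : cong (Scal (c + d)) (Add (Scal c) (Scal d))
| cong_scalM c d : cong (Scal (c * d)) (Mul (Scal c) (Scal d)).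

Definition congb (s t : term K G) : bool := `[< cong s t >].

Lemma congb_equiv : equiv_class_of congb.
Proof.
split=> [t|s t|t s u].
- exact/asboolP/cong_refl.
- by apply/asboolP/asboolP; apply: cong_sym.
- by move=> /asboolP st /asboolP tu; apply/asboolP; apply: cong_trans st tu.
Qed.

Canonical congb_equivRel := EquivRelPack congb_equiv.

Fixpoint eval (A : algType K) (f : G -> A) (t : term K G) : A :=
  match t with
  | Gen g => f g
  | Scal c => c%:A
  | Add s t => eval f s + eval f t
  | Mul s t => eval f s * eval f t
  end.

Lemma eval_cong (A : algType K) (f : G -> A) :
  (forall s t, rel s t -> eval f s = eval f t) ->
  forall s t, cong s t -> eval f s = eval f t.
Proof.
move=> frel s t; elim=> {s t} /=.
- exact: frel.
- by [].
- by move=> s t _ ->.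
- by move=> s t u _ -> _ ->.
- by move=> s s' t t' _ -> _ ->.
- by move=> s s' t t' _ -> _ ->.
- by move=> s t u; rewrite addrA.
- by move=> s t; rewrite addrC.
- by move=> t; rewrite scale0r add0r.
- by move=> t; rewrite scaleN1r mulN1r addNr scale0r.
- by move=> s t u; rewrite mulrA.
- by move=> t; rewrite scale1r mul1r.
- by move=> s t u; rewrite mulrDl.
- by move=> s t u; rewrite mulrDr.
- by move=> c t; rewrite -scalerAl -scalerAr mul1r mulr1.
- by move=> c d; rewrite scalerDl.
- by move=> c d; rewrite -scalerAl mul1r scalerA.
Qed.

End Congruence.

Record presentation (K : comNzRingType) := Presentation {
  gens : Type;
  rels : term K gens -> term K gens -> Prop;
  rels_proper : ~ cong rels (Scal 1) (Scal 0)
}.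

Section PresentedAlgebra.
Variables (K : comNzRingType) (P : presentation K).

Local Notation T := (term K (gens P)).
Local Notation "s ~~~ t" := (cong (@rels K P) s t) (at level 70).

Definition palg : Type := {eq_quot (congb_equivRel (@rels K P))}.
HB.instance Definition _ := Choice.on palg.
HB.instance Definition _ : EqQuotient T (congb_equivRel (@rels K P)) palg :=
  EqQuotient.on palg.

Definition pcls (t : T) : palg := \pi_palg t.

Lemma pclsP s t : (pcls s = pcls t) <-> (s ~~~ t).
Proof.
split; first by move=> /eqquotP /asboolP.
by move=> st; apply/eqquotP/asboolP.
Qed.

Lemma pcls_repr x : pcls (repr x) = x.
Proof. exact: reprK. Qed.

Lemma repr_pcls t : repr (pcls t) ~~~ t.
Proof. by apply/pclsP; rewrite pcls_repr. Qed.

Definition padd (x y : palg) : palg := pcls (Add (repr x) (repr y)).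
Definition pmul (x y : palg) : palg := pcls (Mul (repr x) (repr y)).
Definition popp (x : palg) : palg := pcls (Mul (Scal (-1)) (repr x)).
Definition pscale (c : K) (x : palg) : palg := pcls (Mul (Scal c) (repr x)).

Lemma paddE s t : padd (pcls s) (pcls t) = pcls (Add s t).
Proof. by apply/pclsP; apply: cong_add; apply: repr_pcls. Qed.

Lemma pmulE s t : pmul (pcls s) (pcls t) = pcls (Mul s t).
Proof. by apply/pclsP; apply: cong_mul; apply: repr_pcls. Qed.

Lemma poppE t : popp (pcls t) = pcls (Mul (Scal (-1)) t).
Proof. by apply/pclsP/cong_mul; [exact: cong_refl|exact: repr_pcls]. Qed.

Lemma pscaleE c t : pscale c (pcls t) = pcls (Mul (Scal c) t).
Proof. by apply/pclsP/cong_mul; [exact: cong_refl|exact: repr_pcls]. Qed.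

Lemma palg_ind (Q : palg -> Prop) : (forall t, Q (pcls t)) -> forall x, Q x.
Proof. by move=> QT x; rewrite -(pcls_repr x). Qed.

Lemma paddA : associative padd.
Proof.
elim/palg_ind=> s; elim/palg_ind=> t; elim/palg_ind=> u.
by rewrite !paddE; apply/pclsP/cong_addA.
Qed.

Lemma paddC : commutative padd.
Proof.
elim/palg_ind=> s; elim/palg_ind=> t.
by rewrite !paddE; apply/pclsP/cong_addC.
Qed.

Lemma padd0 : left_id (pcls (Scal 0)) padd.
Proof. by elim/palg_ind=> t; rewrite !paddE; apply/pclsP/cong_add0. Qed.

Lemma paddN : left_inverse (pcls (Scal 0)) popp padd.
Proof. by elim/palg_ind=> t; rewrite poppE paddE; apply/pclsP/cong_addN. Qed.

HB.instance Definition _ := GRing.isZmodule.Build palg paddA paddC padd0 paddN.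

Lemma pmulA : associative pmul.
Proof.
elim/palg_ind=> s; elim/palg_ind=> t; elim/palg_ind=> u.
by rewrite !pmulE; apply/pclsP/cong_mulA.
Qed.

Lemma pmul1 : left_id (pcls (Scal 1)) pmul.
Proof. by elim/palg_ind=> t; rewrite pmulE; apply/pclsP/cong_mul1. Qed.

Lemma p1mul : right_id (pcls (Scal 1)) pmul.
Proof.
elim/palg_ind=> t; rewrite pmulE; apply/pclsP.
by apply: cong_trans (cong_mul1 _ t); apply/cong_sym/cong_scalC.
Qed.

Lemma pmulDl : left_distributive pmul padd.
Proof.
elim/palg_ind=> s; elim/palg_ind=> t; elim/palg_ind=> u.
by rewrite !(paddE, pmulE); apply/pclsP/cong_mulDl.
Qed.

Lemma pmulDr : right_distributive pmul padd.
Proof.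
elim/palg_ind=> s; elim/palg_ind=> t; elim/palg_ind=> u.
by rewrite !(paddE, pmulE); apply/pclsP/cong_mulDr.
Qed.

Lemma pone_neq0 : pcls (Scal 1) != 0.
Proof. by apply/eqP => /pclsP; apply: rels_proper. Qed.

HB.instance Definition _ := GRing.Zmodule_isNzRing.Build palg
  pmulA pmul1 p1mul pmulDl pmulDr pone_neq0.

Lemma pscaleA c d x : pscale c (pscale d x) = pscale (c * d) x.
Proof.
elim/palg_ind: x => t; rewrite !pscaleE; apply/pclsP.
apply: cong_trans (cong_mulA _ _ _ _) _.
by apply: cong_mul (cong_refl _ _); apply/cong_sym/cong_scalM.
Qed.

Lemma pscale1 : left_id 1 pscale.
Proof. by elim/palg_ind=> t; rewrite pscaleE; apply/pclsP/cong_mul1. Qed.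

Lemma pscaleDr : right_distributive pscale +%R.
Proof.
move=> c; elim/palg_ind=> s; elim/palg_ind=> t.
by rewrite /GRing.add /= !(paddE, pscaleE); apply/pclsP/cong_mulDr.
Qed.

Lemma pscaleDl x : {morph pscale^~ x : c d / c + d >-> c + d}.
Proof.
elim/palg_ind: x => t c d.
rewrite [RHS]/GRing.add /= !(paddE, pscaleE); apply/pclsP.
apply: cong_trans (cong_mulDl _ _ _ _).
exact: cong_mul (cong_scalD _ _ _) (cong_refl _ _).
Qed.

HB.instance Definition _ := GRing.Zmodule_isLmodule.Build K palg
  pscaleA pscale1 pscaleDr pscaleDl.

Lemma pscaleAl c (x y : palg) : c *: (x * y) = c *: x * y.
Proof.
elim/palg_ind: x => s; elim/palg_ind: y => t.
rewrite /GRing.scale /GRing.mul /= !(pmulE, pscaleE).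
exact/pclsP/cong_mulA.
Qed.

HB.instance Definition _ := GRing.Lmodule_isLalgebra.Build K palg pscaleAl.

Lemma pscaleAr c (x y : palg) : c *: (x * y) = x * (c *: y).
Proof.
elim/palg_ind: x => s; elim/palg_ind: y => t.
rewrite /GRing.scale /GRing.mul /= !(pmulE, pscaleE).
apply/pclsP; apply: cong_trans (cong_mulA _ _ _ _) _.
apply: cong_trans (cong_sym (cong_mulA _ _ _ _)).
exact: cong_mul (cong_scalC _ _ _) (cong_refl _ _).
Qed.

HB.instance Definition _ := GRing.Lalgebra_isAlgebra.Build K palg pscaleAr.

Definition pgen (g : gens P) : palg := pcls (Gen g).

Definition pmap (A : algType K) (f : gens P -> A) (x : palg) : A :=
  eval f (repr x).

Lemma pmapE (A : algType K) (f : gens P -> A) :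
  (forall s t, rels s t -> eval f s = eval f t) ->
  forall t, pmap f (pcls t) = eval f t.
Proof. by move=> frel t; apply: (eval_cong frel); apply: repr_pcls. Qed.

Section PresentedMap.
Variables (A : algType K) (f : gens P -> A).
Hypothesis frel : forall s t, rels s t -> eval f s = eval f t.

Lemma pmap1 : pmap f 1 = 1.
Proof. by rewrite pmapE //= scale1r. Qed.

Lemma pmapM x y : pmap f (x * y) = pmap f x * pmap f y.
Proof.
elim/palg_ind: x => s; elim/palg_ind: y => t.
by rewrite /GRing.mul /= pmulE !pmapE.
Qed.

Lemma pmapD x y : pmap f (x + y) = pmap f x + pmap f y.
Proof.
elim/palg_ind: x => s; elim/palg_ind: y => t.
by rewrite [in LHS]/GRing.add /= paddE !pmapE.
Qed.

Lemma pmapZ c x : pmap f (c *: x) = c *: pmap f x.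
Proof.
elim/palg_ind: x => t.
by rewrite [in LHS]/GRing.scale /= pscaleE !pmapE //= -scalerAl mul1r.
Qed.

End PresentedMap.

End PresentedAlgebra.

Definition CC : numClosedFieldType := (Rdefinitions.R)[i].

Definition sl2 : Type := {M : 'M[CC]_2 | \tr M == 0}.

Inductive sl2_rel : term CC sl2 -> term CC sl2 -> Prop :=
| sl2_add (x y z : sl2) : val z = val x + val y ->
    sl2_rel (Gen z) (Add (Gen x) (Gen y))
| sl2_scale (c : CC) (x z : sl2) : val z = c *: val x ->
    sl2_rel (Gen z) (Mul (Scal c) (Gen x))
| sl2_bracket (x y z : sl2) : val z = val x *m val y - val y *m val x ->
    sl2_rel (Mul (Gen x) (Gen y)) (Add (Mul (Gen y) (Gen x)) (Gen z)).

Lemma sl2_rel_aug s t : sl2_rel s t ->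
  eval (A := CC^o) (fun=> 0) s = eval (A := CC^o) (fun=> 0) t.
Proof. by case=> *; rewrite /= ?(mulr0, addr0). Qed.

Lemma sl2_rel_proper : ~ cong sl2_rel (Scal 1) (Scal 0).
Proof.
move=> /(eval_cong (A := CC^o) sl2_rel_aug)/eqP /=.
by rewrite scale1r scale0r oner_eq0.
Qed.

Definition Usl2 : algType CC := palg (Presentation sl2_rel_proper).

Lemma sl2X_subproof : \tr (delta_mx 0 1 : 'M[CC]_2) == 0.
Proof. by rewrite /mxtrace !big_ord_recl big_ord0 !mxE /= !addr0. Qed.
Lemma sl2Y_subproof : \tr (delta_mx 1 0 : 'M[CC]_2) == 0.
Proof. by rewrite /mxtrace !big_ord_recl big_ord0 !mxE /= !addr0. Qed.
Lemma sl2H_subproof : \tr (delta_mx 0 0 - delta_mx 1 1 : 'M[CC]_2) == 0.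
Proof. by rewrite /mxtrace !big_ord_recl big_ord0 !mxE /= subr0 sub0r addr0 subrr. Qed.

Definition sl2X : sl2 := @exist _ (fun M : 'M_2 => \tr M == 0) _ sl2X_subproof.
Definition sl2Y : sl2 := @exist _ (fun M : 'M_2 => \tr M == 0) _ sl2Y_subproof.
Definition sl2H : sl2 := @exist _ (fun M : 'M_2 => \tr M == 0) _ sl2H_subproof.

Definition UX : Usl2 := pgen (P := Presentation sl2_rel_proper) sl2X.
Definition UY : Usl2 := pgen (P := Presentation sl2_rel_proper) sl2Y.
Definition UH : Usl2 := pgen (P := Presentation sl2_rel_proper) sl2H.

Definition divpow (x : Usl2) (m : nat) : Usl2 := (m`!%:R)^-1 *: x ^+ m.

Definition binUH (c : int) (m : nat) : Usl2 :=
  (m`!%:R)^-1 *: \prod_(i < m) (UH + c%:~R - i%:R).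

Definition UZ : set Usl2 :=
  smallest (fun S : set Usl2 => GRing.subring_closed [in S])
    (range (divpow UX) `|` range (divpow UY)).


Definition UZ_type : Type := {u : Usl2 | u \in UZ}.

Lemma UZ0 : 0 \in UZ.
Proof.
by apply/mem_set => S [[S1 SB SM] _]; move: (SB _ _ S1 S1); rewrite subrr inE.
Qed.

Definition UZ_incl (u : Usl2) : UZ_type :=
  insubd (exist (fun u => u \in UZ) 0 UZ0) u.

Definition aug (u : Usl2) : CC :=
  pmap (P := Presentation sl2_rel_proper) (A := CC^o) (fun=> 0) u.

Lemma aug_int u : u \in UZ -> exists z : int, aug u = z%:~R.
Proof.
rewrite inE => /(_ [set u | exists z : int, aug u = z%:~R]); apply; split.
  split.
  - by rewrite inE; exists 1; rewrite [LHS]pmap1 //; exact: sl2_rel_aug.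
  - move=> x y; rewrite !inE => -[m xm] [n yn]; exists (m - n).
    rewrite -scaleN1r [LHS]pmapD; last exact: sl2_rel_aug.
    rewrite pmapZ; last exact: sl2_rel_aug.
    by rewrite scaleN1r intrB -xm -yn.
  - move=> x y; rewrite !inE => -[m xm] [n yn]; exists (m * n).
    rewrite [LHS]pmapM; last exact: sl2_rel_aug.
    by rewrite intrM -xm -yn.
have augX (x : Usl2) : aug x = 0 -> forall m, exists z : int,
    aug (divpow x m) = z%:~R.
  move=> x0 [|m].
    exists 1; rewrite /divpow expr0 fact0 invr1 scale1r.
    by rewrite [LHS]pmap1 //; exact: sl2_rel_aug.
  exists 0; rewrite /divpow [LHS]pmapZ; last exact: sl2_rel_aug.
  rewrite exprS pmapM; last exact: sl2_rel_aug.
  by rewrite -/(aug x) x0 mul0r scaler0.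
have augg g : aug (pgen (P := Presentation sl2_rel_proper) g) = 0.
  by rewrite [LHS]pmapE //; exact: sl2_rel_aug.
by move=> _ [[m _ <-]|[m _ <-]]; apply: augX; apply: augg.
Qed.

(* U_Z (x)_Z k is the universal k-algebra receiving a ring morphism from U_Z:
   its generators are symbols, one for each element of U_Z, and its relations
   say that these symbols add and multiply as in U_Z. *)
Inductive base_rel (k : fieldType) :
    term k UZ_type -> term k UZ_type -> Prop :=
| base_add (x y z : UZ_type) : sval z = sval x + sval y ->
    base_rel (Gen z) (Add (Gen x) (Gen y))
| base_mul (x y z : UZ_type) : sval z = sval x * sval y ->
    base_rel (Gen z) (Mul (Gen x) (Gen y))
| base_one (z : UZ_type) : sval z = 1 -> base_rel (Gen z) (Scal 1).

Definition aug_base (k : fieldType) (u : UZ_type) : k^o :=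
  (sval (cid (aug_int (svalP u))))%:~R.

Lemma aug_baseE (k : fieldType) (u : UZ_type) (z : int) :
  aug (sval u) = z%:~R -> aug_base k u = z%:~R.
Proof.
rewrite /aug_base; case: cid => n /= -> /eqP.
by rewrite eqr_int => /eqP ->.
Qed.

Lemma base_rel_aug (k : fieldType) s t : @base_rel k s t ->
  eval (A := k^o) (@aug_base k) s = eval (A := k^o) (@aug_base k) t.
Proof.
case=> /= [x y z zE|x y z zE|z zE].
- have [m xm] := aug_int (svalP x); have [n yn] := aug_int (svalP y).
  rewrite (aug_baseE k xm) (aug_baseE k yn) -intrD; apply: aug_baseE.
  by rewrite zE intrD -xm -yn [LHS]pmapD //; exact: sl2_rel_aug.
- have [m xm] := aug_int (svalP x); have [n yn] := aug_int (svalP y).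
  rewrite (aug_baseE k xm) (aug_baseE k yn) -intrM; apply: aug_baseE.
  by rewrite zE intrM -xm -yn [LHS]pmapM //; exact: sl2_rel_aug.
- rewrite scale1r; apply: (@aug_baseE k z 1).
  by rewrite zE [LHS]pmap1 //; exact: sl2_rel_aug.
Qed.

Lemma base_rel_proper (k : fieldType) : ~ cong (@base_rel k) (Scal 1) (Scal 0).
Proof.
move=> /(eval_cong (A := k^o) (@base_rel_aug k))/eqP /=.
by rewrite scale1r scale0r oner_eq0.
Qed.

Definition hyper (k : fieldType) : algType k :=
  palg (Presentation (@base_rel_proper k)).

(* The image in U of an element of U_Z; only to be applied to elements of U_Z,
   such as the divided powers and the elements binUH c m. *)
Definition to_hyper (k : fieldType) (u : Usl2) : hyper k :=
  pgen (P := Presentation (@base_rel_proper k)) (UZ_incl u).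

(* R stands for (the carrier of) a subalgebra of A, and M, N for submodules
   of A regarded as a left R-module by multiplication. *)
Section RadicalSocle.
Variables (k : fieldType) (A : algType k).
Implicit Types (R I J M N S : set A).

Definition subalg_gen S : set A :=
  smallest (fun B : set A => GRing.subalg_closed [in B]) S.

Definition left_ideal R I : Prop :=
  [/\ I `<=` R, GRing.zmod_closed [in I]
    & forall a x, R a -> I x -> I (a * x)].

Definition maximal_left_ideal R I : Prop :=
  [/\ left_ideal R I, I <> R
    & forall J, left_ideal R J -> I `<=` J -> J <> R -> J = I].

Definition jacobson R : set A :=
  [set x | R x /\ forall I, maximal_left_ideal R I -> I x].

(* Finite sums of products x * m, not just the products themselves. *)
Definition setmul J M : set A :=
  smallest (fun S : set A => GRing.zmod_closed [in S])
    [set x * m | x in J & m in M].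

Fixpoint ideal_pow R J (n : nat) : set A :=
  if n is n'.+1 then setmul J (ideal_pow R J n') else R.

Definition radpow R (n : nat) M : set A :=
  if n is 0 then M else setmul (ideal_pow R (jacobson R) n) M.

Definition socpow R (n : nat) M : set A :=
  if n is 0 then [set 0]
  else [set m | M m /\ forall x, ideal_pow R (jacobson R) n x -> x * m = 0].

Definition cyclic_mod R (b : A) : set A := [set x * b | x in R].

Definition mod_iso R M N : Prop :=
  exists f : A -> A,
    [/\ set_bij M N f,
        forall x y, M x -> M y -> f (x + y) = f x + f y
      & forall a x, R a -> M x -> f (a * x) = a * f x].

End RadicalSocle.

(* An element (a, j) of the index set P; j is a rational number so as to
   accommodate the pair (0, 1/2) for p = 2. *)
Definition pair_index : Type := (nat * rat)%type.

Definition calS (p : nat) : seq rat := [seq n%:R | n <- iota 0 (p.-1)./2.+1].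

Definition calP (p : nat) (q : pair_index) : bool :=
  if p == 2%N then q \in [:: (0%N, 1 / 2); (1%N, 0); (1%N, 1)]
  else (q.1 < p)%N && (q.2 \in calS p).

Definition typeA (p : nat) (q : pair_index) : bool :=
  let: (a, j) := q in
  [&& p != 2%N, ~~ odd a, (p%:R - a%:R + 1) / 2 <= j & j <= (p%:R - 1) / 2].

Definition typeC (p : nat) (q : pair_index) : bool :=
  let: (a, j) := q in
  if p == 2%N then q == (1%N, 0)
  else [&& odd a, 0 <= j & j <= (a%:R - 1) / 2].

Definition sAC (p : nat) (q : pair_index) : nat :=
  if p == 2%N then 1%N
  else if odd q.1 then (p - q.1)./2 else (p - q.1).+1./2.

Definition degenerate (p : nat) (q : pair_index) : bool :=
  if p == 2%N then q.1 == 1%N else q.2 == 0.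

Definition calX (p r : nat) (aj : r.-tuple pair_index) : set (r.-tuple bool) :=
  [set eps | forall i : 'I_r, degenerate p (tnth aj i) -> tnth eps i = false].

Definition hamming (r : nat) (eps : r.-tuple bool) : nat := count id eps.

Definition wmax (p r : nat) (aj : r.-tuple pair_index) : nat :=
  count (fun q => ~~ degenerate p q) aj.

Definition tau (p r : nat) (aj : r.-tuple pair_index) : r.-tuple bool :=
  [tuple of [seq ~~ degenerate p q | q <- aj]].

Definition psi (p : nat) : {poly 'F_p} := \prod_(i : 'F_p) ('X - (i ^+ 2)%:P).

(* The boolean eps encodes 0 (false) or 1 (true). *)
Definition psi_eps (p : nat) (eps : bool) (j : rat) : {poly 'F_p} :=
  let s : 'F_p := ratr j in
  if eps then psi p %/ ('X - (s ^+ 2)%:P)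
  else if j == 0 then \prod_(i : 'F_p | i != 0) ('X - (i ^+ 2)%:P)
  else 2%:R *: 'X * ('X + (s ^+ 2)%:P) *
       \prod_(i : 'F_p | [&& i != 0, i != s & i != - s]) ('X - (i ^+ 2)%:P).

Section Hyperalgebra.
Variables (k : fieldType) (p : nat).

Local Notation U := (hyper k).

Definition hX (m : nat) : U := to_hyper k (divpow UX m).
Definition hY (m : nat) : U := to_hyper k (divpow UY m).
Definition binH (c : int) (m : nat) : U := to_hyper k (binUH c m).

Definition Ur (r : nat) : set U :=
  subalg_gen ([set hX (p ^ i)%N | i in `I_r] `|` [set hY (p ^ i)%N | i in `I_r]).

Definition calA : set U :=
  subalg_gen (range (fun i => binH 0 (p ^ i)%N) `|`
              range (fun i => hY (p ^ i)%N * hX (p ^ i)%N)).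

Definition calAr (r : nat) : set U := calA `&` Ur r.

(* As the Y^(m) binom(H, n) X^(m') form a basis of U, exactly one map satisfies
   the condition. *)
Definition Fr' : U -> U :=
  xget (fun=> 0) [set f : U -> U | linear f /\
    forall m n m' : nat,
      f (hY m * binH 0 n * hX m') =
      hY (m * p)%N * binH 0 (n * p)%N * hX (m' * p)%N].

Definition mu (a : nat) : U := binH (- a%:Z - 1) p.-1.

(* Meaningful when k has characteristic p. *)
Definition Fp_in (c : 'F_p) : k := (c : nat)%:R.

Definition B1 (eps : bool) (q : pair_index) : U :=
  let: (a, j) := q in
  if p == 2%N then
    if a == 0%N then if eps then mu 0 * hY 1 * hX 1 else mu 0
    else if j == 0 then mu 1 * hY 1 * hX 1
    else mu 1 * hY 1 * hX 1 + mu 1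
  else
    horner_alg
      (mu a * hY 1 * hX 1 + (Fp_in ((a.+1%:R / 2%:R) ^+ 2))%:A)
      (map_poly Fp_in (psi_eps p eps j)) * mu a.

(* Such coefficients c_m, 0 <= m <= p - 1, exist and are unique for q in P. *)
Definition Bcoef (eps : bool) (q : pair_index) : {ffun 'I_p -> 'F_p} :=
  xget [ffun=> 0] [set c : {ffun 'I_p -> 'F_p} |
    B1 eps q = mu q.1 * \sum_(m < p) Fp_in (c m) *: (hY 1 ^+ m * hX 1 ^+ m)].

(* The pairs of P that are not of type (A) or (C) are those of types (B), (D). *)
Definition Zmap (eps : bool) (z : U) (q : pair_index) : U :=
  if typeA p q || typeC p q then
    mu q.1 * \sum_(m < p | (sAC p q <= m)%N) Fp_in (Bcoef eps q m) *:
      (hY 1 ^+ m * hX 1 ^+ (m - sAC p q) * Fr' z * hX 1 ^+ sAC p q)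
  else Fr' z * B1 eps q.

Fixpoint Brec (l : seq (bool * pair_index)) : U :=
  match l with
  | [::] => 1
  | [:: (e, q)] => B1 e q
  | (e, q) :: l' => Zmap e (Brec l') q
  end.

Definition Bvec (r : nat) (eps : r.-tuple bool) (aj : r.-tuple pair_index) : U :=
  Brec (zip eps aj).

Definition simple_mod (r : nat) (aj : r.-tuple pair_index) : set U :=
  cyclic_mod (calAr r) (Bvec (tau p aj) aj).

End Hyperalgebra.

Arguments calAr : clear implicits.
Arguments Bvec k p {r} eps aj.
Arguments simple_mod k p {r} aj.

(* Main.v *)
(* In the Kostant form, the coefficient F of Y^(m) F(H) X^(l) is an
   integer-valued polynomial, and u |-> F(h) gives integral functionals phi_(m,l,h),
   hence coordinates on the hyperalgebra.  Let e, n be B^(0)(a,j), B^(1)(a,j).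
   Then e is idempotent, en = n, n^2 = 0, both commute with X^(pm), Y^(pm) and H,
   and Y^(t) X^(t) e is a combination of e and n for t < p.  The linear map
     G : Y^(m) binom(H,t) X^(l) |-> Y^(pm) binom(H+2s,pt) X^(pl) e
   is multiplicative: the middle terms in the commutator of X^(pm) and Y^(pn) add up
   to a multiple delta of e, where delta is 0 for the types (B), (D) and 1 for
   (A), (C), and Pascal's rule absorbs delta.  As Z^(eps)(z; (a,j)) = G(z) B^(eps)(a,j)
   for z of weight zero, induction on r shows that the B^(eps) multiply like squarefree
   monomials B_S, S a subset of D = {s | j_s <> 0}: B_S B_T is B_(S u T) if S and T
   are disjoint and 0 otherwise, and A_r B_0 is spanned by the B_S.  Hence A_r acts
   on A_r B_S through k[x_s | s in D]/(x_s^2), and both rad^i and soc^i are spans of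
   the B_T with T containing S and |T| bounded below. *)
From HB Require Import structures.
Require Import Defs.
From mathcomp Require Import all_boot all_order all_algebra finfield.
From mathcomp Require Import boolp classical_sets functions.
From mathcomp Require Import complex Rstruct ring lra zify.

Set Implicit Arguments.
Unset Strict Implicit.
Unset Printing Implicit Defensive.

Import Order.TTheory GRing.Theory Num.Theory.
Local Open Scope ring_scope.
Local Open Scope classical_set_scope.

(** * Integer-valued polynomials in H and the Kostant form *)

(** The hyperalgebra is a quotient by relations, so neither the independence of the Kostant basis
    nor B_D <> 0 comes for free: both are read off the functionals phi. For B_D this is the
    coefficient of Y^(q-1) F(H) X^(q-1), q = p^r, summed over a period of h; each step in r
    multiplies that sum by a nonzero constant. For odd p, rank one takes place in F_p[x]/(psi). On
    weights congruent to a modulo p, Y^m X^m is the product over l < m of x - ((a+1)/2 + l)^2, where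
    x = YX + ((a+1)/2)^2; for m = p this is psi, and Y^p X^p = 0. If j <> 0, then j^2 is a double
    root of psi, e is the idempotent of that root and n is a multiple of (x - j^2) e; if j = 0, the
    root is simple and n = e. The types say which products contain the roots j and -j. For (A), (C)
    neither occurs in the first s factors, so Y^(s) X^(s) is invertible on e and conjugation by it
    yields delta = 1. For (B), (D) both occur in the first p - a factors, so every middle term with
    a nonzero coefficient kills e. *)

Definition binz (z : int) (n : nat) : int :=
  match z with
  | Posz m => 'C(m, n)%:Z
  | Negz m => (-1) ^+ n * 'C(m + n, n)%:Z
  end.

Lemma binz_nat (m n : nat) : binz m%:Z n = 'C(m, n)%:Z.
Proof. by []. Qed.

(** This characterizes [binz] up to cancellation of n!, so the recursions below become identities
    between products of integers. At negative arguments [binz] is given by upper negation. *)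
Lemma binz_fact (z : int) (n : nat) :
  (n`!)%:Z * binz z n = \prod_(i < n) (z - i%:Z).
Proof.
case: z => m; rewrite /binz.
  rewrite -PoszM mulnC bin_ffact; elim: n => [|n IH]; first by rewrite big_ord0.
  rewrite big_ord_recr /= -IH ffactnSr PoszM.
  case: (leqP n m) => nm; first by rewrite subzn.
  by rewrite ffact_small // !mul0r.
rewrite mulrCA -PoszM mulnC bin_ffact; elim: n => [|n IH].
  by rewrite big_ord0.
rewrite big_ord_recr /= -IH addnS ffactnS /= exprS NegzE PoszM.
have -> : (m + n).+1%:Z = - (- m.+1%:Z - n%:Z) by lia.
ring.
Qed.

Lemma binz0 z : binz z 0 = 1.
Proof. by case: z => m; rewrite /binz ?addn0 !bin0 // expr0. Qed.

Lemma binzS (z : int) (n : nat) : (n.+1)%:Z * binz z n.+1 = (z - n%:Z) * binz z n.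
Proof.
have n0 : (n`!)%:Z != 0 by rewrite eqz_nat -lt0n fact_gt0.
apply: (mulfI n0); rewrite mulrA -PoszM mulnC -factS binz_fact big_ord_recr /=.
by rewrite -binz_fact; ring.
Qed.

Lemma binz_pascal (z : int) (n : nat) : binz (z + 1) n.+1 = binz z n.+1 + binz z n.
Proof.
have n0 : (n.+1`!)%:Z != 0 by rewrite eqz_nat -lt0n fact_gt0.
apply: (mulfI n0); rewrite binz_fact mulrDr binz_fact big_ord_recl /=.
rewrite factS PoszM -mulrA binz_fact big_ord_recr /= subr0.
rewrite (eq_bigr (fun i : 'I_n => z - i%:Z)); last by move=> i _; rewrite /bump /=; lia.
ring.
Qed.

Lemma binz_vdm (z : int) (m n : nat) :
  binz (z + m%:Z) n = \sum_(j < n.+1) binz z (n - j) * 'C(m, j)%:Z.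
Proof.
elim: m n => [|m IH] n.
  rewrite addr0 big_ord_recl /= subn0 bin0 mulr1 big1 ?addr0 // => j _.
  by rewrite /bump /= add1n bin0n mulr0.
case: n => [|n].
  by rewrite binz0 big_ord_recl big_ord0 binz0 bin0 addr0.
have -> : z + m.+1%:Z = (z + m%:Z) + 1 by lia.
rewrite binz_pascal !IH [RHS]big_ord_recl [X in X + _ = _]big_ord_recl /=.
rewrite !bin0 !subn0 !mulr1 -!addrA; congr (_ + _).
rewrite -big_split /=; apply: eq_bigr => j _.
by rewrite /bump /= !add1n subSS binS PoszD mulrDr.
Qed.

Section EvalModule.
Variables (K : comNzRingType) (G D : Type) (act : G -> (D -> K) -> D -> K).

(** A module is given by operators attached to the generators. Letting terms act directly on
    functions avoids packaging the endomorphisms as an algebra, which [eval] would require. *)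
Fixpoint evalm (t : term K G) (f : D -> K) : D -> K :=
  match t with
  | Gen g => act g f
  | Scal c => fun d => c * f d
  | Add s t => fun d => evalm s f d + evalm t f d
  | Mul s t => evalm s (evalm t f)
  end.

(* The relations of an algebra need only hold on the functions satisfying [inv]. *)
Variable inv : (D -> K) -> Prop.
Hypothesis inv_add : forall f g, inv f -> inv g -> inv (fun d => f d + g d).
Hypothesis inv_scale : forall c f, inv f -> inv (fun d => c * f d).
Hypothesis inv_act : forall x f, inv f -> inv (act x f).
Hypothesis act_add : forall x f g,
  act x (fun d => f d + g d) = fun d => act x f d + act x g d.
Hypothesis act_scale : forall x c f,
  act x (fun d => c * f d) = fun d => c * act x f d.

Lemma evalm_inv t f : inv f -> inv (evalm t f).
Proof.
elim: t f => [g|c|s IHs t IHt|s IHs t IHt] f invf /=.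
- exact: inv_act.
- exact: inv_scale.
- by apply: inv_add; [apply: IHs|apply: IHt].
- by apply: IHs; apply: IHt.
Qed.

Lemma evalm_add t f g :
  evalm t (fun d => f d + g d) = fun d => evalm t f d + evalm t g d.
Proof.
elim: t f g => [x|c|s IHs t IHt|s IHs t IHt] f g /=.
- exact: act_add.
- by apply/funext => d; rewrite mulrDr.
- by apply/funext => d; rewrite IHs IHt addrACA.
- by rewrite IHt IHs.
Qed.

Lemma evalm_scale t c f :
  evalm t (fun d => c * f d) = fun d => c * evalm t f d.
Proof.
elim: t f => [x|b|s IHs t IHt|s IHs t IHt] f /=.
- exact: act_scale.
- by apply/funext => d; rewrite mulrCA.
- by apply/funext => d; rewrite IHs IHt mulrDr.
- by rewrite IHt IHs.
Qed.

Lemma evalm_cong (rel : term K G -> term K G -> Prop) :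
  (forall s t, rel s t -> forall f, inv f -> evalm s f = evalm t f) ->
  forall s t, cong rel s t -> forall f, inv f -> evalm s f = evalm t f.
Proof.
move=> H s t; elim=> {s t} /=.
- exact: H.
- by [].
- by move=> s t _ IH f /IH ->.
- by move=> s t u _ IH1 _ IH2 f invf; rewrite IH1 // IH2.
- by move=> s s' t t' _ IH1 _ IH2 f invf; rewrite IH1 // IH2.
- move=> s s' t t' _ IH1 _ IH2 f invf; rewrite IH2 //.
  by apply: IH1; apply: evalm_inv.
- by move=> s t u f _; apply/funext => d; rewrite addrA.
- by move=> s t f _; apply/funext => d; rewrite addrC.
- by move=> t f _; apply/funext => d; rewrite mul0r add0r.
- by move=> t f _; apply/funext => d; rewrite mul0r mulN1r addNr.
- by [].
- by move=> t f _; apply/funext => d; rewrite mul1r.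
- by [].
- by move=> s t u f _; rewrite evalm_add.
- by move=> c t f _; rewrite evalm_scale.
- by move=> c d f _; apply/funext => x; rewrite mulrDl.
- by move=> c d f _; apply/funext => x; rewrite mulrA.
Qed.

End EvalModule.

(** * Commutation rules in the enveloping algebra of sl2 *)

Lemma sl2_pgenZ c (x z : sl2) : val z = c *: val x ->
  pgen (P := Presentation sl2_rel_proper) z =
  c *: pgen (P := Presentation sl2_rel_proper) x.
Proof.
move=> h; rewrite /pgen [RHS]/GRing.scale /= pscaleE; apply/pclsP.
by apply: cong_rel; apply: sl2_scale.
Qed.

Lemma sl2_pgenM (x y z : sl2) : val z = val x *m val y - val y *m val x ->
  pgen (P := Presentation sl2_rel_proper) x * pgen (P := Presentation sl2_rel_proper) y =
  pgen (P := Presentation sl2_rel_proper) y * pgen (P := Presentation sl2_rel_proper) x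
  + pgen (P := Presentation sl2_rel_proper) z.
Proof.
move=> h; rewrite /pgen /GRing.mul /GRing.add /= !pmulE paddE; apply/pclsP.
by apply: cong_rel; apply: sl2_bracket.
Qed.

Lemma UXY : UX * UY = UY * UX + UH.
Proof.
apply: sl2_pgenM => /=.
by apply/matrixP => i j; rewrite !mxE !big_ord_recl !big_ord0 !mxE;
  case: i => -[|[|[]]] //= ?; case: j => -[|[|[]]] //= ?;
  rewrite ?(mulr0, mul0r, mulr1, addr0, add0r, subr0, sub0r, mulr0n).
Qed.

Lemma trace_sl2Z (c : CC) (x : sl2) : \tr (c *: val x) == 0.
Proof. by rewrite mxtraceZ (eqP (valP x)) mulr0. Qed.

Lemma UHX : UH * UX = UX * (UH + 2%:R).
Proof.
pose z : sl2 := exist (fun M : 'M[CC]_2 => \tr M == 0) _ (trace_sl2Z 2%:R sl2X).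
have -> : UH * UX = UX * UH + pgen (P := Presentation sl2_rel_proper) z.
  apply: sl2_pgenM => /=.
  by apply/matrixP => i j; rewrite !mxE !big_ord_recl !big_ord0 !mxE;
    case: i => -[|[|[]]] //= ?; case: j => -[|[|[]]] //= ?;
    rewrite ?(mulr0, mul0r, mulr1, addr0, add0r, subr0, sub0r, mulr0n, mulrN, mulNr) //=; ring.
rewrite (@sl2_pgenZ 2%:R sl2X) // mulrDr; congr (_ + _).
by rewrite mulr_natr scaler_nat.
Qed.

Lemma UHY : UH * UY = UY * (UH - 2%:R).
Proof.
pose z : sl2 := exist (fun M : 'M[CC]_2 => \tr M == 0) _ (trace_sl2Z (- 2%:R) sl2Y).
have -> : UH * UY = UY * UH + pgen (P := Presentation sl2_rel_proper) z.
  apply: sl2_pgenM => /=.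
  by apply/matrixP => i j; rewrite !mxE !big_ord_recl !big_ord0 !mxE;
    case: i => -[|[|[]]] //= ?; case: j => -[|[|[]]] //= ?;
    rewrite ?(mulr0, mul0r, mulr1, addr0, add0r, subr0, sub0r, mulr0n, mulrN, mulNr) //=; ring.
rewrite (@sl2_pgenZ (- 2%:R) sl2Y) // mulrBr; congr (_ + _).
by rewrite mulr_natr scaleNr scaler_nat.
Qed.

(** Integer-valued polynomials are represented by their values on the integers. The values determine
    the polynomial, so identities between polynomials in H become identities between integers. *)
Definition interp (F : int -> int) : set {poly CC} :=
  [set P | forall h : int, P.[h%:~R] = (F h)%:~R].

Definition ipf (F : int -> int) : Prop := exists P, interp F P.

(* Meaningful only when [ipf F]. *)
Definition hU (F : int -> int) : Usl2 := horner_alg UH (xget 0 (interp F)).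

Lemma interp_uniq F P Q : interp F P -> interp F Q -> P = Q.
Proof.
move=> FP FQ; apply/eqP; rewrite -subr_eq0; apply/eqP.
apply: (@roots_geq_poly_eq0 _ _ [seq i%:R | i <- iota 0 (size (P - Q))]).
- apply/allP => _ /mapP[i _ ->].
  by rewrite rootE hornerD hornerN (FP i) (FQ i) subrr.
- rewrite map_inj_uniq ?iota_uniq //.
  by move=> i j /eqP; rewrite eqr_nat => /eqP.
- by rewrite size_map size_iota.
Qed.

Lemma hUE F P : interp F P -> hU F = horner_alg UH P.
Proof.
move=> FP; rewrite /hU; congr (horner_alg _ _).
by apply: (@interp_uniq F) => //; apply: (xgetI 0 FP).
Qed.

Lemma interp_cst c : interp (fun=> c) (c%:~R)%:P.
Proof. by move=> h; rewrite hornerC. Qed.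
Lemma interp_id : interp id 'X.
Proof. by move=> h; rewrite hornerX. Qed.
Lemma interpD F G P Q : interp F P -> interp G Q -> interp (fun h => F h + G h) (P + Q).
Proof. by move=> FP GQ h; rewrite hornerD FP GQ intrD. Qed.
Lemma interpM F G P Q : interp F P -> interp G Q -> interp (fun h => F h * G h) (P * Q).
Proof. by move=> FP GQ h; rewrite hornerM FP GQ intrM. Qed.
Lemma interp_shift F P c : interp F P ->
  interp (fun h => F (h + c)) (P \Po ('X + (c%:~R)%:P)).
Proof. by move=> FP h; rewrite horner_comp hornerD hornerX hornerC -intrD FP. Qed.
Lemma interp_binz n :
  interp (binz^~ n) ((n`!%:R)^-1 *: \prod_(i < n) ('X - (i%:R)%:P)).
Proof.
move=> h; rewrite hornerZ horner_prod.
have n0 : n`!%:R != 0 :> CC by rewrite pnatr_eq0 -lt0n fact_gt0.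
apply: (mulfI n0); rewrite mulrA divff // mul1r -[n`!%:R]/((n`!)%:Z%:~R).
rewrite -intrM binz_fact rmorph_prod; apply: eq_bigr => i _.
rewrite hornerD hornerX hornerN hornerC. by rewrite rmorphB.
Qed.

Lemma ipf_cst c : ipf (fun=> c). Proof. by eexists; apply: interp_cst. Qed.
Lemma ipf_id : ipf id. Proof. by eexists; apply: interp_id. Qed.
Lemma ipfD F G : ipf F -> ipf G -> ipf (fun h => F h + G h).
Proof. by move=> [P FP] [Q GQ]; eexists; apply: interpD FP GQ. Qed.
Lemma ipfM F G : ipf F -> ipf G -> ipf (fun h => F h * G h).
Proof. by move=> [P FP] [Q GQ]; eexists; apply: interpM FP GQ. Qed.
Lemma ipfN F : ipf F -> ipf (fun h => - F h).
Proof.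
move=> /(ipfM (ipf_cst (-1))) [P FP]; exists P => h.
by rewrite FP mulN1r.
Qed.
Lemma ipf_shift F c : ipf F -> ipf (fun h => F (h + c)).
Proof. by move=> [P FP]; eexists; apply: interp_shift FP. Qed.
Lemma ipf_binz n : ipf (binz^~ n). Proof. by eexists; apply: interp_binz. Qed.
Lemma ipf_binzD n c : ipf (fun h => binz (h + c) n).
Proof. exact: ipf_shift (ipf_binz n). Qed.
Lemma ipf_sum (I : Type) (s : seq I) (P : pred I) (F : I -> int -> int) :
  (forall i, P i -> ipf (F i)) -> ipf (fun h => \sum_(i <- s | P i) F i h).
Proof.
move=> H; elim: s => [|i s IH].
  by have [P0 h0] := ipf_cst 0; exists P0 => h; rewrite h0 big_nil.
case: (boolP (P i)) => Pi; last first.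
  by case: IH => Q hQ; exists Q => h; rewrite hQ big_cons (negbTE Pi).
by have [Q hQ] := ipfD (H i Pi) IH; exists Q => h; rewrite hQ big_cons Pi.
Qed.

Lemma hU_cst c : hU (fun=> c) = (c%:~R)%:A.
Proof. by rewrite (hUE (interp_cst c)) /= horner_algC. Qed.
Lemma hU_id : hU id = UH.
Proof. by rewrite (hUE interp_id) /= horner_algX. Qed.
Lemma hUD F G : ipf F -> ipf G -> hU (fun h => F h + G h) = hU F + hU G.
Proof.
move=> [P FP] [Q GQ].
by rewrite (hUE (interpD FP GQ)) (hUE FP) (hUE GQ) rmorphD.
Qed.
Lemma hUM F G : ipf F -> ipf G -> hU (fun h => F h * G h) = hU F * hU G.
Proof.
move=> [P FP] [Q GQ].
by rewrite (hUE (interpM FP GQ)) (hUE FP) (hUE GQ) rmorphM.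
Qed.
Lemma hUZ c F : ipf F -> hU (fun h => c * F h) = c%:~R *: hU F.
Proof. by move=> iF; rewrite hUM ?hU_cst -?scalerAl ?mul1r //; apply: ipf_cst. Qed.
Lemma hU_sum (I : Type) (s : seq I) (P : pred I) (F : I -> int -> int) :
  (forall i, P i -> ipf (F i)) ->
  hU (fun h => \sum_(i <- s | P i) F i h) = \sum_(i <- s | P i) hU (F i).
Proof.
move=> H; elim: s => [|i s IH].
  rewrite big_nil -[RHS](scale0r 1) -[0 in RHS]/(0%:~R) -hU_cst; congr hU.
  by apply/funext => h; rewrite big_nil.
rewrite big_cons -IH; case: (boolP (P i)) => Pi.
  rewrite -hUD; [|exact: H|exact: ipf_sum].
  by congr hU; apply/funext => h; rewrite big_cons Pi.
by congr hU; apply/funext => h; rewrite big_cons (negbTE Pi).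
Qed.

Lemma binUHE c n : binUH c n = hU (fun h => binz (h + c) n).
Proof.
rewrite /binUH (hUE (interp_shift c (interp_binz n))) comp_polyZ linearZ /=.
rewrite mulr_algl; congr (_ *: _); rewrite [_ \Po _]rmorph_prod rmorph_prod; apply: eq_bigr => i _.
rewrite /= comp_polyB comp_polyX comp_polyC !rmorphB !rmorphD /= horner_algX.
by rewrite !horner_algC scaler_int scaler_nat.
Qed.

Lemma horner_alg_shift (z : Usl2) (d : CC) P : UH * z = z * (UH + d%:A) ->
  horner_alg UH P * z = z * horner_alg UH (P \Po ('X + d%:P)).
Proof.
move=> Hz; elim/poly_ind: P => [|P c IH].
  by rewrite comp_poly0 !rmorph0 mul0r mulr0.
rewrite comp_polyD comp_polyM comp_polyX comp_polyC.
rewrite !(rmorphD (horner_alg UH)) !(rmorphM (horner_alg UH)) /=.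
rewrite !(rmorphD (horner_alg UH)) /= !horner_algX !horner_algC.
rewrite mulrDl [RHS]mulrDr -mulrA Hz [in LHS]mulrA IH -mulrA; congr (_ + _).
by rewrite -scalerAl -scalerAr mul1r mulr1.
Qed.

Lemma horner_UHX P : horner_alg UH P * UX = UX * horner_alg UH (P \Po ('X + (2%:Z%:~R)%:P)).
Proof. by apply: horner_alg_shift; rewrite UHX scaler_nat. Qed.

Lemma horner_UHY P : horner_alg UH P * UY = UY * horner_alg UH (P \Po ('X + ((-2)%:~R)%:P)).
Proof. by apply: horner_alg_shift; rewrite UHY scaleNr scaler_nat. Qed.

Lemma hU_X F : ipf F -> hU F * UX = UX * hU (fun h => F (h + 2)).
Proof.
move=> [P FP]; rewrite (hUE FP) horner_UHX; congr (_ * _).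
by rewrite (hUE (interp_shift 2 FP)).
Qed.

Lemma hU_Y F : ipf F -> hU F * UY = UY * hU (fun h => F (h - 2)).
Proof.
move=> [P FP]; rewrite (hUE FP) horner_UHY; congr (_ * _).
by rewrite (hUE (interp_shift (-2) FP)).
Qed.

Lemma divpowE x m : divpow x m = (m`!%:R)^-1 *: x ^+ m.
Proof. by []. Qed.
Lemma divpow0 x : divpow x 0 = 1.
Proof. by rewrite /divpow expr0 fact0 invr1 scale1r. Qed.
Lemma divpow1 x : divpow x 1 = x.
Proof. by rewrite /divpow expr1 factS fact0 invr1 scale1r. Qed.

Lemma divpowM x m n : divpow x m * divpow x n = 'C(m + n, m)%:R *: divpow x (m + n).
Proof.
rewrite /divpow -scalerAl -scalerAr -exprD !scalerA; congr (_ *: _).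
have f0 i : i`!%:R != 0 :> CC by rewrite pnatr_eq0 -lt0n fact_gt0.
have := bin_fact (leq_addr n m); rewrite addKn => <-; rewrite !natrM.
have b0 : 'C(m + n, m)%:R != 0 :> CC by rewrite pnatr_eq0 -lt0n bin_gt0 leq_addr.
by field; rewrite !f0 b0.
Qed.

Lemma divpowS x m : x * divpow x m = m.+1%:R *: divpow x m.+1.
Proof. by rewrite -{1}[x]divpow1 divpowM add1n bin1. Qed.

Lemma hU_expX F m : ipf F -> hU F * UX ^+ m = UX ^+ m * hU (fun h => F (h + 2 * m%:Z)).
Proof.
move=> iF; elim: m => [|m IH].
  by rewrite mul1r mulr1; congr hU; apply/funext => h; rewrite mulr0 addr0.
rewrite exprSr mulrA IH -mulrA hU_X; last exact: ipf_shift.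
by rewrite mulrA; congr (_ * hU _); apply/funext => h; congr F; lia.
Qed.

Lemma hU_expY F m : ipf F -> hU F * UY ^+ m = UY ^+ m * hU (fun h => F (h - 2 * m%:Z)).
Proof.
move=> iF; elim: m => [|m IH].
  by rewrite mul1r mulr1; congr hU; apply/funext => h; rewrite mulr0 subr0.
rewrite exprSr mulrA IH -mulrA hU_Y; last exact: ipf_shift.
by rewrite mulrA; congr (_ * hU _); apply/funext => h; congr F; lia.
Qed.

Lemma hU_divX F m : ipf F ->
  hU F * divpow UX m = divpow UX m * hU (fun h => F (h + 2 * m%:Z)).
Proof. by move=> iF; rewrite /divpow -scalerAr hU_expX // scalerAl. Qed.

Lemma hU_divY F m : ipf F ->
  hU F * divpow UY m = divpow UY m * hU (fun h => F (h - 2 * m%:Z)).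
Proof. by move=> iF; rewrite /divpow -scalerAr hU_expY // scalerAl. Qed.

Lemma UX_expY n :
  UX * UY ^+ n.+1 = UY ^+ n.+1 * UX + n.+1%:R *: (UY ^+ n * hU (fun h => h - n%:Z)).
Proof.
have iH c : ipf (fun h => h + c) by apply: ipf_shift ipf_id.
elim: n => [|n IH].
  rewrite expr1 expr0 scale1r mul1r UXY; congr (_ + _).
  by rewrite -hU_id; congr hU; apply/funext => h; rewrite subr0.
rewrite exprSr mulrA IH mulrDl -mulrA UXY mulrDr mulrA -exprSr -addrA; congr (_ + _).
rewrite -scalerAl -mulrA hU_Y // mulrA -exprSr -hU_id.
rewrite -(_ : n.+1%:Z%:~R = n.+1%:R :> CC) // -(_ : n.+2%:Z%:~R = n.+2%:R :> CC) //.
rewrite !scalerAr -mulrDr; congr (_ * _).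
have iH' : ipf (fun h : int => h - 2 - n%:Z).
  by have [P hP] := iH (- 2 - n%:Z); exists P => h; rewrite hP addrA.
rewrite -!hUZ // -hUD; [|exact: ipf_id|exact: ipfM (ipf_cst _) iH'].
by congr hU; apply/funext => h; lia.
Qed.

(** The case i > n must give 0, whereas the truncated difference would give Y^(0) = 1. *)
Definition ydiv (n i : nat) : Usl2 := if (i <= n)%N then divpow UY (n - i) else 0.

Lemma UX_ydiv n i :
  UX * ydiv n i = ydiv n i * UX + ydiv n i.+1 * hU (fun h => h - n%:Z + i.+1%:Z).
Proof.
rewrite /ydiv; case: (ltngtP i n) => [lt_in|_|->].
- rewrite subnS; have := UX_expY (n - i).-1; rewrite prednK ?subn_gt0 // => E.
  rewrite /divpow -scalerAr E scalerDr scalerAl; congr (_ + _).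
  have -> : hU (fun h => h - n%:Z + i.+1%:Z) = hU (fun h => h - ((n - i).-1)%:Z).
    by congr hU; apply/funext => h; lia.
  rewrite -scalerAl scalerA; congr (_ *: _).
  have /prednK {1 2}<- : (0 < n - i)%N by rewrite subn_gt0.
  rewrite factS natrM invfM mulrAC mulVf ?mul1r //.
  by rewrite pnatr_eq0.
- by rewrite mulr0 !mul0r addr0.
- by rewrite subnn divpow0 mulr1 mul1r mul0r addr0.
Qed.

(** Kostant's commutation formula, by induction on m: since (m+1) X^(m+1) = X X^(m), it suffices to
    move one X across each Y^(n-i) with [UX_ydiv]. *)
Lemma divXY m n : divpow UX m * divpow UY n =
  \sum_(i < m.+1) ydiv n i * hU (fun h => binz (h - m%:Z - n%:Z + 2 * i%:Z) i)
                  * divpow UX (m - i).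
Proof.
have ipfb (m0 n0 i : nat) (c : int) : ipf (fun h => binz (h - m0%:Z - n0%:Z + 2 * i%:Z + c) i).
  have [P hP] := ipf_binzD i (- m0%:Z - n0%:Z + 2 * i%:Z + c).
  by exists P => h; rewrite hP !addrA.
have ipfb0 (m0 n0 i : nat) : ipf (fun h => binz (h - m0%:Z - n0%:Z + 2 * i%:Z) i).
  by have [P hP] := ipfb m0 n0 i 0; exists P => h; rewrite hP addr0.
elim: m => [|m IH].
  rewrite divpow0 mul1r big_ord_recl big_ord0 addr0 /ydiv /= !subn0. rewrite mulr1.
  rewrite -[LHS]mulr1; congr (_ * _); rewrite -(scale1r 1) -[X in X *: _]/(1%:~R) -hU_cst.
  by congr hU; apply/funext => h; rewrite binz0.
have m0 : m.+1%:R != 0 :> CC by rewrite pnatr_eq0.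
apply: (scalerI m0); rewrite scalerAl -divpowS -mulrA IH mulr_sumr.
pose b (c : int) (i : nat) := fun h => binz (h - m%:Z - n%:Z + 2 * i%:Z + c) i.
have ib c i : ipf (b c i) by exact: (ipfb m n i c).
have il (c : int) : ipf (fun h : int => h - n%:Z + c).
  by have [P hP] := ipf_shift (- n%:Z + c) ipf_id; exists P => h; rewrite hP addrA.
(* [T1] collects the terms in which X has passed Y^(n-i), and [T2] those in which it has turned it
   into Y^(n-i-1). Index i of [T2] therefore meets index i + 1 of [T1]. *)
pose T1 (i : nat) := ydiv n i * hU (fun h => (m.+1 - i)%N%:Z * b (-2) i h) * divpow UX (m.+1 - i).
pose T2 (i : nat) := ydiv n i.+1 * hU (fun h => (h - n%:Z + i.+1%:Z) * b 0 i h) * divpow UX (m - i).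
transitivity (\sum_(i < m.+1) (T1 i + T2 i)).
  apply: eq_bigr => i _; rewrite !mulrA UX_ydiv [X in X * _ = _]mulrDl [LHS]mulrDl; congr (_ + _); last first.
    rewrite /T2 hUM //.
    rewrite -!mulrA; congr (_ * (_ * (hU _ * _))).
    by apply/funext => h; rewrite /b addr0.
  rewrite /T1 hUZ //.
  have E : UX * hU (fun h => binz (h - m%:Z - n%:Z + 2 * i%:Z) i) = hU (b (-2) i) * UX.
    rewrite hU_X //; congr (_ * hU _); apply/funext => h; rewrite /b; congr binz; lia.
  rewrite -[ydiv n i * UX * _]mulrA E -!mulrA divpowS -subSn; last by rewrite -ltnS.
  by rewrite -[in LHS]scalerAr -[in RHS]scalerAl.
rewrite big_split /= scaler_sumr.
pose S1 i := ydiv n i * hU (fun h => (m.+1 - i)%N%:Z * b (-2) i h) * divpow UX (m.+1 - i).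
pose S2 i := if i is j.+1 then T2 j else 0.
transitivity (\sum_(i < m.+2) (S1 i + S2 i)).
  rewrite big_split /=; congr (_ + _).
    rewrite [RHS]big_ord_recr /= [X in _ = _ + X]/S1 subnn.
    rewrite (_ : hU _ = 0) ?mulr0 ?mul0r ?addr0 // -[RHS](scale0r 1) -[0 in RHS]/(0%:~R) -hU_cst.
    by congr hU; apply/funext => h; rewrite mul0r.
  by rewrite [RHS]big_ord_recl /= add0r.
apply: eq_bigr => -[[|i] /= lti] _.
  rewrite addr0 /S1 subn0 -[m.+1%:R]/(m.+1%:Z%:~R) scalerAl scalerAr -hUZ //.
  by congr (_ * hU _ * _); apply/funext => h; rewrite /b !binz0.
rewrite /S1 /T2 !subSS -!mulrDl -!mulrDr.
rewrite -hUD; [|exact: ipfM (ipf_cst _) (ib _ _)|exact: ipfM].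
rewrite -[m.+1%:R]/(m.+1%:Z%:~R) scalerAl scalerAr -hUZ //.
congr (_ * hU _ * _); apply/funext => h; rewrite /b.
set t := h - m%:Z - n%:Z + 2 * i.+1%:Z + -2.
have -> : h - m.+1%:Z - n%:Z + 2 * i.+1%:Z = t + 1 by rewrite /t; lia.
have -> : h - m%:Z - n%:Z + 2 * i%:Z + 0 = t by rewrite /t; lia.
(* With t = h - m - n + 2i the claim is (m+1) binom(t+1,i+1) = (m-i) binom(t,i+1) + (t+m-i+1)
   binom(t,i). It follows from Pascal's rule and (i+1) binom(t,i+1) = (t-i) binom(t,i). *)
rewrite binz_pascal.
have E : (m - i)%:Z = m%:Z - i%:Z by lia.
have := binzS t i; rewrite E /t => E2.
have -> : m.+1%:Z = (m%:Z - i%:Z) + i.+1%:Z by lia.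
rewrite mulrDr mulrDl -/t; rewrite -/t in E2.
rewrite [X in _ = X + _]mulrDl E2; move: (binz t i) (binz t i.+1) => A B.
rewrite /t; have -> : i.+1%:Z = i%:Z + 1 by lia.
ring.
Qed.

Local Opaque divpow hU.

(** * Newton expansion of integer-valued polynomials *)

Section Newton.
Variable V : zmodType.
Implicit Types F G : int -> V.

Definition fdiff F : int -> V := fun h => F (h + 1) - F h.
Definition newton F (n : nat) : V := iter n fdiff F 0.

Lemma newtonS F n : newton F n.+1 = newton (fdiff F) n.
Proof. by rewrite /newton iterSr. Qed.

Lemma fdiffD F G : fdiff (fun h => F h + G h) = fun h => fdiff F h + fdiff G h.
Proof. by apply/funext => h; rewrite /fdiff opprD addrACA. Qed.

Lemma newtonD F G n : newton (fun h => F h + G h) n = newton F n + newton G n.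
Proof. by elim: n F G => [|n IH] F G //; rewrite !newtonS fdiffD IH. Qed.

Lemma newton_formula F (h N : nat) : (h < N)%N ->
  F h%:Z = \sum_(j < N) newton F j *+ 'C(h, j).
Proof.
elim: h F N => [|h IH] F N hN.
  case: N hN => // N _; rewrite big_ord_recl /= bin0 mulr1n big1 ?addr0 //.
have -> : F h.+1%:Z = F h%:Z + fdiff F h%:Z.
  by rewrite /fdiff [_ - _]addrC addrA subrr add0r; congr F; lia.
rewrite (IH F N) ?(ltn_trans _ hN) //; case: N hN => // N hN.
rewrite (IH _ N) // [LHS]addrC big_ord_recl [RHS]big_ord_recl /= !bin0.
rewrite addrCA; congr (_ + _); rewrite -big_split /=; apply: eq_bigr => j _.
by rewrite /bump /= add1n newtonS binS mulrnDr addrC.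
Qed.

End Newton.

Lemma newton_map (V W : zmodType) (f : V -> W) F n :
  {morph f : x y / x - y} -> newton (f \o F) n = f (newton F n).
Proof.
move=> fB; elim: n F => [|n IH] F //; rewrite !newtonS -IH; congr newton.
by apply/funext => h; rewrite /fdiff /= fB.
Qed.

Lemma newton_binz m n : newton (binz^~ m) n = (m == n)%:R.
Proof.
elim: n m => [|n IH] [|m].
- by [].
- by [].
- rewrite newtonS (_ : fdiff _ = fun=> 0); last first.
    by apply/funext => h; rewrite /fdiff !binz0 subrr.
  elim: n {IH} => [|n IH] //; rewrite newtonS -[RHS]IH; congr newton.
- rewrite newtonS eqSS -IH; congr newton.
  by apply/funext => h; rewrite /fdiff binz_pascal addrC addKr.
Qed.

(** Both sides come from polynomials of size at most [size P] that agree at 0, ..., [size P] - 1.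
    The coefficients being integers, the binomials span the integer-valued polynomials over Z. *)
Lemma ipf_newton F : ipf F -> exists N, forall h : int,
  F h = \sum_(j < N) newton F j * binz h j.
Proof.
move=> [P FP]; exists (size P).
have iR : interp (fun h => \sum_(j < size P) newton F j * binz h j)
  (\sum_(j < size P) (newton F j)%:~R%:P *
     ((j`!%:R)^-1 *: \prod_(i < j) ('X - (i%:R)%:P))).
  move=> h; rewrite horner_sum rmorph_sum; apply: eq_bigr => j _.
  by rewrite hornerM hornerC rmorphM; congr (_ * _); apply: interp_binz.
suff E : P = \sum_(j < size P) (newton F j)%:~R%:P *
     ((j`!%:R)^-1 *: \prod_(i < j) ('X - (i%:R)%:P)).
  move=> h; apply/eqP; rewrite -(eqr_int CC); apply/eqP.
  by rewrite -(FP h) {1}E; apply: iR.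
apply/eqP; rewrite -subr_eq0; apply/eqP.
apply: (@roots_geq_poly_eq0 _ _ [seq i%:R | i <- iota 0 (size P)]).
- apply/allP => _ /mapP[i Hi ->]; move: Hi; rewrite mem_iota add0n => /andP[_ ltiP].
  rewrite rootE hornerD hornerN (FP i) (iR i) subr_eq0 eqr_int.
  rewrite (newton_formula F ltiP); apply/eqP/eq_bigr => j _.
  by rewrite binz_nat -mulr_natr natz.
- rewrite map_inj_uniq ?iota_uniq //.
  by move=> i j /eqP; rewrite eqr_nat => /eqP.
- rewrite size_map size_iota (leq_trans (size_polyD _ _)) // size_polyN geq_max leqnn /=.
  apply: (leq_trans (size_sum _ _ _)); apply/bigmax_leqP => j _.
  rewrite mul_polyC (leq_trans (size_scale_leq _ _)) // (leq_trans (size_scale_leq _ _)) //.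
  by rewrite size_prod_XsubC /index_enum -enumT size_enum_ord ltn_ord.
Qed.

Lemma hU_newton F : ipf F -> exists N, hU F = \sum_(j < N) (newton F j)%:~R *: binUH 0 j.
Proof.
move=> iF; have [N HN] := ipf_newton iF; exists N.
rewrite {1}(_ : F = fun h => \sum_(j < N) newton F j * binz h j); last exact/funext.
rewrite hU_sum; last by move=> j _; exact: ipfM (ipf_cst _) (ipf_binz _).
apply: eq_bigr => j _; rewrite hUZ; last exact: ipf_binz.
by rewrite binUHE; congr (_ *: hU _); apply/funext => h; rewrite addr0.
Qed.

(** * The Kostant form and its spanning set *)

Lemma UZ1 : UZ 1.
Proof. by move=> S [[S1 _ _] _]; rewrite inE in S1. Qed.
Lemma UZB u v : UZ u -> UZ v -> UZ (u - v).
Proof.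
move=> Uu Uv S HS; have [[_ SB _] _] := HS.
by apply/set_mem/SB; apply/mem_set; [exact: Uu|exact: Uv].
Qed.
Lemma UZM u v : UZ u -> UZ v -> UZ (u * v).
Proof.
move=> Uu Uv S HS; have [[_ _ SM] _] := HS.
by apply/set_mem/SM; apply/mem_set; [exact: Uu|exact: Uv].
Qed.
Lemma UZ0' : UZ 0. Proof. by rewrite -(subrr 1); apply: UZB; apply: UZ1. Qed.
Lemma UZN u : UZ u -> UZ (- u).
Proof. by move=> Uu; rewrite -sub0r; apply: UZB => //; apply: UZ0'. Qed.
Lemma UZD u v : UZ u -> UZ v -> UZ (u + v).
Proof. by move=> Uu Uv; rewrite -[v]opprK; apply: UZB => //; apply: UZN. Qed.
Lemma UZ_sum (I : Type) (s : seq I) (P : pred I) (F : I -> Usl2) :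
  (forall i, P i -> UZ (F i)) -> UZ (\sum_(i <- s | P i) F i).
Proof. by move=> H; apply: big_ind => //; [exact: UZ0'|exact: UZD]. Qed.
Lemma UZZ (z : int) u : UZ u -> UZ (z%:~R *: u).
Proof.
move=> Uu; rewrite scaler_int; elim/int_ind: z => [|n IH|n IH].
- by rewrite mulr0z; apply: UZ0'.
- by rewrite intS mulrzDr; apply: UZD.
- by rewrite intS opprD mulrzDr mulrN1z; apply: UZD => //; apply: UZN.
Qed.
Lemma UZ_divX m : UZ (divpow UX m).
Proof. by move=> S [_ HS]; apply: HS; left; exists m. Qed.
Lemma UZ_divY m : UZ (divpow UY m).
Proof. by move=> S [_ HS]; apply: HS; right; exists m. Qed.

(** For c = 0, binom(H,n) is the last term of X^(n) Y^(n) in [divXY], and the other terms contain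
    binomials of smaller degree. Pascal's rule then moves c up and down by 1. *)
Lemma UZ_binzD n c : UZ (hU (fun h => binz (h + c) n)).
Proof.
elim/ltn_ind: n c => n IH c.
have step d : hU (fun h => binz (h + (d + 1)) n) =
   hU (fun h => binz (h + d) n) + (if n is m.+1 then hU (fun h => binz (h + d) m) else 0).
  case: n {IH} => [|m].
    by rewrite addr0; congr hU; apply/funext => h; rewrite !binz0.
  rewrite -hUD; [|exact: ipf_binzD|exact: ipf_binzD].
  by congr hU; apply/funext => h; rewrite addrA binz_pascal.
have low d : UZ (if n is m.+1 then hU (fun h => binz (h + d) m) else 0).
  by case: n IH {step} => [|m] IH; [exact: UZ0'|exact: IH].
have base : UZ (hU (fun h => binz (h + 0) n)).
  have := divXY n n; rewrite big_ord_recr /= /ydiv leqnn subnn !divpow0 mul1r mulr1.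
  move=> /esym/(canRL (addKr _)) E.
  have -> : hU (fun h : int => binz (h + 0) n) = hU (fun h => binz (h - n%:Z - n%:Z + 2 * n%:Z) n).
    by congr hU; apply/funext => h; congr binz; lia.
  rewrite E; apply: UZD; last exact: UZM (UZ_divX _) (UZ_divY _).
  apply: UZN; apply: UZ_sum => i _; apply: UZM (UZ_divX _); apply: UZM.
    by case: ifP => _; [exact: UZ_divY|exact: UZ0'].
  have -> : hU (fun h : int => binz (h - n%:Z - n%:Z + 2 * i%:Z) i) =
      hU (fun h => binz (h + (- n%:Z - n%:Z + 2 * i%:Z)) i).
    by congr hU; apply/funext => h; congr binz; lia.
  exact: IH.
elim/int_ind: c => [//|m IHm|m IHm].
  by rewrite -addn1 PoszD step; apply: UZD.
have := step (- m.+1%:Z); rewrite (_ : - m.+1%:Z + 1 = - m%:Z); last by lia.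
move=> /esym/(canRL (addrK _)) ->.
by apply: UZB.
Qed.

Lemma UZ_hU F : ipf F -> UZ (hU F).
Proof.
move=> iF; have [N ->] := hU_newton iF; apply: UZ_sum => j _; apply: UZZ.
by rewrite binUHE; apply: UZ_binzD.
Qed.

Section ZSpan.
Variable (V : zmodType) (S : set V).

Inductive zspan : V -> Prop :=
| zspan0 : zspan 0
| zspan_cons u v : S u -> zspan v -> zspan (u + v)
| zspan_consN u v : S u -> zspan v -> zspan (- u + v).

Lemma zspan_gen u : S u -> zspan u.
Proof. by move=> Su; rewrite -[u]addr0; apply: zspan_cons => //; apply: zspan0. Qed.
Lemma zspanD u v : zspan u -> zspan v -> zspan (u + v).
Proof.
move=> Hu Hv; elim: Hu => [|a b Sa _ IH|a b Sa _ IH]; first by rewrite add0r.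
  by rewrite -addrA; apply: zspan_cons.
by rewrite -addrA; apply: zspan_consN.
Qed.
Lemma zspanN u : zspan u -> zspan (- u).
Proof.
elim=> [|a b Sa _ IH|a b Sa _ IH]; first by rewrite oppr0; apply: zspan0.
  by rewrite opprD; apply: zspan_consN.
by rewrite opprD opprK; apply: zspan_cons.
Qed.
Lemma zspanB u v : zspan u -> zspan v -> zspan (u - v).
Proof. by move=> Hu Hv; apply: zspanD => //; apply: zspanN. Qed.
Lemma zspan_sum (I : Type) (s : seq I) (P : pred I) (F : I -> V) :
  (forall i, P i -> zspan (F i)) -> zspan (\sum_(i <- s | P i) F i).
Proof. by move=> H; apply: big_ind => //; [exact: zspan0|exact: zspanD]. Qed.

End ZSpan.

Definition Uterms : set Usl2 :=
  [set u | exists m F l, ipf F /\ u = divpow UY m * hU F * divpow UX l].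

Lemma Uterms_scale (c : int) u : Uterms u -> Uterms (c%:~R *: u).
Proof.
move=> [m [F [l [iF ->]]]]; exists m, (fun h => c * F h), l; split.
  exact: ipfM (ipf_cst c) iF.
by rewrite hUZ // scalerAl scalerAr.
Qed.

Lemma Uterms_divX i u : Uterms u -> zspan Uterms (divpow UX i * u).
Proof.
move=> [m [F [l [iF ->]]]].
rewrite !mulrA divXY !mulr_suml; apply: zspan_sum => t _.
rewrite /ydiv; case: ifP => _; last by rewrite !mul0r; apply: zspan0.
have iF' : ipf (fun h => F (h - 2 * (i - t)%N%:Z)) by exact: ipf_shift.
have -> : divpow UY (m - t) * hU (fun h => binz (h - i%:Z - m%:Z + 2 * t%:Z) t) *
   divpow UX (i - t) * hU F * divpow UX l =
   ('C(i - t + l, i - t)%:Z%:~R : CC) *: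
   (divpow UY (m - t) * hU (fun h => binz (h - i%:Z - m%:Z + 2 * t%:Z) t *
      F (h - 2 * (i - t)%N%:Z)) * divpow UX (i - t + l)).
  have ib : ipf (fun h => binz (h - i%:Z - m%:Z + 2 * t%:Z) t).
    have [P hP] := ipf_binzD t (- i%:Z - m%:Z + 2 * t%:Z).
    by exists P => h; rewrite hP !addrA.
  rewrite hUM //.
  rewrite [RHS]scalerAr -[_%:~R *: _]divpowM -!mulrA; congr (_ * (_ * _)).
  rewrite !mulrA; congr (_ * _); rewrite hU_divX //; congr (_ * hU _).
  by apply/funext => h; rewrite addrK.
apply: zspan_gen; apply: Uterms_scale.
do 3 eexists; split; last reflexivity.
apply: ipfM iF'.
have [P hP] := ipf_binzD t (- i%:Z - m%:Z + 2 * t%:Z).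
by exists P => h; rewrite hP !addrA.
Qed.

Lemma Uterms_divY i u : Uterms u -> zspan Uterms (divpow UY i * u).
Proof.
move=> [m [F [l [iF ->]]]]; rewrite !mulrA divpowM -2!scalerAl; apply: zspan_gen.
by apply: (@Uterms_scale ('C(i + m, i))); exists (i + m)%N, F, l.
Qed.

(** The elements whose left multiplication preserves the span of [Uterms] form a subring containing
    the generators of [UZ]; such an element is recovered by applying it to 1. *)
Lemma UZ_zspan u : UZ u -> zspan Uterms u.
Proof.
move=> Uu.
have mulP (w : Usl2) : (forall u, Uterms u -> zspan Uterms (w * u)) ->
    forall v, zspan Uterms v -> zspan Uterms (w * v).
  move=> H v; elim=> [|a b Sa _ IH|a b Sa _ IH].
  - by rewrite mulr0; apply: zspan0.
  - by rewrite mulrDr; apply: zspanD => //; apply: H.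
  - by rewrite mulrDr mulrN; apply: zspanD => //; apply: zspanN; apply: H.
suff H : forall v, zspan Uterms v -> zspan Uterms (u * v).
  rewrite -[u]mulr1; apply: H; apply: zspan_gen; exists 0%N, (fun=> 1), 0%N.
  by split; [exact: ipf_cst|rewrite !divpow0 hU_cst !mulr1 mul1r scale1r].
apply: (Uu [set u | forall v, zspan Uterms v -> zspan Uterms (u * v)]); split.
  split=> [|x y|x y]; rewrite !inE /=.
  - by move=> v; rewrite mul1r.
  - by move=> Hx Hy v Hv; rewrite mulrBl; apply: zspanB; [apply: Hx|apply: Hy].
  - by move=> Hx Hy v Hv; rewrite -mulrA; apply: Hx; apply: Hy.
move=> _ [[m _ <-]|[m _ <-]] /=; apply: mulP => v Hv.
  exact: Uterms_divX.
exact: Uterms_divY.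
Qed.

(* [f (m, l, h)] stands for the value at [h] of the coefficient [F] of
   [Y^(m) F(H) X^(l)], and [symact] for the left multiplication by elements of sl2. *)
Definition symdom : Type := (nat * nat * int)%type.

Definition symact (M : sl2) (f : symdom -> CC) (d : symdom) : CC :=
  let: (m, l, h) := d in
  (val M) 0 1 * (l%:R * f (m, l.-1, h - 2) + (h - m%:Z)%:~R * f (m.+1, l, h))
  + (val M) 1 0 * (m%:R * f (m.-1, l, h))
  + (val M) 0 0 * ((h - 2 * m%:Z)%:~R * f (m, l, h)).

Lemma mx11_sl2 (M : sl2) : (val M) 1 1 = - (val M) 0 0.
Proof.
have /eqP := valP M; rewrite /mxtrace !big_ord_recl big_ord0 addr0 => /eqP.
rewrite addrC addr_eq0 (_ : lift ord0 ord0 = 1); last exact/val_inj.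
by move/eqP.
Qed.

Lemma symact_rel s t : sl2_rel s t -> forall f : symdom -> CC, True ->
  evalm symact s f = evalm symact t f.
Proof.
case=> [x y z E|c x z E|x y z E] f _; apply/funext => -[[m l] h].
- by rewrite /= -!/(val _) E !mxE; ring.
- by rewrite /= -!/(val _) E !mxE; ring.
have H1 (F : 'I_2 -> CC) : \sum_j F j = F 0 + F 1.
  rewrite !big_ord_recl big_ord0 addr0; congr (_ + F _); exact/val_inj.
have E01 : (val z) 0 1 = 2%:R * ((val x) 0 0 * (val y) 0 1 - (val x) 0 1 * (val y) 0 0).
  by rewrite E !mxE !H1 !mx11_sl2; ring.
have E10 : (val z) 1 0 = 2%:R * ((val x) 1 0 * (val y) 0 0 - (val x) 0 0 * (val y) 1 0).
  by rewrite E !mxE !H1 !mx11_sl2; ring.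
have E00 : (val z) 0 0 = (val x) 0 1 * (val y) 1 0 - (val y) 0 1 * (val x) 1 0.
  by rewrite E !mxE !H1; ring.
rewrite /evalm /symact E01 E10 E00.
move: ((val x) 0 1) ((val x) 1 0) ((val x) 0 0) => x01 x10 x00.
move: ((val y) 0 1) ((val y) 1 0) ((val y) 0 0) => y01 y10 y00.
case: m => [|m]; case: l => [|l] /=; ring.
Qed.

Definition symop (u : Usl2) (f : symdom -> CC) : symdom -> CC := evalm symact (repr u) f.

Lemma symact_add x f g :
  symact x (fun d => f d + g d) = fun d => symact x f d + symact x g d.
Proof. by apply/funext => -[[m l] h] /=; ring. Qed.

Lemma symact_scale x (c : CC) f :
  symact x (fun d => c * f d) = fun d => c * symact x f d.
Proof. by apply/funext => -[[m l] h] /=; ring. Qed.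

Lemma symopE t f : symop (pcls (P := Presentation sl2_rel_proper) t) f = evalm symact t f.
Proof.
apply: (@evalm_cong _ _ _ symact (fun=> True) _ _ _ symact_add symact_scale sl2_rel) => //.
  exact: symact_rel.
exact: (@repr_pcls _ (Presentation sl2_rel_proper)).
Qed.

Lemma symopD u v f d : symop (u + v) f d = symop u f d + symop v f d.
Proof.
elim/palg_ind: u => s; elim/palg_ind: v => t.
by rewrite {1}/GRing.add /= paddE !symopE.
Qed.
Lemma symopM u v f : symop (u * v) f = symop u (symop v f).
Proof.
elim/palg_ind: u => s; elim/palg_ind: v => t.
by rewrite {1}/GRing.mul /= pmulE !symopE.
Qed.
Lemma symopZ c u f d : symop (c *: u) f d = c * symop u f d.
Proof.
elim/palg_ind: u => s.
by rewrite {1}/GRing.scale /= pscaleE !symopE.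
Qed.
Lemma symop1 f : symop 1 f = f.
Proof. by rewrite symopE /=; apply/funext => d; rewrite mul1r. Qed.
Lemma symop0 f d : symop 0 f d = 0.
Proof. by rewrite -(scale0r 0) symopZ mul0r. Qed.

Lemma symop_gen g f : symop (pgen (P := Presentation sl2_rel_proper) g) f = symact g f.
Proof. exact: symopE. Qed.

Lemma symop_UX f m l h :
  symop UX f (m, l, h) = l%:R * f (m, l.-1, h - 2) + (h - m%:Z)%:~R * f (m.+1, l, h).
Proof. by rewrite symop_gen /= !mxE /= !mul0r mul1r !addr0. Qed.
Lemma symop_UY f m l h : symop UY f (m, l, h) = m%:R * f (m.-1, l, h).
Proof. by rewrite symop_gen /= !mxE /= !mul0r mul1r addr0 add0r. Qed.
Lemma symop_UH f m l h : symop UH f (m, l, h) = (h - 2 * m%:Z)%:~R * f (m, l, h).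
Proof. by rewrite symop_gen /= !mxE /= ?subr0 ?subrr ?oppr0 ?addr0 !mul0r mul1r !add0r. Qed.

Lemma symop_horner P f m l h :
  symop (horner_alg UH P) f (m, l, h) = P.[(h - 2 * m%:Z)%:~R] * f (m, l, h).
Proof.
elim/poly_ind: P f => [|P c IH] f.
  by rewrite rmorph0 symop0 horner0 mul0r.
rewrite rmorphD rmorphM /= horner_algX horner_algC symopD symopM IH symop_UH.
by rewrite symopZ symop1 hornerD hornerM hornerX hornerC; ring.
Qed.

Lemma symop_hU F f m l h : ipf F ->
  symop (hU F) f (m, l, h) = (F (h - 2 * m%:Z))%:~R * f (m, l, h).
Proof. by move=> [P FP]; rewrite (hUE FP) symop_horner FP. Qed.

Lemma symop_divY a f m l h :
  symop (divpow UY a) f (m, l, h) = 'C(m, a)%:R * f ((m - a)%N, l, h).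
Proof.
have H : symop (UY ^+ a) f (m, l, h) = (m ^_ a)%:R * f ((m - a)%N, l, h).
  elim: a m => [|a IH] m; first by rewrite expr0 symop1 mul1r subn0.
  rewrite exprS symopM symop_UY IH mulrA -natrM ffactnS.
  by case: m => [|m] //=; rewrite !mul0n !mul0r.
rewrite divpowE symopZ H mulrA -bin_ffact natrM mulrCA mulVf ?mulr1 //.
by rewrite pnatr_eq0 -lt0n fact_gt0.
Qed.

(** The symbol of 1. Letting u act on it gives the symbol of u. *)
Definition sym0 : symdom -> CC := fun d => ((d.1.1 == 0%N) && (d.1.2 == 0%N))%:R.

Lemma symop_divX l' m l h :
  symop (divpow UX l') sym0 (m, l, h) = ((m == 0%N) && (l == l'))%:R.
Proof.
have H : symop (UX ^+ l') sym0 (m, l, h) = ((m == 0%N) && (l == l'))%:R * l'`!%:R.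
  elim: l' m l h => [|l' IH] m l h; first by rewrite expr0 symop1 fact0 mulr1.
  rewrite exprS symopM symop_UX !IH /= mul0r mulr0 addr0.
  case: m => [|m] /=; last by rewrite !mul0r mulr0.
  case: l => [|l] /=; first by rewrite !mul0r.
  rewrite eqSS factS natrM mulrCA; case: eqP => [->|_]; last by rewrite !mul0r.
  by rewrite !mul1r.
rewrite divpowE symopZ H mulrCA mulVf ?mulr1 //.
by rewrite pnatr_eq0 -lt0n fact_gt0.
Qed.

Definition symb (u : Usl2) (m l : nat) (h : int) : CC := symop u sym0 (m, l, h).

(** The symbol recovers F from Y^(a) F(H) X^(b) and separates the exponents: this is the
    independence half of the basis theorem. *)
Lemma symb_term a F b m l h : ipf F ->
  symb (divpow UY a * hU F * divpow UX b) m l h = ((m == a) && (l == b))%:R * (F h)%:~R.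
Proof.
move=> iF; rewrite /symb -mulrA symopM symop_divY symopM symop_hU // symop_divX.
case: (ltngtP m a) => [lt_ma|lt_am|->] /=.
- by rewrite bin_small // !mul0r.
- by rewrite subn_eq0 leqNgt lt_am /= !mulr0 mul0r.
- by rewrite binn subnn /= mulr0 subr0 mul1r mulrC.
Qed.

(** Symbols have values in [CC]; integrality on [UZ] is what allows them to be mapped to k. *)
Lemma symb_int u m l h : UZ u -> exists z : int, symb u m l h = z%:~R.
Proof.
move=> /UZ_zspan; elim=> [|_ b [a [F [c [iF ->]]]] _ [z hz]|_ b [a [F [c [iF ->]]]] _ [z hz]].
- by exists 0; rewrite /symb symop0.
- eexists ((((m == a) && (l == c))%:R : int) * F h + z).
  by rewrite /symb symopD -/(symb _ _ _ _) symb_term // -/(symb b _ _ _) hz; case: eqP; case: eqP => _ _ /=; rewrite ?mul0r ?mul1r ?rmorphD ?add0r.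
- eexists (- ((((m == a) && (l == c))%:R : int) * F h) + z).
  rewrite /symb symopD -scaleN1r symopZ -/(symb _ _ _ _) symb_term // -/(symb b _ _ _) hz mulN1r.
  by case: eqP; case: eqP => _ _ /=; rewrite ?mul0r ?mul1r ?oppr0 ?add0r ?rmorphD ?rmorphN.
Qed.

Section KSpan.
Variables (k : nzRingType) (V : lmodType k) (S : set V).

Inductive kspan : V -> Prop :=
| kspan0 : kspan 0
| kspan_cons c u v : S u -> kspan v -> kspan (c *: u + v).

Lemma kspan_gen u : S u -> kspan u.
Proof.
by move=> Su; rewrite -[u]addr0 -[u]scale1r; apply: kspan_cons => //; apply: kspan0.
Qed.
Lemma kspanD u v : kspan u -> kspan v -> kspan (u + v).
Proof.
move=> Hu Hv; elim: Hu => [|c a b Sa _ IH]; first by rewrite add0r.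
by rewrite -addrA; apply: kspan_cons.
Qed.
Lemma kspanZ c u : kspan u -> kspan (c *: u).
Proof.
elim=> [|d a b Sa _ IH]; first by rewrite scaler0; apply: kspan0.
by rewrite scalerDr scalerA; apply: kspan_cons.
Qed.
Lemma kspanN u : kspan u -> kspan (- u).
Proof. by move=> Hu; rewrite -scaleN1r; apply: kspanZ. Qed.
Lemma kspan_sum (I : Type) (s : seq I) (P : pred I) (F : I -> V) :
  (forall i, P i -> kspan (F i)) -> kspan (\sum_(i <- s | P i) F i).
Proof. by move=> H; apply: big_ind => //; [exact: kspan0|exact: kspanD]. Qed.

End KSpan.

Lemma kspan_map (k : nzRingType) (V W : lmodType k) (S : set V) (T : set W) (f : V -> W) :
  linear f -> (forall u, S u -> kspan T (f u)) -> forall u, kspan S u -> kspan T (f u).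
Proof.
move=> lf H u; have f0 : f 0 = 0.
  by have := lf (-1) 0 0; rewrite scaler0 addr0 scaleN1r addrC subrr.
elim=> [|c a b Sa _ IH]; first by rewrite f0; apply: kspan0.
by rewrite lf; apply: kspanD => //; apply: kspanZ; apply: H.
Qed.

Lemma kspan_sub (k : nzRingType) (V : lmodType k) (S T : set V) :
  (forall u, S u -> kspan T u) -> forall u, kspan S u -> kspan T u.
Proof. by move=> H u; apply: (@kspan_map _ _ _ S T id). Qed.

(** * Coordinates on the hyperalgebra *)

Section HyperExtension.
Variable k : fieldType.
Local Notation U := (hyper k).
Local Notation th := (@to_hyper k).
Local Notation Pk := (Presentation (@base_rel_proper k)).

Lemma UZ_inclK u : UZ u -> sval (UZ_incl u) = u.
Proof. by move=> Uu; rewrite /UZ_incl; apply: insubdK; apply/mem_set. Qed.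

Lemma thD u v : UZ u -> UZ v -> th (u + v) = th u + th v.
Proof.
move=> Uu Uv; rewrite /to_hyper /pgen [RHS]/GRing.add /= paddE; apply/pclsP.
by apply: cong_rel; apply: base_add; rewrite !UZ_inclK //; apply: UZD.
Qed.
Lemma thM u v : UZ u -> UZ v -> th (u * v) = th u * th v.
Proof.
move=> Uu Uv; rewrite /to_hyper /pgen [RHS]/GRing.mul /= pmulE; apply/pclsP.
by apply: cong_rel; apply: base_mul; rewrite !UZ_inclK //; apply: UZM.
Qed.
Lemma th1 : th 1 = 1.
Proof.
rewrite /to_hyper /pgen; apply/pclsP; apply: cong_rel; apply: base_one.
by rewrite UZ_inclK //; apply: UZ1.
Qed.
Lemma th0 : th 0 = 0.
Proof. by apply: (addrI (th 0)); rewrite -thD ?addr0 //; apply: UZ0'. Qed.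
Lemma thN u : UZ u -> th (- u) = - th u.
Proof.
move=> Uu; apply: (addrI (th u)); rewrite -thD ?subrr ?th0 //.
exact: UZN.
Qed.
Lemma thZ (z : int) u : UZ u -> th (z%:~R *: u) = z%:~R *: th u.
Proof.
move=> Uu; elim/int_ind: z => [|n IH|n IH].
- by rewrite !scale0r th0.
- rewrite !intS !rmorphD /= !scalerDl thD ?scale1r ?IH //.
    exact: UZZ.
- rewrite !intS !opprD !rmorphD /= !scalerDl thD.
  + by rewrite IH !rmorphN1 !scaleN1r thN.
  + by rewrite rmorphN1 scaleN1r; apply: UZN.
  + exact: UZZ.
Qed.
Lemma th_sum (I : Type) (s : seq I) (P : pred I) (F : I -> Usl2) :
  (forall i, P i -> UZ (F i)) ->
  th (\sum_(i <- s | P i) F i) = \sum_(i <- s | P i) th (F i).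
Proof.
move=> H; elim: s => [|i s IH]; first by rewrite !big_nil th0.
by rewrite !big_cons; case: ifP => Pi //; rewrite thD ?IH //; [exact: H|exact: UZ_sum].
Qed.

Lemma hyper_span x : kspan (th @` UZ) x.
Proof.
elim/palg_ind: x; elim=> [g|c|s IHs t IHt|s IHs t IHt].
- apply: kspan_gen; exists (sval g); first by apply/set_mem/(valP g).
  rewrite /to_hyper /pgen; congr (pcls (Gen _)).
  by apply/val_inj; rewrite /= UZ_inclK //; apply/set_mem/(valP g).
- have -> : pcls (P := Pk) (Scal c) = c *: 1.
    rewrite [RHS]/GRing.scale /= pscaleE; apply/pclsP; apply: cong_sym.
    by apply: cong_trans (cong_scalC _ _ _) _; apply: cong_mul1.
  by apply: kspanZ; apply: kspan_gen; exists 1; [exact: UZ1|exact: th1].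
- have -> : pcls (P := Pk) (Add s t) = pcls (P := Pk) s + pcls (P := Pk) t.
    by rewrite [RHS]/GRing.add /= paddE.
  exact: kspanD.
have -> : pcls (P := Pk) (Mul s t) = pcls (P := Pk) s * pcls (P := Pk) t.
  by rewrite [RHS]/GRing.mul /= pmulE.
move: (pcls (P := Pk) s) (pcls (P := Pk) t) IHs IHt => x y Hx Hy.
elim: Hx => [|c _ b [u Uu <-] _ IH]; first by rewrite mul0r; apply: kspan0.
rewrite mulrDl; apply: kspanD => //; rewrite -scalerAl; apply: kspanZ.
elim: Hy {IH} => [|d _ e [v Uv <-] _ IH]; first by rewrite mulr0; apply: kspan0.
rewrite mulrDr -scalerAr -thM //; apply: kspan_cons => //.
by exists (u * v) => //; apply: UZM.
Qed.

(* [hyper k] acts on the functions [f] that are additive on [UZ] by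
   [(x f) v = f (v x)], and [f] is extended by [x |-> (x f) 1]. *)
Lemma hyper_additive (f : Usl2 -> k) :
  (forall u v, UZ u -> UZ v -> f (u + v) = f u + f v) ->
  exists phi : U -> k, (linear (phi : U -> k^o)) /\ forall u, UZ u -> phi (th u) = f u.
Proof.
move=> f_add.
(* Besides additivity on [UZ], vanishing outside [UZ] is imposed: [act] cuts functions off there,
   and the symbol of 1 must act as the identity. *)
pose inv (g : Usl2 -> k) := (forall u v, UZ u -> UZ v -> g (u + v) = g u + g v) /\
  (forall u, ~ UZ u -> g u = 0).
pose act (x : UZ_type) (g : Usl2 -> k) : Usl2 -> k :=
  fun v => if `[< UZ v >] then g (v * sval x) else 0.
have UZv (x : UZ_type) : UZ (sval x) by apply/set_mem/(valP x).
have inv_add g h : inv g -> inv h -> inv (fun d => g d + h d).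
  move=> [g1 g2] [h1 h2]; split=> [u v Uu Uv|u nU].
    by rewrite g1 // h1 // addrACA.
  by rewrite g2 // h2 // addr0.
have inv_scale c g : inv g -> inv (fun d => c * g d).
  move=> [g1 g2]; split=> [u v Uu Uv|u nU]; first by rewrite g1 // mulrDr.
  by rewrite g2 // mulr0.
have inv_act x g : inv g -> inv (act x g).
  move=> [g1 g2]; split=> [u v Uu Uv|u nU]; last by rewrite /act asboolF.
  rewrite /act !asboolT //; last exact: UZD.
  by rewrite mulrDl g1 //; apply: UZM.
have act_add x g h : act x (fun d => g d + h d) = fun d => act x g d + act x h d.
  by apply/funext => d; rewrite /act; case: asboolP => // _; rewrite addr0.
have act_scale x c g : act x (fun d => c * g d) = fun d => c * act x g d.
  by apply/funext => d; rewrite /act; case: asboolP => // _; rewrite mulr0.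
have act_rel s t : base_rel s t -> forall g, inv g -> evalm act s g = evalm act t g.
  case=> [x y z E|x y z E|z E] g [g1 g2]; apply/funext => v /=; rewrite /act.
  - case: asboolP => Uv; last by rewrite addr0.
    by rewrite E mulrDr g1 //; apply: UZM.
  - case: asboolP => Uv //; rewrite E asboolT ?mulrA //.
    exact: UZM.
  - by case: asboolP => Uv; rewrite ?E ?mulr1 ?mul1r // g2.
pose f0 u := if `[< UZ u >] then f u else 0.
have inv_f0 : inv f0.
  split=> [u v Uu Uv|u nU]; last by rewrite /f0 asboolF.
  by rewrite /f0 !asboolT ?f_add //; apply: UZD.
have E t : evalm act (repr (pcls (P := Pk) t)) f0 = evalm act t f0.
  apply: (@evalm_cong _ _ _ act inv inv_add inv_scale inv_act act_add act_scale _ act_rel) => //.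
  exact: (@repr_pcls _ Pk).
exists (fun x => evalm act (repr x) f0 1); split.
  move=> c; elim/palg_ind=> s; elim/palg_ind=> t.
  rewrite [X in evalm _ (repr X)]/GRing.add /GRing.scale /= pscaleE paddE !E /=.
  by [].
move=> u Uu; rewrite /to_hyper /pgen E /= /act asboolT; last exact: UZ1.
by rewrite UZ_inclK // mul1r /f0 asboolT.
Qed.

Definition symz (m l : nat) (h : int) (u : Usl2) : int :=
  xget 0 [set z : int | symb u m l h = z%:~R].

Lemma symzE m l h u (z : int) : symb u m l h = z%:~R -> symz m l h u = z.
Proof.
move=> E; have /= := @xgetI _ 0 [set z : int | symb u m l h = z%:~R] z E.
by move=> H; apply/eqP; rewrite -(eqr_int CC) -E; apply/eqP/esym/H.
Qed.

Lemma phi_exists m l h : exists phi : U -> k, (linear (phi : U -> k^o)) /\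
  forall u, UZ u -> phi (th u) = (symz m l h u)%:~R.
Proof.
apply: hyper_additive => u v Uu Uv; rewrite -intrD; congr (_%:~R).
have [z hz] := symb_int m l h Uu; have [y hy] := symb_int m l h Uv.
rewrite (symzE hz) (symzE hy); apply: symzE.
by rewrite /symb symopD -!/(symb _ _ _ _) hz hy rmorphD.
Qed.

Definition phi m l h : U -> k := sval (cid (phi_exists m l h)).

Lemma phi_linear m l h : linear (phi m l h : U -> k^o).
Proof. exact: (proj1 (svalP (cid (phi_exists m l h)))). Qed.

Lemma phi_th m l h u : UZ u -> phi m l h (th u) = (symz m l h u)%:~R.
Proof. exact: (proj2 (svalP (cid (phi_exists m l h)))). Qed.

Lemma phiD m l h x y : phi m l h (x + y) = phi m l h x + phi m l h y.
Proof. by have := phi_linear m l h 1 x y; rewrite !scale1r. Qed.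
Lemma phi0 m l h : phi m l h 0 = 0.
Proof. by apply: (addrI (phi m l h 0)); rewrite -phiD !addr0. Qed.
Lemma phiZ m l h c x : phi m l h (c *: x) = c * phi m l h x.
Proof. by have := phi_linear m l h c x 0; rewrite !addr0 phi0 addr0. Qed.
Lemma phi_sum m l h (I : Type) (s : seq I) (P : pred I) (F : I -> U) :
  phi m l h (\sum_(i <- s | P i) F i) = \sum_(i <- s | P i) phi m l h (F i).
Proof. by apply: (big_morph _ (phiD m l h) (phi0 m l h)). Qed.

Definition hL (F : int -> int) : U := th (hU F).

Lemma hterm_th m F l : ipf F ->
  hY k m * hL F * hX k l = th (divpow UY m * hU F * divpow UX l).
Proof.
move=> iF; have UF := UZ_hU iF; have UY := UZ_divY m; have UX := UZ_divX l.
by rewrite /hY /hX /hL -!thM //; apply: UZM.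
Qed.

Lemma phi_term m l h a F b : ipf F ->
  phi m l h (hY k a * hL F * hX k b) = ((m == a) && (l == b))%:R * (F h)%:~R.
Proof.
move=> iF; rewrite hterm_th // phi_th; last first.
  by apply: UZM (UZ_divX _); apply: UZM (UZ_divY _) (UZ_hU iF).
rewrite (@symzE m l h _ (((m == a) && (l == b))%:R * F h)).
  by case: (_ && _); rewrite ?mul1r // !mul0r.
by rewrite symb_term //; case: (_ && _); rewrite ?mul1r // !mul0r.
Qed.

Lemma hLD F G : ipf F -> ipf G -> hL (fun h => F h + G h) = hL F + hL G.
Proof. by move=> iF iG; rewrite /hL hUD // thD //; apply: UZ_hU. Qed.
Lemma hLM F G : ipf F -> ipf G -> hL (fun h => F h * G h) = hL F * hL G.
Proof. by move=> iF iG; rewrite /hL hUM // thM //; apply: UZ_hU. Qed.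
Lemma hLC F G : ipf F -> ipf G -> hL F * hL G = hL G * hL F.
Proof.
by move=> iF iG; rewrite -!hLM //; congr hL; apply/funext => h; rewrite mulrC.
Qed.
Lemma hLZ c F : ipf F -> hL (fun h => c * F h) = c%:~R *: hL F.
Proof. by move=> iF; rewrite /hL hUZ // thZ //; apply: UZ_hU. Qed.
Lemma hL_cst c : hL (fun=> c) = c%:~R *: 1.
Proof. by rewrite /hL hU_cst thZ ?th1 //; apply: UZ1. Qed.
Lemma hL_sum (I : Type) (s : seq I) (P : pred I) (F : I -> int -> int) :
  (forall i, P i -> ipf (F i)) ->
  hL (fun h => \sum_(i <- s | P i) F i h) = \sum_(i <- s | P i) hL (F i).
Proof.
move=> H; rewrite /hL hU_sum // th_sum // => i Pi.
by apply: UZ_hU; apply: H.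
Qed.
Lemma binHE c n : binH k c n = hL (fun h => binz (h + c) n).
Proof. by rewrite /binH binUHE. Qed.
Lemma binH0E n : binH k 0 n = hL (binz^~ n).
Proof. by rewrite binHE; congr hL; apply/funext => h; rewrite addr0. Qed.
Lemma hL_newton F : ipf F -> exists N, hL F = \sum_(j < N) (newton F j)%:~R *: binH k 0 j.
Proof.
move=> iF; have [N E] := hU_newton iF; exists N.
have Ub j : UZ (binUH 0 j) by rewrite binUHE; apply: UZ_binzD.
rewrite /hL E th_sum; last by move=> j _; apply: UZZ.
by apply: eq_bigr => j _; rewrite thZ.
Qed.

Lemma hX0 : hX k 0 = 1. Proof. by rewrite /hX divpow0 th1. Qed.
Lemma hY0 : hY k 0 = 1. Proof. by rewrite /hY divpow0 th1. Qed.
Lemma hXM m n : hX k m * hX k n = 'C(m + n, m)%:R *: hX k (m + n).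
Proof.
rewrite /hX -thM; [|exact: UZ_divX|exact: UZ_divX].
by rewrite divpowM -(thZ 'C(m + n, m)) //; apply: UZ_divX.
Qed.
Lemma hYM m n : hY k m * hY k n = 'C(m + n, m)%:R *: hY k (m + n).
Proof.
rewrite /hY -thM; [|exact: UZ_divY|exact: UZ_divY].
by rewrite divpowM -(thZ 'C(m + n, m)) //; apply: UZ_divY.
Qed.
Lemma hL_X F m : ipf F -> hL F * hX k m = hX k m * hL (fun h => F (h + 2 * m%:Z)).
Proof.
move=> iF; rewrite /hL /hX -!thM; try exact: UZ_divX; try exact: UZ_hU.
  by rewrite hU_divX.
by apply: UZ_hU; apply: ipf_shift.
Qed.
Lemma hL_Y F m : ipf F -> hL F * hY k m = hY k m * hL (fun h => F (h - 2 * m%:Z)).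
Proof.
move=> iF; rewrite /hL /hY -!thM; try exact: UZ_divY; try exact: UZ_hU.
  by rewrite hU_divY.
by apply: UZ_hU; apply: ipf_shift.
Qed.
Lemma hX_L F m : ipf F -> hX k m * hL F = hL (fun h => F (h - 2 * m%:Z)) * hX k m.
Proof.
move=> iF; rewrite hL_X; last exact: ipf_shift.
by congr (_ * hL _); apply/funext => h; congr F; lia.
Qed.
Lemma hY_L F m : ipf F -> hY k m * hL F = hL (fun h => F (h + 2 * m%:Z)) * hY k m.
Proof.
move=> iF; rewrite hL_Y; last exact: ipf_shift.
by congr (_ * hL _); apply/funext => h; congr F; lia.
Qed.

Definition ydv (n i : nat) : U := if (i <= n)%N then hY k (n - i) else 0.

Lemma ipf_xy (m n i : nat) : ipf (fun h => binz (h - m%:Z - n%:Z + 2 * i%:Z) i).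
Proof.
have [P hP] := ipf_binzD i (- m%:Z - n%:Z + 2 * i%:Z).
by exists P => h; rewrite hP !addrA.
Qed.

Lemma hXY m n : hX k m * hY k n =
  \sum_(i < m.+1) ydv n i * hL (fun h => binz (h - m%:Z - n%:Z + 2 * i%:Z) i)
                  * hX k (m - i).
Proof.
have Uy i : UZ (ydiv n i).
  by rewrite /ydiv; case: ifP => _; [exact: UZ_divY|exact: UZ0'].
have Uxy i := UZ_hU (ipf_xy m n i).
rewrite /hX /hY -thM; [|exact: UZ_divX|exact: UZ_divY].
rewrite divXY th_sum; last first.
  by move=> i _; apply: UZM (UZ_divX _); apply: UZM.
apply: eq_bigr => i _; rewrite !thM //; try exact: UZ_divX; last exact: UZM.
by congr (_ * _ * _); rewrite /ydv /ydiv; case: ifP => // _; apply: th0.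
Qed.

Definition hbasis : set U := [set x | exists m n l, x = hY k m * binH k 0 n * hX k l].

Lemma hyper_basis_span x : kspan hbasis x.
Proof.
apply: (kspan_sub _ (hyper_span x)) => _ [u Uu <-].
elim: (UZ_zspan Uu) (Uu) => [|v w [m [F [l [iF ->]]]] Hw IH|v w [m [F [l [iF ->]]]] Hw IH] _.
- by rewrite th0; apply: kspan0.
all: have Uw : UZ w by elim: Hw => [|a b [m' [F' [l' [iF' ->]]]] _ IHb|a b [m' [F' [l' [iF' ->]]]] _ IHb];
  [exact: UZ0'|apply: UZD => //|apply: UZD => //; apply: UZN];
  apply: UZM (UZ_divX _); apply: UZM (UZ_divY _) (UZ_hU iF').
all: have Ut : UZ (divpow UY m * hU F * divpow UX l)
  by apply: UZM (UZ_divX _); apply: UZM (UZ_divY _) (UZ_hU iF).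
all: have Ht : kspan hbasis (th (divpow UY m * hU F * divpow UX l)) by
  rewrite -hterm_th //; have [N ->] := hL_newton iF; rewrite mulr_sumr mulr_suml;
  apply: kspan_sum => j _; rewrite -scalerAr -scalerAl; apply: kspanZ; apply: kspan_gen; exists m, j, l.
- by rewrite thD //; apply: kspanD => //; apply: IH.
- rewrite thD ?thN //; last exact: UZN.
  by apply: kspanD; [exact: kspanN|exact: IH].
Qed.

End HyperExtension.

(** * Linear maps prescribed on the Kostant basis *)

Section Lift.
Variables (k : fieldType) (W : lmodType k) (e : nat -> nat -> nat -> W).

Let idx := (nat * nat * nat)%type.
Let term3 (t : idx) : hyper k := hY k t.1.1 * binH k 0 t.1.2 * hX k t.2.
(** The coordinate on Y^(m) binom(H,n) X^(l): the n-th difference at 0 extracts the coefficient of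
    binom(h,n) from the function h |-> phi_(m,l,h)(x). *)
Let coef3 (x : hyper k) (t : idx) : k := newton (fun h => phi t.1.1 t.2 h x) t.1.2.

Let coef3_term t t' : coef3 (term3 t') t = (t == t')%:R.
Proof.
case: t => -[m n] l; case: t' => -[m' n'] l'; rewrite /coef3 /term3 /=.
pose g (z : int) : k := ((m == m') && (l == l'))%:R * z%:~R.
rewrite (_ : (fun h => _) = g \o binz^~ n'); last first.
  by apply/funext => h /=; rewrite binH0E phi_term //; apply: ipf_binz.
rewrite newton_map; last by move=> x y; rewrite /g rmorphB mulrBr.
rewrite newton_binz /g !xpair_eqE /= (eq_sym n n').
by case: (m == m'); case: (l == l'); case: (n' == n); rewrite /= ?mulr1 ?mulr0 ?mul0r.
Qed.

Let coef3_linear t : linear (coef3^~ t : hyper k -> k^o).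
Proof.
move=> c x y; rewrite /coef3.
rewrite -[RHS]/(c * _ + _) -(newton_map _ _ (mulrBr c)) -newtonD; congr newton.
by apply/funext => h; rewrite phiD phiZ.
Qed.

(** Triples are enumerated by natural numbers through [pickle], so that finitely supported sums
    become sums over ordinals. *)
Let coef (x : hyper k) (i : nat) : k :=
  if pickle_inv i is Some t then coef3 x t else 0.

Let coef_linear i c x y : coef (c *: x + y) i = c * coef x i + coef y i.
Proof.
by rewrite /coef; case: pickle_inv => [t|]; [exact: coef3_linear|rewrite mulr0 addr0].
Qed.

Let coef_supp x : exists N, forall i, (N <= i)%N -> coef x i = 0.
Proof.
elim: (hyper_basis_span x) => [|c _ v [m [n [l ->]]] _ [N HN]].
  by exists 0%N => i _; have := coef_linear i (-1) 0 0; rewrite scaler0 addr0 mulN1r addNr.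
exists (maxn (pickle (m, n, l)).+1 N) => i; rewrite geq_max => /andP[lt_i leNi].
rewrite coef_linear HN // addr0 /coef.
case E: (pickle_inv i) => [t|]; last by rewrite mulr0.
have /= := coef3_term t (m, n, l); rewrite /term3 /= => ->.
case: eqP => [tE|_]; last by rewrite mulr0.
have := pickle_invK i (T := idx); rewrite E /= => pE.
by rewrite -pE tE ltnn in lt_i.
Qed.

Let e1 (i : nat) : W := if pickle_inv i is Some t then e (t : idx).1.1 t.1.2 t.2 else 0.

(** Freeness of the Kostant basis, in the form in which [Fr'] and G need it. The sum defining [f x]
    may be cut at any bound beyond the support of x ([fE]), so a common bound for two elements gives
    linearity. *)
Lemma hyper_lift : exists f : hyper k -> W, linear f /\
  forall m n l, f (hY k m * binH k 0 n * hX k l) = e m n l.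
Proof.
pose N x := sval (cid (coef_supp x)).
have HN x i : (N x <= i)%N -> coef x i = 0 by apply: (svalP (cid (coef_supp x))).
pose f x := \sum_(i < N x) coef x i *: e1 i.
have fE x M : (forall i, (M <= i)%N -> coef x i = 0) -> f x = \sum_(i < M) coef x i *: e1 i.
  have sumE (A B : nat) : (A <= B)%N -> (forall i, (A <= i)%N -> coef x i = 0) ->
      \sum_(i < A) coef x i *: e1 i = \sum_(i < B) coef x i *: e1 i.
    move=> leAB HA; rewrite (big_ord_widen B (fun i => coef x i *: e1 i) leAB).
    rewrite [RHS](bigID (fun i : 'I_B => (i < A)%N)) /= [X in _ + X]big1 ?addr0 // => i.
    by rewrite -leqNgt => /HA ->; rewrite scale0r.
  move=> HM; rewrite /f (sumE _ _ (leq_maxl (N x) M) (HN x)).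
  by rewrite (sumE _ _ (leq_maxr (N x) M) HM).
exists f; split=> [c x y|m n l].
  pose M := maxn (N x) (N y).
  have Hx i : (M <= i)%N -> coef x i = 0 by rewrite geq_max => /andP[/HN].
  have Hy i : (M <= i)%N -> coef y i = 0 by rewrite geq_max => /andP[_ /HN].
  rewrite (fE x M) // (fE y M) // (fE _ M); last first.
    by move=> i lei; rewrite coef_linear Hx // Hy // mulr0 addr0.
  rewrite scaler_sumr -big_split /=; apply: eq_bigr => i _.
  by rewrite coef_linear scalerDl scalerA.
pose t : idx := (m, n, l); pose i0 := pickle t.
have C i : coef (term3 t) i = (i == i0)%:R.
  rewrite /coef; case: eqP => [->|ne].
    by rewrite pickleK_inv coef3_term eqxx.
  case E: (pickle_inv i) => [t'|] //; rewrite coef3_term; case: eqP => // t'E.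
  by have := pickle_invK i (T := idx); rewrite E /= t'E => /esym.
rewrite (fE (term3 t) i0.+1); last by move=> i lti; rewrite C; case: eqP => // iE; rewrite iE ltnn in lti.
rewrite big_ord_recr /= C eqxx scale1r big1 ?add0r; last first.
  by move=> i _; rewrite C ltn_eqF // scale0r.
by rewrite /e1 pickleK_inv.
Qed.

End Lift.

(** * Binomials and divided powers in characteristic p *)

Section CharP.
Variables (k : fieldType) (p : nat).
Hypothesis hp : p \in [pchar k].

Let p_pr : prime p. Proof. exact: pcharf_prime hp. Qed.
Let p_gt0 : (0 < p)%N. Proof. exact: prime_gt0 p_pr. Qed.

(** If F and G agree modulo p, then (F - G)/p is again an integer-valued polynomial, and p times its
    image is 0. Equalities in H are thus tested on values modulo p. *)
Lemma hL_congr F G : ipf F -> ipf G ->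
  (forall h, (F h)%:~R = (G h)%:~R :> k) -> hL k F = hL k G.
Proof.
move=> iF iG E.
have dvd h : (p %| F h - G h)%Z by rewrite (dvdz_pcharf hp) rmorphB /= E subrr.
pose D h := ((F h - G h) %/ p%:Z)%Z.
have DE h : F h - G h = p%:Z * D h by rewrite mulrC divzK.
have p0 : p%:R != 0 :> CC by rewrite pnatr_eq0 -lt0n.
have iD : ipf D.
  have [P hP] := ipfD iF (ipfN iG).
  exists ((p%:R)^-1 *: P) => h; rewrite hornerZ hP DE.
  by rewrite rmorphM /= mulrA mulVf ?mul1r.
have -> : F = fun h => G h + p%:Z * D h by apply/funext => h; rewrite -DE addrC subrK.
rewrite hLD //; last exact: ipfM (ipf_cst _) iD.
by rewrite hLZ // (_ : p%:Z%:~R = 0 :> k) ?scale0r ?addr0 //; apply: pcharf0.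
Qed.

Definition bk (z : int) (n : nat) : k := (binz z n)%:~R.

Lemma bk0 z : bk z 0 = 1. Proof. by rewrite /bk binz0. Qed.
Lemma bk_nat (m n : nat) : bk m n = 'C(m, n)%:R. Proof. by []. Qed.

(** From j binom(p^r,j) = p^r binom(p^r-1,j-1): if p did not divide binom(p^r,j), then p^r would
    divide j. *)
Lemma bin_pexp r j : (0 < j < p ^ r)%N -> 'C(p ^ r, j)%:R = 0 :> k.
Proof.
case: j => // j /= ltj; apply/eqP; rewrite -(dvdn_pcharf hp).
apply: contraLR ltj => ndvd; rewrite -leqNgt.
have := mul_bin_diag (p ^ r) j => E.
have : (p ^ r %| j.+1 * 'C(p ^ r, j.+1))%N by rewrite -E dvdn_mulr.
rewrite Gauss_dvdl; first by move/dvdn_leq; apply.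
by rewrite coprimeXl // prime_coprime.
Qed.

Lemma bk_addq r z n :
  bk (z + (p ^ r)%N%:Z) n = bk z n + (if (p ^ r <= n)%N then bk z (n - p ^ r) else 0).
Proof.
have q0 : (0 < p ^ r)%N by rewrite expn_gt0 p_gt0.
rewrite /bk binz_vdm rmorph_sum /= big_ord_recl /= subn0 bin0 mulr1; congr (_ + _).
have T (j : 'I_n) : (binz z (n - bump 0 j) * 'C(p ^ r, bump 0 j)%:Z)%:~R =
    if (j.+1 == p ^ r)%N then bk z (n - j.+1) else 0.
  rewrite rmorphM /= /bump add1n /=; case: (ltngtP j.+1 (p ^ r)) => H.
  - by rewrite [X in _ * X](bin_pexp (r := r) (j := j.+1)) ?mulr0.
  - by rewrite bin_small // mulr0.
  - by rewrite H binn mulr1.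
rewrite (eq_bigr _ (fun j _ => T j)) -big_mkcond /=.
case: leqP => [le_qn|lt_nq].
  have ltq : ((p ^ r).-1 < n)%N by rewrite prednK.
  rewrite (big_pred1 (Ordinal ltq)) /=; first by rewrite prednK.
  by move=> j; rewrite /= -val_eqE /= -[RHS]eqSS prednK.
by rewrite big_pred0 // => j; rewrite ltn_eqF // (leq_ltn_trans _ lt_nq).
Qed.

(** Lucas's congruence with an arbitrary integer h on top. By [bk_addq] both sides obey the same
    Pascal rule in (h, n); the induction runs from h = 0 upwards and, with an inner induction on n,
    downwards. *)
Lemma bk_lucas r (h : int) (a n b : nat) : (a < p ^ r)%N -> (b < p ^ r)%N ->
  bk ((p ^ r)%N%:Z * h + a%:Z) (p ^ r * n + b) = bk h n * 'C(a, b)%:R.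
Proof.
move=> lta ltb; have q0 : (0 < p ^ r)%N by rewrite expn_gt0 p_gt0.
have up g m : bk ((p ^ r)%N%:Z * (g + 1) + a%:Z) (p ^ r * m + b) =
    bk ((p ^ r)%N%:Z * g + a%:Z) (p ^ r * m + b) +
    (if m is m'.+1 then bk ((p ^ r)%N%:Z * g + a%:Z) (p ^ r * m' + b) else 0).
  have -> : (p ^ r)%N%:Z * (g + 1) + a%:Z = ((p ^ r)%N%:Z * g + a%:Z) + (p ^ r)%N%:Z by ring.
  rewrite bk_addq; congr (_ + _); case: m => [|m].
    by rewrite muln0 add0n leqNgt ltb.
  by rewrite mulnS -addnA leq_addr addKn.
have up1 g m : bk (g + 1) m = bk g m + (if m is m'.+1 then bk g m' else 0).
  case: m => [|m]; first by rewrite !bk0 addr0.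
  by rewrite /bk binz_pascal rmorphD.
elim/int_ind: h n => [|h IH|h IH] n.
- rewrite mulr0 add0r; case: n => [|n]; first by rewrite muln0 add0n bk0 mul1r.
  rewrite bk_nat bin_small ?mul0r //.
  by rewrite mulnS -addnA (leq_trans lta) // leq_addr.
- have -> : h.+1%:Z = h%:Z + 1 by lia.
  rewrite up up1 IH mulrDl; congr (_ + _); case: n => [|n]; rewrite ?mul0r //.
- set g := - h.+1%:Z; have gE : - h%:Z = g + 1 by rewrite /g; lia.
  rewrite gE in IH.
  elim: n => [|n IHn].
    by have := up g 0%N; rewrite IH up1 !addr0 => ->.
  have := up g n.+1; rewrite IH up1 IHn mulrDl => /eqP.
  by rewrite (inj_eq (addIr _)) => /eqP ->.
Qed.

Lemma bk_per r (z c : int) n : (n < p ^ r)%N -> bk (z + (p ^ r)%N%:Z * c) n = bk z n.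
Proof.
move=> ltn; have q0 : (0 < p ^ r)%N by rewrite expn_gt0 p_gt0.
set q := (p ^ r)%N in ltn q0 *.
pose a := `|(z %% q%:Z)%Z|%N; pose h := (z %/ q%:Z)%Z.
have aE : a%:Z = (z %% q%:Z)%Z by rewrite /a gez0_abs // modz_ge0 // eqz_nat -lt0n.
have lta : (a < q)%N by rewrite -ltz_nat aE ltz_pmod.
have zE : z = q%:Z * h + a%:Z by rewrite aE /h mulrC -divz_eq.
have := bk_lucas (r := r) h 0 lta ltn; have := bk_lucas (r := r) (h + c) 0 lta ltn.
rewrite !muln0 !add0n !bk0 -/q -zE => E1 ->; rewrite -E1; congr bk.
by rewrite {1}zE; ring.
Qed.

Lemma int_divp (z : int) q : (0 < q)%N ->
  exists (h : int) (a : nat), (a < q)%N /\ z = q%:Z * h + a%:Z.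
Proof.
move=> q0; exists (z %/ q%:Z)%Z, `|(z %% q%:Z)%Z|%N.
have aE : `|(z %% q%:Z)%Z|%N%:Z = (z %% q%:Z)%Z.
  by rewrite gez0_abs // modz_ge0 // eqz_nat -lt0n.
by split; [rewrite -ltz_nat aE ltz_pmod|rewrite aE mulrC -divz_eq].
Qed.

Definition per (r : nat) (F : int -> int) : Prop :=
  forall h c : int, (F (h + (p ^ r)%N%:Z * c))%:~R = (F h)%:~R :> k.

Lemma per_binz r n c : (n < p ^ r)%N -> per r (fun h => binz (h + c) n).
Proof.
by move=> ltn h d; rewrite addrAC; apply: bk_per.
Qed.

(** A function of period p^r modulo p is determined modulo p by its values at 0, ..., p^r - 1, hence
    by its first p^r Newton coefficients. *)
Lemma hL_per r F : ipf F -> per r F ->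
  hL k F = \sum_(n < p ^ r) (newton F n)%:~R *: binH k 0 n.
Proof.
move=> iF pF; have q0 : (0 < p ^ r)%N by rewrite expn_gt0 p_gt0.
pose G h := \sum_(n < p ^ r) newton F n * binz h n.
have iG : ipf G by apply: ipf_sum => n _; apply: ipfM (ipf_cst _) (ipf_binz _).
rewrite (@hL_congr F G) //.
  rewrite hL_sum; last by move=> n _; apply: ipfM (ipf_cst _) (ipf_binz _).
  by apply: eq_bigr => n _; rewrite hLZ ?binH0E //; apply: ipf_binz.
move=> h; have [c [a [lta ->]]] := int_divp h q0.
rewrite addrC pF (newton_formula F lta) /G !rmorph_sum; apply: eq_bigr => n _ /=.
rewrite rmorphMn rmorphM /= -[X in _ = _ * X]/(bk _ _) bk_per //.
by rewrite bk_nat mulr_natr.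
Qed.

Lemma bin_pmul_add n t : (t < p)%N -> 'C(p * n + t, t)%:R = 1 :> k.
Proof.
move=> ltt; have := bk_lucas (r := 1) n%:Z 0 (a := t) (b := t).
rewrite expn1 muln0 add0n bk0 mul1r binn -PoszM -PoszD bk_nat => E.
exact: E.
Qed.

Lemma bin_pmul n m : 'C(p * n, p * m)%:R = 'C(n, m)%:R :> k.
Proof.
have := bk_lucas (r := 1) n%:Z m (a := 0) (b := 0).
rewrite expn1 !addn0 addr0 -PoszM !bk_nat mulr1; apply; exact: p_gt0.
Qed.

Lemma bin_pmul_small n s t : (s < t)%N -> (t < p)%N -> 'C(p * n + s, t)%:R = 0 :> k.
Proof.
move=> lst ltt; have := bk_lucas (r := 1) n%:Z 0 (a := s) (b := t).
rewrite expn1 muln0 add0n bk0 mul1r -PoszM -PoszD bk_nat => ->.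
- by rewrite bin_small.
- exact: ltn_trans ltt.
- by [].
Qed.

Lemma hYp_add n t : (t < p)%N -> hY k (p * n) * hY k t = hY k (p * n + t).
Proof.
move=> ltt; rewrite hYM -bin_sub ?leq_addr // addKn.
by rewrite bin_pmul_add // scale1r.
Qed.

Lemma hXp_add n t : (t < p)%N -> hX k t * hX k (p * n) = hX k (p * n + t).
Proof. by move=> ltt; rewrite hXM addnC bin_pmul_add // scale1r. Qed.

Lemma hYC m n : hY k m * hY k n = hY k n * hY k m.
Proof. by rewrite !hYM addnC -bin_sub ?leq_addl // addnK. Qed.
Lemma hXC m n : hX k m * hX k n = hX k n * hX k m.
Proof. by rewrite !hXM addnC -bin_sub ?leq_addl // addnK. Qed.

Lemma hL1 F : ipf F -> (forall h, F h = 1) -> hL k F = 1.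
Proof.
by move=> iF E; rewrite (_ : F = fun=> 1) ?hL_cst ?scale1r //; apply/funext.
Qed.

(** In the commutation formula a term of index i > 0 contains binom(pm - i + t, t); for i <= t its
    last digit on top is t - i < t, so it vanishes in k. *)
Lemma hYX_hX t m : (t < p)%N ->
  hX k (p * m) * (hY k t * hX k t) = hY k t * hX k t * hX k (p * m).
Proof.
move=> ltt; rewrite mulrA hXY big_ord_recl /= mulrDl mulr_suml big1 ?addr0.
  rewrite /ydv leq0n !subn0 hL1; last 2 first.
  - by have := ipf_xy (p * m) t 0.
  - by move=> h; apply: binz0.
  by rewrite mulr1 -!mulrA hXC.
move=> i _; rewrite /bump /= add1n /ydv; case: ifP => [lei|_]; last by rewrite !mul0r.
rewrite -mulrA hXM.
have E : (p * m - i.+1 + t)%N = (p * m + (t - i.+1))%N by have := ltn_ord i; lia.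
rewrite -bin_sub ?leq_addr // addKn.
rewrite {1}E bin_pmul_small //; last by lia.
by rewrite scale0r mulr0.
Qed.

Lemma hYX_hY t m : (t < p)%N ->
  hY k t * hX k t * hY k (p * m) = hY k (p * m) * (hY k t * hX k t).
Proof.
move=> ltt; rewrite -mulrA hXY big_ord_recl /= mulrDr mulr_sumr big1 ?addr0.
  rewrite /ydv leq0n !subn0 hL1; last 2 first.
  - by have := ipf_xy t (p * m) 0.
  - by move=> h; apply: binz0.
  by rewrite mulr1 !mulrA hYC.
move=> i _; rewrite /bump /= add1n /ydv; case: ifP => [lei|_]; last by rewrite !mul0r mulr0.
rewrite !mulrA hYM.
have E : (t + (p * m - i.+1))%N = (p * m + (t - i.+1))%N by have := ltn_ord i; lia.
rewrite E bin_pmul_small //; last by have := ltn_ord i; lia.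
by rewrite scale0r !mul0r.
Qed.

Lemma hXp0 m n : (m < p)%N -> (n < p)%N -> (p <= m + n)%N -> hX k m * hX k n = 0.
Proof.
move=> ltm ltn le; rewrite hXM.
have -> : (m + n)%N = (p * 1 + (m + n - p))%N by lia.
by rewrite bin_pmul_small ?scale0r //; lia.
Qed.

End CharP.

Lemma linear_ext_span (k : fieldType) (V W : lmodType k) (S : set V) (f g : V -> W) :
  linear f -> linear g -> (forall u, S u -> f u = g u) ->
  forall u, kspan S u -> f u = g u.
Proof.
move=> lf lg H u; have z0 (h : V -> W) : linear h -> h 0 = 0.
  by move=> lh; have := lh (-1) 0 0; rewrite scaler0 addr0 scaleN1r addrC subrr.
elim=> [|c a b Sa _ IH]; first by rewrite !z0.
by rewrite lf lg IH H.
Qed.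

Lemma sum_ord_recl (V : nmodType) (q : nat) (f : nat -> V) : (0 < q)%N ->
  \sum_(t < q) f t = f 0%N + \sum_(t < q.-1) f t.+1.
Proof. by case: q => // q _; rewrite big_ord_recl. Qed.

Lemma sum_ord_mul (V : nmodType) (q m : nat) (f : nat -> V) :
  \sum_(t < q * m) f t = \sum_(i < m) \sum_(t < q) f (q * i + t)%N.
Proof.
elim: m => [|m IH]; first by rewrite muln0 !big_ord0.
rewrite big_ord_recr /= -IH mulnSr big_split_ord /=.
by [].
Qed.

(** * The twisted Frobenius map *)

Section Block.
Variables (k : fieldType) (p : nat).
Hypothesis hp : p \in [pchar k].

Let p_pr : prime p. Proof. exact: pcharf_prime hp. Qed.
Let p_gt0 : (0 < p)%N. Proof. exact: prime_gt0 p_pr. Qed.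

Local Notation bk := (@bk k).

(** For 0 <= c < p, binom(c,p-1) is 1 if c = p - 1 and 0 otherwise. Hence [mu] is the projector onto
    the weights congruent to a modulo p. *)
Lemma mu_val (a b : nat) (h : int) : (a < p)%N -> (b < p)%N ->
  bk (p%:Z * h + b%:Z + (- a%:Z - 1)) p.-1 = (b == a)%:R.
Proof.
move=> lta ltb; have lt1 : (p.-1 < p)%N by rewrite prednK.
have L (g : int) (c : nat) : (c < p)%N -> bk (p%:Z * g + c%:Z) p.-1 = 'C(c, p.-1)%:R.
  move=> ltc; have := bk_lucas hp (r := 1) g 0 (a := c) (b := p.-1).
  by rewrite expn1 muln0 add0n bk0 mul1r; apply.
case: (leqP b a) => [leba|ltab].
  have -> : p%:Z * h + b%:Z + (- a%:Z - 1) = p%:Z * (h - 1) + (p.-1 - (a - b))%N%:Z.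
    have -> : (p.-1 - (a - b))%N%:Z = p%:Z - 1 - (a%:Z - b%:Z) by lia.
    ring.
  rewrite L; last by lia.
  case: (ltngtP b a) leba => // [ltba|->] _; last by rewrite subnn subn0 binn.
  by rewrite bin_small //; lia.
have -> : p%:Z * h + b%:Z + (- a%:Z - 1) = p%:Z * h + (b - a).-1%:Z by lia.
rewrite L; last by lia.
by rewrite gtn_eqF // bin_small //; lia.
Qed.

Lemma per1_hX F m : ipf F -> per k p 1 F -> hL k F * hX k (p * m) = hX k (p * m) * hL k F.
Proof.
move=> iF pF; rewrite hL_X //; congr (_ * _); apply: (hL_congr hp) => //.
  exact: ipf_shift.
by move=> h; rewrite PoszM mulrCA -[p in p%:Z]expn1 pF.
Qed.

Lemma per1_hY F m : ipf F -> per k p 1 F -> hL k F * hY k (p * m) = hY k (p * m) * hL k F.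
Proof.
move=> iF pF; rewrite hL_Y //; congr (_ * _); apply: (hL_congr hp) => //.
  exact: ipf_shift.
by move=> h; rewrite PoszM mulrCA -[p in p%:Z]expn1 -mulrN pF.
Qed.

Lemma mu_hL a : mu k p a = hL k (fun h => binz (h + (- a%:Z - 1)) p.-1).
Proof. exact: binHE. Qed.

Lemma mu_per a : per k p 1 (fun h => binz (h + (- a%:Z - 1)) p.-1).
Proof. by apply: per_binz; rewrite // expn1 prednK. Qed.

Variables (a s : nat) (delta : bool) (e : hyper k).
Hypothesis lt_ap : (a < p)%N.
Hypothesis eX : forall m, e * hX k (p * m) = hX k (p * m) * e.
Hypothesis eY : forall m, e * hY k (p * m) = hY k (p * m) * e.
Hypothesis eL : forall F, ipf F -> e * hL k F = hL k F * e.
Hypothesis mu_e : mu k p a * e = e.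
Hypothesis ee : e * e = e.
(** The coefficient binom(a,t+1) is the value modulo p of binom(H,t+1) on every weight congruent to
    a, by Lucas. *)
Hypothesis Q_e : \sum_(t < p.-1) 'C(a, t.+1)%:R *:
  (hY k (p - t.+1) * hX k (p - t.+1) * e) = (delta : nat)%:R *: e.
Hypothesis shift_s : forall (h : int) n,
  bk (p%:Z * h + a%:Z + 2 * s%:Z) (p * n) = bk (h + (delta : nat)%:Z) n.

(* [twist F F']: on the weights congruent to [a] modulo [p], [F'] is [F]
   precomposed with division by [p] and translation by [delta]. *)
Definition twist (F F' : int -> int) : Prop :=
  forall h : int, (F' (p%:Z * h + a%:Z))%:~R = (F (h + (delta : nat)%:Z))%:~R :> k.

(** Since [mu] fixes e, it may be inserted on both sides; it annihilates the values at all weights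
    not congruent to a. *)
Lemma hL_e_congr F G : ipf F -> ipf G ->
  (forall h : int, (F (p%:Z * h + a%:Z))%:~R = (G (p%:Z * h + a%:Z))%:~R :> k) ->
  hL k F * e = hL k G * e.
Proof.
move=> iF iG E; rewrite -mu_e mu_hL !mulrA.
have ib : ipf (fun h => binz (h + (- a%:Z - 1)) p.-1) by apply: ipf_binzD.
rewrite -!hLM //; congr (_ * e); apply: (hL_congr hp); try exact: ipfM.
move=> h; have [c [b [ltb ->]]] := int_divp h p_gt0.
rewrite !rmorphM /= -[(binz _ _)%:~R]/(bk _ _) mu_val //.
by case: eqP => [->|_]; rewrite ?mulr0 // E.
Qed.

(** In the Newton expansion of F each binom(h,j) is replaced by binom(h+2s,pj); [shift_s] is the
    twist property for one binomial. *)
Lemma twist_exists F : ipf F -> exists2 F', ipf F' & twist F F'.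
Proof.
move=> iF; have [N EN] := ipf_newton iF.
exists (fun h => \sum_(j < N) newton F j * binz (h + 2 * s%:Z) (p * j)).
  by apply: ipf_sum => j _; apply: ipfM (ipf_cst _) (ipf_binzD _ _).
move=> h; rewrite (EN (h + _)) !rmorph_sum /=; apply: eq_bigr => j _.
by rewrite !rmorphM /= -[(binz (_ + 2 * _) _)%:~R]/(bk _ _) shift_s.
Qed.

Variable G : hyper k -> hyper k.
Hypothesis G_lin : linear G.
Hypothesis G_basis : forall m n l, G (hY k m * binH k 0 n * hX k l) =
  hY k (p * m) * hL k (fun h => binz (h + 2 * s%:Z) (p * n)) * hX k (p * l) * e.

Lemma G0 : G 0 = 0.
Proof. by have := G_lin (-1) 0 0; rewrite scaler0 addr0 scaleN1r addrC subrr. Qed.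
Lemma GD x y : G (x + y) = G x + G y.
Proof. by have := G_lin 1 x y; rewrite !scale1r. Qed.
Lemma GZ c x : G (c *: x) = c *: G x.
Proof. by have := G_lin c x 0; rewrite !addr0 G0 addr0. Qed.
Lemma G_sum (I : Type) (r : seq I) (P : pred I) (F : I -> hyper k) :
  G (\sum_(i <- r | P i) F i) = \sum_(i <- r | P i) G (F i).
Proof. exact: (big_morph _ GD G0). Qed.

(** All twists of F give the same element on e, by [hL_e_congr], so each later computation may use
    the most convenient one. *)
Lemma G_term F F' m l : ipf F -> ipf F' -> twist F F' ->
  G (hY k m * hL k F * hX k l) = hY k (p * m) * hL k F' * hX k (p * l) * e.
Proof.
move=> iF iF' tw; have [N EN] := ipf_newton iF.
have ib j : ipf (fun h : int => newton F j * binz h j).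
  exact: ipfM (ipf_cst _) (ipf_binz _).
have ib' (j : nat) : ipf (fun h : int => newton F j * binz (h + 2 * s%:Z) (p * j)).
  exact: ipfM (ipf_cst _) (ipf_binzD _ _).
have -> : hL k F = \sum_(j < N) (newton F j)%:~R *: binH k 0 j.
  rewrite {1}(_ : F = fun h => \sum_(j < N) newton F j * binz h j); last exact/funext.
  rewrite hL_sum //; apply: eq_bigr => j _.
  by rewrite hLZ ?binH0E //; apply: ipf_binz.
have -> : hY k (p * m) * hL k F' * hX k (p * l) * e =
   hY k (p * m) * (\sum_(j < N) (newton F j)%:~R *: hL k (fun h => binz (h + 2 * s%:Z) (p * j)))
     * hX k (p * l) * e.
  rewrite -!mulrA -!eX !(mulrA (hL _ _)) !(mulrA (\sum_(j < N) _)); congr (_ * (_ * _)).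
  pose F2 h := \sum_(j < N) newton F j * binz (h + 2 * s%:Z) (p * j).
  transitivity (hL k F2 * e).
    apply: hL_e_congr => // [|h]; first by apply: ipf_sum => j _.
    rewrite tw (EN (h + _)) /F2 !rmorph_sum /=; apply: eq_bigr => j _.
    by rewrite !rmorphM /= -[(binz (_ + 2 * _) _)%:~R]/(bk _ _) shift_s.
  congr (_ * _); rewrite hL_sum //; apply: eq_bigr => j _.
  by rewrite hLZ //; apply: ipf_binzD.
rewrite !(mulr_sumr, mulr_suml) G_sum; apply: eq_bigr => j _.
by rewrite -!scalerAr -!scalerAl GZ G_basis.
Qed.

Lemma linear_mulr (u : hyper k) : linear (fun z : hyper k => z * u).
Proof. by move=> c x y; rewrite mulrDl scalerAl. Qed.
Lemma linear_mull (u : hyper k) : linear (fun z : hyper k => u * z).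
Proof. by move=> c x y; rewrite mulrDr scalerAr. Qed.
Lemma linear_compf (f g : hyper k -> hyper k) : linear f -> linear g -> linear (f \o g).
Proof. by move=> lf lg c x y /=; rewrite lg lf. Qed.

Lemma eqG (f g : hyper k -> hyper k) : linear f -> linear g ->
  (forall m F l, ipf F -> f (hY k m * hL k F * hX k l) = g (hY k m * hL k F * hX k l)) ->
  f =1 g.
Proof.
move=> lf lg H z; apply: (linear_ext_span lf lg _ (hyper_basis_span z)).
by move=> _ [m [n [l ->]]]; rewrite binH0E; apply: H; apply: ipf_binz.
Qed.

Lemma eG z : e * G z = G z.
Proof.
apply: (@eqG (fun z => e * G z)) => //.
  exact: (linear_compf (linear_mull e) G_lin).
move=> m F l iF; have [F' iF' tw] := twist_exists iF.
rewrite (G_term _ _ iF iF' tw) !mulrA eY -(mulrA _ e) eL // mulrA -(mulrA _ e) eX.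
by rewrite mulrA -(mulrA _ e) ee.
Qed.

Lemma G1 : G 1 = e.
Proof.
have -> : 1 = hY k 0 * binH k 0 0 * hX k 0.
  rewrite hX0 hY0 mul1r mulr1 binH0E (@hL1 k (binz^~ 0%N)) //.
    exact: ipf_binz.
  by move=> h; rewrite binz0.
rewrite G_basis muln0 hX0 hY0 mul1r mulr1 hL1 ?mul1r //; first exact: ipf_binzD.
by move=> h; rewrite binz0.
Qed.

Lemma G_mulX z l : G (z * hX k l) = G z * hX k (p * l).
Proof.
apply: (@eqG (fun z => G (z * hX k l)) (fun z => G z * hX k (p * l))).
- exact: (linear_compf G_lin (linear_mulr _)).
- exact: (linear_compf (linear_mulr _) G_lin).
move=> m F l' iF; have [F' iF' tw] := twist_exists iF.
rewrite (G_term _ _ iF iF' tw) -mulrA hXM -scalerAr GZ (G_term _ _ iF iF' tw).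
rewrite -(mulrA _ e) eX mulrA -(mulrA _ (hX k _) (hX k _)) hXM -mulnDr (bin_pmul hp).
by rewrite -scalerAr -scalerAl.
Qed.

Lemma G_mulL z F F' : ipf F -> ipf F' -> twist F F' -> G (z * hL k F) = G z * hL k F'.
Proof.
move=> iF iF' tw.
apply: (@eqG (fun z => G (z * hL k F)) (fun z => G z * hL k F')).
- exact: (linear_compf G_lin (linear_mulr _)).
- exact: (linear_compf (linear_mulr _) G_lin).
move=> m B l iB; have [B' iB' twB] := twist_exists iB.
rewrite (G_term _ _ iB iB' twB) -mulrA hX_L // mulrA -(mulrA _ (hL k B)) -hLM //;
  last exact: ipf_shift.
rewrite (@G_term _ (fun h => B' h * F' (h - 2 * (p * l)%N%:Z))); last 3 first.
- exact: ipfM (ipf_shift _ iF).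
- exact: ipfM (ipf_shift _ iF').
- move=> h; rewrite !rmorphM /= twB; congr (_ * _).
  have -> : p%:Z * h + a%:Z - 2 * (p * l)%N%:Z = p%:Z * (h - 2 * l%:Z) + a%:Z.
    by rewrite PoszM; ring.
  by rewrite tw; congr (F _)%:~R; ring.
rewrite -(mulrA _ e) eL // mulrA -(mulrA _ (hX k _) (hL k _)) hX_L // hLM //; last exact: ipf_shift.
by rewrite !mulrA.
Qed.

Lemma G_Ymul z m : G (hY k m * z) = hY k (p * m) * G z.
Proof.
apply: (@eqG (fun z => G (hY k m * z)) (fun z => hY k (p * m) * G z)).
- exact: (linear_compf G_lin (linear_mull _)).
- exact: (linear_compf (linear_mull _) G_lin).
move=> m' F l iF; have [F' iF' tw] := twist_exists iF.
rewrite (G_term _ _ iF iF' tw) !mulrA !hYM -!scalerAl GZ (G_term _ _ iF iF' tw).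
by rewrite -mulnDr (bin_pmul hp).
Qed.

Lemma G_Lmul z F F' : ipf F -> ipf F' -> twist F F' -> G (hL k F * z) = hL k F' * G z.
Proof.
move=> iF iF' tw.
apply: (@eqG (fun z => G (hL k F * z)) (fun z => hL k F' * G z)).
- exact: (linear_compf G_lin (linear_mull _)).
- exact: (linear_compf (linear_mull _) G_lin).
move=> m B l iB; have [B' iB' twB] := twist_exists iB.
rewrite (G_term _ _ iB iB' twB) !mulrA !hL_Y // -(mulrA (hY k m)) -hLM //;
  last exact: ipf_shift.
rewrite (@G_term _ (fun h => F' (h - 2 * (p * m)%N%:Z) * B' h)); last 3 first.
- exact: ipfM (ipf_shift _ iF) iB.
- exact: ipfM (ipf_shift _ iF') iB'.
- move=> h; rewrite !rmorphM /= twB; congr (_ * _).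
  have -> : p%:Z * h + a%:Z - 2 * (p * m)%N%:Z = p%:Z * (h - 2 * m%:Z) + a%:Z.
    by rewrite PoszM; ring.
  by rewrite tw; congr (F _)%:~R; ring.
by rewrite hLM ?mulrA //; apply: ipf_shift.
Qed.

(* In the expansion of [X^(pm) Y^(pn) e], the terms of index [p i + t] with
   [0 < t < p] add up to the one of index [p (i + 1)] with the binomial coefficient
   of index [p i], times [delta]. *)
Lemma G_XY m n : G (hX k m * hY k n) = hX k (p * m) * hY k (p * n) * e.
Proof.
pose T (i : nat) : hyper k := ydv k (p * n) (p * i) * hX k (p * m - p * i).
pose B (i : nat) (h : int) := binz (h + (p%:Z * (m%:Z - n%:Z))) (p * i).
have iB i : ipf (B i) by apply: ipf_binzD.
have BE (h : int) i t : (t < p)%N ->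
    bk (p%:Z * h + a%:Z + p%:Z * (m%:Z - n%:Z)) (p * i + t) = bk (h + (m%:Z - n%:Z)) i * 'C(a, t)%:R.
  move=> ltt; have -> : p%:Z * h + a%:Z + p%:Z * (m%:Z - n%:Z) = p%:Z * (h + (m%:Z - n%:Z)) + a%:Z by ring.
  by have := bk_lucas hp (r := 1) (h + (m%:Z - n%:Z)) i (a := a) (b := t); rewrite expn1; apply.
have BE0 (h : int) i : (B i (p%:Z * h + a%:Z))%:~R = bk (h + (m%:Z - n%:Z)) i.
  by have := BE h i 0%N p_gt0; rewrite addn0 bin0 mulr1.
(* The term of index t in the expansion of X^(pm) Y^(pn) e, with its binomial moved to the right of
   the power of X so that it can be evaluated on e. *)
pose f (t : nat) : hyper k := ydv k (p * n) t * hX k (p * m - t) *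
  (hL k (fun h => binz (h + p%:Z * (m%:Z - n%:Z)) t) * e).
have LHS1 : hX k (p * m) * hY k (p * n) * e = \sum_(t < (p * m).+1) f t.
  rewrite hXY mulr_suml; apply: eq_bigr => t _; rewrite /f !mulrA; congr (_ * _).
  rewrite -!mulrA hL_X; last exact: ipf_xy.
  congr (_ * (_ * hL k _)); apply/funext => h; congr binz.
  by have := ltn_ord t; rewrite !PoszM; lia.
have f0 i : f (p * i)%N = T i * (hL k (B i) * e) by [].
(* For 0 < t < p, Lucas splits binom(a,t) off the binomial of index pi + t, and Y^(pn-pi-t) =
   Y^(p(n-i-1)) Y^(p-t), similarly for X. The sum over these t is therefore the one in [Q_e]. *)
have sumT i : (i < m)%N -> \sum_(t < p) f (p * i + t)%N =
    T i * (hL k (B i) * e) + (delta : nat)%:R *: (T i.+1 * (hL k (B i) * e)).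
  move=> ltim; rewrite (sum_ord_recl (fun t => f (p * i + t)%N) p_gt0) addn0 f0.
  congr (_ + _); rewrite /T /ydv leq_pmul2l //.
  case: ifP => [ltin|/negbT]; last first.
    rewrite -leqNgt => leni; rewrite !mul0r scaler0 big1 // => t _.
    have le0 : (p * n <= p * i)%N by rewrite leq_pmul2l.
    by rewrite /f /ydv ifF ?mul0r //; apply/negbTE; rewrite -ltnNge addnS ltnS (leq_trans le0) // leq_addr.
  have -> : (delta : nat)%:R *: (hY k (p * n - p * i.+1) * hX k (p * m - p * i.+1) * (hL k (B i) * e)) =
      hY k (p * (n - i.+1)) * ((delta : nat)%:R *: e) * (hX k (p * (m - i.+1)) * hL k (B i)).
    rewrite -!mulnBr -scalerAr -scalerAl -!mulrA; congr (_ *: (_ * _)).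
    by rewrite [RHS]mulrA eX -[RHS]mulrA eL.
  rewrite -Q_e mulr_sumr mulr_suml; apply: eq_bigr => t _; rewrite /f /ydv.
  have ltt : (t.+1 < p)%N by have := ltn_ord t; lia.
  have le1 : (p * i.+1 <= p * n)%N by rewrite leq_pmul2l.
  have le2 : (p * i.+1 <= p * m)%N by rewrite leq_pmul2l.
  have le3 : (p * i + t.+1 <= p * n)%N by rewrite mulnS in le1; lia.
  rewrite le3.
  have -> : (p * n - (p * i + t.+1) = p * (n - i.+1) + (p - t.+1))%N.
    by rewrite mulnBr mulnS in le1 *; lia.
  have -> : (p * m - (p * i + t.+1) = p * (m - i.+1) + (p - t.+1))%N.
    by rewrite mulnBr mulnS in le2 *; lia.
  rewrite -(hYp_add hp) ?ltn_subrL // -(hXp_add hp) ?ltn_subrL //.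
  have -> : hL k (fun h => binz (h + p%:Z * (m%:Z - n%:Z)) (p * i + t.+1)) * e =
     'C(a, t.+1)%:R *: (hL k (B i) * e).
    rewrite -[X in X *: _]/('C(a, t.+1)%:Z%:~R) scalerAl -hLZ //.
    apply: hL_e_congr => [||h]; first exact: ipf_binzD.
      exact: ipfM (ipf_cst _) (iB i).
    rewrite rmorphM /= BE0 -[LHS]/(bk _ _) BE //.
    by rewrite mulrC.
  rewrite -!scalerAr -scalerAl; congr (_ *: _); rewrite -!mulrA; congr (_ * (_ * (_ * _))).
  by rewrite -eL // !mulrA eX.
rewrite LHS1 big_ord_recr /= (sum_ord_mul p m f).
under eq_bigr => i _ do rewrite (sumT i (ltn_ord i)).
rewrite big_split /= addrAC f0.
have -> : \sum_(i < m) T i * (hL k (B i) * e) + T m * (hL k (B m) * e) =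
    \sum_(i < m.+1) T i * (hL k (B i) * e) by rewrite big_ord_recr.
(* The contribution carried over from index i - 1 to index i. By Pascal's rule it adds up with
   [B i], after a translation, to a twist of the binomial in X^(m) Y^(n). *)
pose B1 (i : nat) (h : int) : int := if i is j.+1 then (delta : nat)%:Z * B j h else 0.
have iB1 i : ipf (B1 i) by case: i => [|i]; [exact: ipf_cst|exact: ipfM (ipf_cst _) (iB i)].
have -> : \sum_(i < m) (delta : nat)%:R *: (T i.+1 * (hL k (B i) * e)) =
   \sum_(i < m.+1) T i * (hL k (B1 i) * e).
  rewrite big_ord_recl /= hL_cst scale0r mul0r mulr0 add0r; apply: eq_bigr => i _.
  rewrite /bump /= add1n hLZ // -[X in X *: (T _ * _)]/((delta : nat)%:Z%:~R).
  by rewrite -scalerAl -scalerAr.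
rewrite -big_split /= hXY G_sum; apply: eq_bigr => i _.
have lei : (i <= m)%N by rewrite -ltnS.
rewrite -mulrDr -mulrDl -hLD // /T /ydv leq_pmul2l //; case: ifP => [lein|_]; last by rewrite !mul0r G0.
pose F' (h : int) := B i (h - 2 * (p%:Z * (m%:Z - i%:Z))) + B1 i (h - 2 * (p%:Z * (m%:Z - i%:Z))).
have iF' : ipf F' by apply: ipfD; apply: ipf_shift.
rewrite (@G_term _ F') //; first last.
- move=> h; rewrite rmorphD /=.
  have -> : p%:Z * h + a%:Z - 2 * (p%:Z * (m%:Z - i%:Z)) = p%:Z * (h - 2 * (m%:Z - i%:Z)) + a%:Z by ring.
  rewrite BE0; case: (nat_of_ord i) => [|j] /=.
    by rewrite addr0 /bk !binz0.
  rewrite rmorphM /= BE0.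
  have -> : h - 2 * (m%:Z - j.+1%:Z) + (m%:Z - n%:Z) = h - m%:Z - n%:Z + 2 * j.+1%:Z by ring.
  rewrite -[RHS]/(bk _ _); case: (delta) => /=; last by rewrite mul0r !addr0.
  by rewrite mul1r -rmorphD /= -binz_pascal; congr (binz _ _)%:~R; ring.
- exact: ipf_xy.
rewrite -!mulnBr -!mulrA; congr (_ * _); rewrite !mulrA; congr (_ * _).
rewrite hL_X //; congr (_ * hL k _); apply/funext => h.
by rewrite /F' /B1; have -> : h + 2 * (p * (m - i))%N%:Z - 2 * (p%:Z * (m%:Z - i%:Z)) = h
  by rewrite PoszM -subzn //; ring.
Qed.

Lemma G_Xmul z m : G (hX k m * z) = hX k (p * m) * G z.
Proof.
apply: (@eqG (fun z => G (hX k m * z)) (fun z => hX k (p * m) * G z)).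
- exact: (linear_compf G_lin (linear_mull _)).
- exact: (linear_compf (linear_mull _) G_lin).
move=> n F l iF; have [F' iF' tw] := twist_exists iF.
rewrite (G_term _ _ iF iF' tw) !mulrA G_mulX (G_mulL _ iF iF' tw) G_XY.
rewrite -(mulrA _ e) eL // mulrA -(mulrA _ e) eX.
by rewrite !mulrA.
Qed.

Lemma GM x y : G (x * y) = G x * G y.
Proof.
apply: (@eqG (fun x => G (x * y)) (fun x => G x * G y)).
- exact: (linear_compf G_lin (linear_mulr _)).
- exact: (linear_compf (linear_mulr _) G_lin).
move=> m F l iF; have [F' iF' tw] := twist_exists iF.
by rewrite -!mulrA G_Ymul (G_Lmul _ iF iF' tw) G_Xmul !mulrA (G_term _ _ iF iF' tw) -!mulrA eG.
Qed.

End Block.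

(** * The elements B^(eps)(a, j) *)

Section RankOne.
Variables (k : fieldType) (p : nat).
Hypothesis hp : p \in [pchar k].

Let p_pr : prime p. Proof. exact: pcharf_prime hp. Qed.
Let p_gt0 : (0 < p)%N. Proof. exact: prime_gt0 p_pr. Qed.
Let p_gt1 : (1 < p)%N. Proof. exact: prime_gt1 p_pr. Qed.

Local Notation bk := (@bk k).
Local Notation U := (hyper k).

Lemma Fr'P : linear (@Fr' k p) /\ forall m n l,
  Fr' p (hY k m * binH k 0 n * hX k l) =
  hY k (m * p) * binH k 0 (n * p) * hX k (l * p).
Proof.
rewrite /Fr'; case: xgetP => [f _ [lf Hf]|H]; first by split.
have [f [lf Hf]] := hyper_lift (fun m n l => hY k (m * p) * binH k 0 (n * p) * hX k (l * p)).
by exfalso; apply: (H f).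
Qed.

Definition central1 (x : U) : Prop :=
  [/\ forall m, x * hX k (p * m) = hX k (p * m) * x,
      forall m, x * hY k (p * m) = hY k (p * m) * x
    & forall F, ipf F -> x * hL k F = hL k F * x].

Lemma central1_1 : central1 1.
Proof. by split=> *; rewrite mul1r mulr1. Qed.
Lemma central1D x y : central1 x -> central1 y -> central1 (x + y).
Proof.
move=> [x1 x2 x3] [y1 y2 y3]; split=> [m|m|F iF]; rewrite mulrDl mulrDr.
- by rewrite x1 y1.
- by rewrite x2 y2.
- by rewrite x3 // y3.
Qed.
Lemma central1Z c x : central1 x -> central1 (c *: x).
Proof.
move=> [x1 x2 x3]; split=> [m|m|F iF]; rewrite -scalerAl -scalerAr.
- by rewrite x1.
- by rewrite x2.
- by rewrite x3.
Qed.
Lemma central1M x y : central1 x -> central1 y -> central1 (x * y).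
Proof.
move=> [x1 x2 x3] [y1 y2 y3]; split=> [m|m|F iF]; rewrite -mulrA.
- by rewrite y1 mulrA x1 mulrA.
- by rewrite y2 mulrA x2 mulrA.
- by rewrite y3 // mulrA x3 // mulrA.
Qed.
Lemma central1_0 : central1 0.
Proof. by rewrite -(scale0r 1); apply: central1Z; apply: central1_1. Qed.
Lemma central1_horner x f : central1 x -> central1 (horner_alg x f).
Proof.
move=> cx; elim/poly_ind: f => [|f c IH]; first by rewrite rmorph0; apply: central1_0.
rewrite rmorphD rmorphM /= horner_algX horner_algC; apply: central1D.
  exact: central1M.
by apply: central1Z; apply: central1_1.
Qed.
Lemma central1_per F : ipf F -> per k p 1 F -> central1 (hL k F).
Proof.
move=> iF pF; split=> [m|m|G iG]; first exact: per1_hX; first exact: per1_hY.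
exact: hLC.
Qed.
Lemma ipf_mu a : ipf (fun h => binz (h + (- a%:Z - 1)) p.-1).
Proof. exact: ipf_binzD. Qed.
Lemma central1_mu a : central1 (mu k p a).
Proof. by rewrite mu_hL; apply: central1_per; [exact: ipf_mu|exact: mu_per]. Qed.

Lemma hYX_hL t F : ipf F -> hY k t * hX k t * hL k F = hL k F * (hY k t * hX k t).
Proof.
move=> iF; rewrite -mulrA hX_L // mulrA hY_L; last exact: ipf_shift.
by rewrite -mulrA; congr (hL k _ * _); apply/funext => h; congr F; lia.
Qed.
Lemma central1_YX t : (t < p)%N -> central1 (hY k t * hX k t).
Proof.
move=> ltt; split=> [m|m|F iF]; first by rewrite (hYX_hX hp).
  exact: (hYX_hY hp).
exact: hYX_hL.
Qed.

Lemma mu_idem a : (a < p)%N -> mu k p a * mu k p a = mu k p a.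
Proof.
move=> lta; rewrite mu_hL -hLM; try exact: ipf_mu.
apply: (hL_congr hp); [exact: ipfM (ipf_mu a) (ipf_mu a)|exact: ipf_mu|].
move=> h; rewrite rmorphM /=; have [c [b [ltb ->]]] := int_divp h p_gt0.
rewrite -[(binz _ _)%:~R]/(bk _ _) mu_val //.
by case: eqP; rewrite ?mulr1 ?mulr0.
Qed.

Lemma hL_mu a F G : (a < p)%N -> ipf F -> ipf G ->
  (forall h : int, (F (p%:Z * h + a%:Z))%:~R = (G (p%:Z * h + a%:Z))%:~R :> k) ->
  hL k F * mu k p a = hL k G * mu k p a.
Proof. by move=> lta; apply: (hL_e_congr hp lta); apply: mu_idem. Qed.

Lemma hX1_exp m : hX k 1 ^+ m = m`!%:R *: hX k m.
Proof.
elim: m => [|m IH]; first by rewrite hX0 scale1r.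
by rewrite exprSr IH -scalerAl hXM addn1 binSn scalerA factS mulnC natrM.
Qed.
Lemma hY1_exp m : hY k 1 ^+ m = m`!%:R *: hY k m.
Proof.
elim: m => [|m IH]; first by rewrite hY0 scale1r.
by rewrite exprSr IH -scalerAl hYM addn1 binSn scalerA factS mulnC natrM.
Qed.

Definition E (m : nat) : U := hY k 1 ^+ m * hX k 1 ^+ m.

Lemma E_YX m : E m = (m`!%:R ^+ 2) *: (hY k m * hX k m).
Proof. by rewrite /E hX1_exp hY1_exp -scalerAr -scalerAl scalerA. Qed.

Lemma fact_neq0 m : (m < p)%N -> m`!%:R != 0 :> k.
Proof.
elim: m => [|m IH] ltm; first by rewrite oner_eq0.
rewrite factS natrM mulf_neq0 ?IH //; last exact: ltnW.
by rewrite -(dvdn_pcharf hp) gtnNdvd.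
Qed.

Lemma YX_E m : (m < p)%N -> hY k m * hX k m = (m`!%:R ^- 2) *: E m.
Proof.
by move=> ltm; rewrite E_YX scalerA mulVf ?scale1r // expf_neq0 // fact_neq0.
Qed.

Lemma central1_E m : (m < p)%N -> central1 (E m).
Proof. by move=> ltm; rewrite E_YX; apply: central1Z; apply: central1_YX. Qed.

Lemma E0 : E 0 = 1. Proof. by rewrite /E !expr0 mul1r. Qed.
Lemma E1 : E 1 = hY k 1 * hX k 1. Proof. by rewrite /E !expr1. Qed.

Lemma Ep : E p = 0.
Proof.
rewrite /E hX1_exp (_ : p`!%:R = 0) ?scale0r ?mulr0 //; apply/eqP.
by rewrite -(dvdn_pcharf hp) dvdn_fact // p_gt0 /=.
Qed.

Lemma ipf_add c : ipf (fun h : int => h + c).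
Proof. exact: ipf_shift ipf_id. Qed.

Lemma hX1_hX m : hX k m * (hY k 1 * hX k 1) =
  m.+1%:R *: (hY k 1 * hX k m.+1) + m%:R *: (hX k m * hL k (fun h => h + m.+1%:Z)).
Proof.
case: m => [|m].
  by rewrite hX0 mul1r scale0r addr0 scale1r.
rewrite mulrA hXY 2!big_ord_recl /= big1 ?addr0; last first.
  by move=> i _; rewrite /ydv /bump /= !mul0r.
rewrite /ydv /= !subn0 /bump /= addn0 subnn hY0 mul1r subSS subn0.
rewrite hL1; last 2 first.
- exact: ipf_xy.
- by move=> h; rewrite binz0.
rewrite mulr1 mulrDl -mulrA hXM addn1 binSn -scalerAr; congr (_ + _).
rewrite -mulrA hXM addn1 binSn -scalerAr hL_X; last exact: ipf_xy.
congr (_ *: (_ * hL k _)).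
apply/funext => h; have := binzS (h + 2 * m.+1%:Z - m.+1%:Z - 1%:Z + 2 * 1%:Z) 0.
by rewrite binz0 mul1r mulr1 => ->; lia.
Qed.

(** Iterated, this writes Y^m X^m as a product of linear factors in YX and H, which on a fixed
    weight becomes a polynomial in YX. *)
Lemma ES m : E m.+1 = E m * (hY k 1 * hX k 1 - m%:R *: hL k (fun h => h + m.+1%:Z)).
Proof.
rewrite !E_YX -scalerAl mulrBr -mulrA hX1_hX mulrDr -!scalerAr mulrA hYM.
rewrite (mulrA (hY k m) (hX k m)) addrK addn1 binSn -scalerAl !scalerA; congr (_ *: _).
by rewrite factS natrM; ring.
Qed.

(** Reordering gives a sum of Y^(t-i) X^(t-i) binom(H,i) with i <= t < p: the first factor falls
    under [central1_YX], the second has period p. *)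
Lemma central1_XY t : (t < p)%N -> central1 (hX k t * hY k t).
Proof.
move=> ltt; rewrite hXY.
apply: (big_ind central1); [exact: central1_0|exact: central1D|move=> i _].
rewrite /ydv; case: ifP => [_|_]; last by rewrite !mul0r; apply: central1_0.
rewrite -mulrA hL_X; last exact: ipf_xy.
rewrite mulrA; apply: central1M; first by apply: central1_YX; lia.
have E : (fun h : int => binz (h + 2 * (t - i)%N%:Z - t%:Z - t%:Z + 2 * i%:Z) i) = binz^~ i.
  by apply/funext => h; congr binz; have := ltn_ord i; lia.
rewrite E; apply: central1_per; first exact: ipf_binz.
move=> h c; apply: (bk_per hp); rewrite expn1; have := ltn_ord i; lia.
Qed.

(* Conjugation by [X^(s)] and [Y^(s)] turns the commutator of [X^(p)] and
   [Y^(p)] on the weight [a] into the one on the weight [a + 2 s], which is 0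
   or 1 modulo [p] and for which all the middle terms vanish. *)
Section Conjugation.
Variables (a b s : nat) (e v : U).
Hypothesis (lt_ap : (a < p)%N) (mu_e : mu k p a * e = e).
Hypotheses (s_gt0 : (0 < s)%N) (lt_sp : (s < p)%N) (le_b1 : (b <= 1)%N).
Hypothesis abs : (a + 2 * s = p + b)%N.
Hypothesis inv_e : hY k s * hX k s * e * v = e.

Lemma hL_e_a F G : ipf F -> ipf G ->
  (forall h : int, (F (p%:Z * h + a%:Z))%:~R = (G (p%:Z * h + a%:Z))%:~R :> k) ->
  hL k F * e = hL k G * e.
Proof. exact: (hL_e_congr hp lt_ap mu_e). Qed.

Let lt_bp : (b < p)%N. Proof. by apply: leq_ltn_trans le_b1 _. Qed.

Let XpYp (z : U) : hX k p * hY k p * z = hY k p * hX k p * z +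
  \sum_(t < p.-1) hY k (p - t.+1) * hX k (p - t.+1) * hL k (binz^~ t.+1) * z
  + hL k (binz^~ p) * z.
Proof.
have T (i : nat) : (i <= p)%N ->
    ydv k p i * hL k (fun h => binz (h - p%:Z - p%:Z + 2 * i%:Z) i) * hX k (p - i) =
    hY k (p - i) * hX k (p - i) * hL k (binz^~ i).
  move=> lei; rewrite /ydv lei -mulrA hL_X; last exact: ipf_xy.
  rewrite mulrA; congr (_ * hL k _); apply/funext => h; congr binz; lia.
rewrite hXY big_ord_recr /= T // subnn hY0 hX0 !mul1r mulrDl; congr (_ + _).
rewrite (sum_ord_recl (fun i => ydv k p i * hL k (fun h => binz (h - p%:Z - p%:Z + 2 * i%:Z) i)
   * hX k (p - i)) p_gt0) T // subn0 mulrDl mulr_suml; congr (_ + _).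
  rewrite hL1 ?mulr1 //; first exact: ipf_binz.
  by move=> h; rewrite binz0.
by apply: eq_bigr => t _; rewrite T //; have := ltn_ord t; lia.
Qed.

Lemma XpYp_conj : hX k p * hY k p * e = hY k p * hX k p * e + hL k (fun h => binz (h + 2 * s%:Z) p) * e.
Proof.
(* The weight of X^(s) e is a + 2s, congruent to b <= 1, so binom(H,t+1) contributes binom(b,t+1) =
   0 for t > 0. For t = 0 the factor X^(p-1) X^(s) vanishes because 0 < s < p. *)
have step1 : hX k p * hY k p * (hX k s * e) = hY k p * hX k p * (hX k s * e)
    + hX k s * hL k (fun h => binz (h + 2 * s%:Z) p) * e.
  rewrite XpYp big1 ?addr0; last first.
    move=> t _; have ltt : (t.+1 < p)%N by have := ltn_ord t; lia.
    rewrite -mulrA (mulrA (hL k _)) hL_X; last exact: ipf_binz.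
    rewrite -(mulrA (hX k s)).
    have -> : hL k (fun h => binz (h + 2 * s%:Z) t.+1) * e = hL k (fun=> 'C(b, t.+1)%:Z) * e.
      apply: hL_e_a => [||h]; [exact: ipf_binzD|exact: ipf_cst|].
      have -> : p%:Z * h + a%:Z + 2 * s%:Z = p%:Z * (h + 1) + b%:Z.
        have E : a%:Z + 2 * s%:Z = p%:Z + b%:Z by lia.
        by rewrite -addrA E; ring.
      have := bk_lucas hp (r := 1) (h + 1) 0 (a := b) (b := t.+1).
      by rewrite expn1 muln0 add0n bk0 mul1r; apply.
    rewrite hL_cst -scalerAl mul1r; case: (posnP t) => [t0|t_gt0]; last first.
      by rewrite bin_small ?scale0r ?mulr0 // (leq_ltn_trans le_b1).
    rewrite -!mulrA (mulrA (hX k _)) t0 (hXp0 hp) ?mul0r ?mulr0 //; lia.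
  by congr (_ + _); rewrite mulrA hL_X //; apply: ipf_binz.
have [cX cY cL] := central1_YX lt_sp.
have [dX dY dL] := central1_XY lt_sp.
have p1 : p = (p * 1)%N by rewrite muln1.
(* Writing e as Y^(s) X^(s) e v creates a factor X^(s) Y^(s), which commutes with Y^(p); this is
   what lets Y^(s) pass X^(p) Y^(p). *)
have step2 : hY k s * (hX k p * hY k p * (hX k s * e)) = hX k p * hY k p * (hY k s * hX k s * e).
  transitivity (hY k s * (hX k p * hY k p * (hX k s * (hY k s * hX k s * e * v)))).
    by rewrite inv_e.
  transitivity (hY k s * (hX k p * (hY k p * (hX k s * hY k s)) * (hX k s * e * v))).
    by rewrite !mulrA.
  rewrite p1 -dY -p1.
  transitivity ((hY k s * (hX k p * hX k s)) * ((hY k s * hY k p) * (hX k s * e * v))).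
    by rewrite !mulrA.
  rewrite (hXC k p) (hYC k s).
  transitivity ((hY k s * hX k s) * hX k p * hY k p * (hY k s * hX k s * e * v)).
    by rewrite !mulrA.
  by rewrite inv_e p1 cX -(mulrA (hX k _)) cY -p1 !mulrA.
have := congr1 (fun z => hY k s * z * v) step1; rewrite mulrDr step2 mulrDl.
rewrite -!(mulrA (hX k p * hY k p)) inv_e => ->; congr (_ + _).
  transitivity ((hY k s * hY k p) * (hX k p * hX k s) * e * v); first by rewrite !mulrA.
  rewrite (hYC k s) (hXC k p).
  transitivity (hY k p * (hY k s * hX k s * hX k p) * e * v); first by rewrite !mulrA.
  rewrite p1 cX -p1.
  transitivity (hY k p * hX k p * (hY k s * hX k s * e * v)); first by rewrite !mulrA.
  by rewrite inv_e.
rewrite !mulrA cL; last exact: ipf_binzD.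
transitivity (hL k (fun h => binz (h + 2 * s%:Z) p) * (hY k s * hX k s * e * v)).
  by rewrite !mulrA.
by rewrite inv_e.
Qed.

(** Comparing [XpYp] with [XpYp_conj], the middle terms amount to binom(H+2s,p) - binom(H,p) on e.
    As a + 2s = p + b, Lucas turns this into binom(h+1,1) - binom(h,1) = 1 at the weight ph + a. *)
Lemma Q_conj : \sum_(t < p.-1) 'C(a, t.+1)%:R *:
  (hY k (p - t.+1) * hX k (p - t.+1) * e) = e.
Proof.
have := XpYp_conj; rewrite XpYp -addrA => /addrI H.
have -> : \sum_(t < p.-1) 'C(a, t.+1)%:R *: (hY k (p - t.+1) * hX k (p - t.+1) * e) =
   \sum_(t < p.-1) hY k (p - t.+1) * hX k (p - t.+1) * hL k (binz^~ t.+1) * e.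
  apply: eq_bigr => t _; have ltt : (t.+1 < p)%N by have := ltn_ord t; lia.
  rewrite -[RHS]mulrA; have -> : hL k (binz^~ t.+1) * e = hL k (fun=> 'C(a, t.+1)%:Z) * e.
    apply: hL_e_a => [||h]; [exact: ipf_binz|exact: ipf_cst|].
    have := bk_lucas hp (r := 1) h 0 (a := a) (b := t.+1).
    by rewrite expn1 muln0 add0n bk0 mul1r; apply.
  by rewrite hL_cst -scalerAl mul1r -scalerAr.
have E1 : hL k (fun h => binz (h + 2 * s%:Z) p) * e = (hL k (binz^~ p) + hL k (fun=> 1)) * e.
  rewrite -hLD; [|exact: ipf_binz|exact: ipf_cst].
  apply: hL_e_a => [||h]; [exact: ipf_binzD|exact: ipfD (ipf_binz _) (ipf_cst _)|].
  have E : a%:Z + 2 * s%:Z = p%:Z + b%:Z by lia.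
  rewrite -addrA E (_ : p%:Z * h + (p%:Z + b%:Z) = p%:Z * (h + 1) + b%:Z); last by ring.
  have := bk_lucas hp (r := 1) (h + 1) 1 (a := b) (b := 0); rewrite expn1 muln1 addn0 bin0 mulr1.
  rewrite -[(binz (_ * (h + 1) + _) p)%:~R]/(bk _ _) => -> //.
  have := bk_lucas hp (r := 1) h 1 (a := a) (b := 0); rewrite expn1 muln1 addn0 bin0 mulr1.
  rewrite rmorphD /= -[(binz (_ * h + _) p)%:~R]/(bk _ _) => -> //.
  by rewrite /bk binz_pascal binz0 rmorphD.
rewrite E1 mulrDl hL_cst scale1r mul1r addrC in H.
by move/addrI: H.
Qed.
End Conjugation.

End RankOne.

Section BlockData.
Variables (k : fieldType) (p : nat).
Hypothesis hp : p \in [pchar k].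

Let p_pr : prime p. Proof. exact: pcharf_prime hp. Qed.
Let p_gt0 : (0 < p)%N. Proof. exact: prime_gt0 p_pr. Qed.
Let p_gt1 : (1 < p)%N. Proof. exact: prime_gt1 p_pr. Qed.

Local Notation bk := (@bk k).
Local Notation U := (hyper k).
Local Notation E := (E k).
Local Notation iota := (@Fp_in k p).

Lemma Fp_in_nat n : iota n%:R = n%:R.
Proof.
by rewrite /Fp_in val_Fp_nat // {2}(divn_eq n p) natrD natrM (pcharf0 hp) mulr0 add0r.
Qed.
Lemma Fp_in_val (x : 'F_p) : x = (x : nat)%:R.
Proof. by rewrite natr_Zp. Qed.

Lemma Fp_inD x y : iota (x + y) = iota x + iota y.
Proof. by rewrite (Fp_in_val x) (Fp_in_val y) -natrD !Fp_in_nat natrD. Qed.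
Lemma Fp_inM : {morph iota : x y / x * y}.
Proof. by move=> x y; rewrite (Fp_in_val x) (Fp_in_val y) -natrM !Fp_in_nat natrM. Qed.
Lemma Fp_in1 : iota 1 = 1. Proof. exact: (Fp_in_nat 1). Qed.
Lemma Fp_in0 : iota 0 = 0. Proof. exact: (Fp_in_nat 0). Qed.
Lemma Fp_inB : {morph iota : x y / x - y}.
Proof.
by move=> x y; apply/eqP; rewrite eq_sym subr_eq -Fp_inD subrK.
Qed.
Lemma Fp_in_eq0 x : (iota x == 0) = (x == 0).
Proof.
apply/eqP/eqP => [H|->]; last exact: Fp_in0.
apply/eqP; apply: contraT => x0; have := oner_eq0 k.
by rewrite -Fp_in1 -(divff x0) Fp_inM H mul0r eqxx.
Qed.

Lemma ipf_muB a (t : nat) : ipf (fun h => binz (h - 2 * t%:Z + (- a%:Z - 1)) p.-1).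
Proof. by apply: (@ipf_shift (fun h => binz (h + (- a%:Z - 1)) p.-1)); apply: ipf_binzD. Qed.

Lemma muE_hL a t : E t * mu k p a =
  (t`!%:R ^+ 2) *: (hY k t * hL k (fun h => binz (h - 2 * t%:Z + (- a%:Z - 1)) p.-1) * hX k t).
Proof.
rewrite E_YX -scalerAl; congr (_ *: _); rewrite -[LHS]mulrA mu_hL.
rewrite hX_L; last exact: ipf_mu.
by rewrite mulrA.
Qed.

Lemma E_mu a t : (t < p)%N -> E t * mu k p a = mu k p a * E t.
Proof.
move=> ltt; have [_ _ H] := central1_E hp ltt; rewrite mu_hL; apply: H.
exact: ipf_mu.
Qed.

Lemma E_indep a (c : 'I_p -> k) : (a < p)%N ->
  mu k p a * (\sum_(t < p) c t *: E t) = 0 -> forall t, c t = 0.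
Proof.
(* Up to t!^2, Y^t X^t times [mu] is Y^(t) F(H) X^(t) with F the indicator modulo p of the residue
   of a + 2t; the chosen coordinate sees F = 1. *)
move=> lta H t; have := congr1 (phi t t (a%:Z + 2 * t%:Z)) H.
rewrite phi0 mulr_sumr phi_sum (bigD1 t) //= big1 ?addr0; last first.
  move=> i ne; rewrite -scalerAr -E_mu // muE_hL !phiZ phi_term; last first.
    exact: (ipf_muB a i).
  by rewrite (_ : (t == i :> nat) = false) ?mul0r ?mulr0 //; apply/negbTE; rewrite eq_sym.
rewrite -scalerAr -E_mu // muE_hL !phiZ phi_term; last first.
  exact: (ipf_muB a t).
rewrite !eqxx mul1r.
have := @mu_val k p hp a a 0 lta lta; rewrite /bk mulr0 add0r eqxx.
have -> : a%:Z + 2 * t%:Z - 2 * t%:Z + (- a%:Z - 1) = a%:Z + (- a%:Z - 1) by ring.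
move=> ->; rewrite mulr1 => /eqP; rewrite mulf_eq0 => /orP[/eqP //|].
by rewrite expf_eq0 /= (negbTE (fact_neq0 hp (ltn_ord t))).
Qed.

Definition Bexp (eps : bool) (q : pair_index) (c : {ffun 'I_p -> 'F_p}) : Prop :=
  B1 k p eps q = mu k p q.1 * \sum_(m < p) iota (c m) *: E m.

Lemma BcoefE eps q c : (q.1 < p)%N -> Bexp eps q c -> Bcoef k p eps q = c.
Proof.
move=> ltq Hc.
have Hd : Bexp eps q (Bcoef k p eps q).
  exact: (@xgetPex _ [ffun=> 0] [set c | Bexp eps q c] (ex_intro _ c Hc)).
apply/ffunP => m; apply/eqP; rewrite -subr_eq0 -Fp_in_eq0 Fp_inB; apply/eqP.
apply: (@E_indep q.1 (fun m => iota (Bcoef k p eps q m) - iota (c m)) ltq).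
under eq_bigr => i _ do rewrite scalerBl.
by rewrite sumrB mulrBr -[X in X - _]Hd -[X in _ - X]Hc subrr.
Qed.

Lemma ZmapD eps q : linear (fun z => Zmap (k := k) p eps z q).
Proof.
have [lf _] := Fr'P k p; move=> c x y; rewrite /Zmap; case: ifP => _.
  rewrite scalerAr -mulrDr scaler_sumr -big_split /=; congr (_ * _).
  apply: eq_bigr => m _; rewrite lf mulrDr mulrDl -scalerAr -scalerAl scalerDr !scalerA.
  by rewrite mulrC.
by rewrite lf mulrDl scalerAl.
Qed.

(** In the summand of index i, the part left of Fr'(z) is Y^s times [E (i - s)], and the latter
    commutes with Y^(pm). Moving the right-hand X^s to the left of binom(H,pn) changes it into
    binom(H+2s,pn) and rebuilds [E i]: this is the origin of the translation by 2s in G. *)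
Lemma Zmap_AC eps q c m n : (q.1 < p)%N -> typeA p q || typeC p q -> (sAC p q < p)%N ->
  Bexp eps q c -> (forall i : 'I_p, (i < sAC p q)%N -> c i = 0) ->
  Zmap p eps (hY k m * binH k 0 n * hX k m) q =
  hY k (p * m) * hL k (fun h => binz (h + 2 * (sAC p q)%:Z) (p * n)) * hX k (p * m) * B1 k p eps q.
Proof.
move=> ltq tq; rewrite /Zmap tq; set s := sAC p q => lts Hc c0.
have [_ ->] := Fr'P k p; rewrite (BcoefE ltq Hc) Hc.
have -> : \sum_(i < p) iota (c i) *: E i = \sum_(i < p | (s <= i)%N) iota (c i) *: E i.
  rewrite (bigID (fun i : 'I_p => (s <= i)%N)) /= [X in _ + X]big1 ?addr0 // => i.
  by rewrite -ltnNge => /c0 ->; rewrite Fp_in0 scale0r.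
set Z := hY k (p * m) * hL k _ * hX k (p * m).
have ZE (x : U) : central1 p x -> Z * x = x * Z.
  move=> [x1 x2 x3]; rewrite /Z -!mulrA -x1 !mulrA -(mulrA _ _ x) -x3; last exact: ipf_binzD.
  by rewrite !mulrA x2.
rewrite [RHS]mulrA ZE; last exact: central1_mu.
rewrite -[RHS]mulrA; congr (_ * _); rewrite mulr_sumr; apply: eq_bigr => i lesi.
rewrite -scalerAr; congr (_ *: _).
have lti := ltn_ord i.
have [e1 e2 e3] : central1 p (E (i - s)) by apply: central1_E => //; lia.
have sX F : ipf F -> hL k F * hX k 1 ^+ s = hX k 1 ^+ s * hL k (fun h => F (h + 2 * s%:Z)).
  by move=> iF; rewrite hX1_exp -scalerAr hL_X // -scalerAl.
transitivity (hY k 1 ^+ s * (E (i - s) * hY k (p * m)) * (binH k 0 (p * n)) * (hX k (p * m) * hX k 1 ^+ s)).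
  rewrite /E -{1}(subnKC lesi) exprD !mulrA.
  by rewrite (mulnC n) (mulnC m).
have Ys : hY k 1 ^+ s * hY k (p * m) = hY k (p * m) * hY k 1 ^+ s.
  by rewrite hY1_exp -scalerAl hYC scalerAr.
have Xs : hX k (p * m) * hX k 1 ^+ s = hX k 1 ^+ s * hX k (p * m).
  by rewrite hX1_exp -scalerAr hXC scalerAl.
rewrite e2 Xs.
transitivity (hY k (p * m) * (hY k 1 ^+ s * E (i - s)) * (binH k 0 (p * n) * hX k 1 ^+ s) * hX k (p * m)).
  by rewrite !mulrA Ys.
rewrite binH0E sX; last exact: ipf_binz.
have -> : hY k (p * m) * (hY k 1 ^+ s * E (i - s)) *
    (hX k 1 ^+ s * hL k (fun h => binz (h + 2 * s%:Z) (p * n))) * hX k (p * m) =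
    hY k (p * m) * (E i * hL k (fun h => binz (h + 2 * s%:Z) (p * n))) * hX k (p * m).
  rewrite !mulrA; congr (_ * _ * _); rewrite -!mulrA; congr (_ * _).
  by rewrite /E !mulrA -exprD subnKC // -mulrA -exprD subnK.
have [f1 f2 f3] := central1_E hp lti.
rewrite f3; last exact: ipf_binzD.
by rewrite mulrA -mulrA f1 !mulrA.
Qed.

Lemma Zmap_BD eps q m n : typeA p q || typeC p q = false ->
  Zmap p eps (hY k m * binH k 0 n * hX k m) q =
  hY k (p * m) * hL k (fun h => binz (h + 2 * 0%:Z) (p * n)) * hX k (p * m) * B1 k p eps q.
Proof.
move=> tq; rewrite /Zmap tq; have [_ ->] := Fr'P k p; rewrite binH0E (mulnC n) (mulnC m).
by congr (_ * hL k _ * _ * _); apply/funext => h; rewrite mulr0 addr0.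
Qed.

(* [s] is s(a, j) and [delta] is true for the types (A), (C), while [s] is 0 and
   [delta] is false for (B), (D); [block_Q] gives the middle terms of the commutator
   of [X^(p)] and [Y^(p)] on B^(0)(a, j). *)
Record block (q : pair_index) (s : nat) (delta : bool) : Prop := Block {
  block_lt : (q.1 < p)%N;
  block_central : forall eps, central1 p (B1 k p eps q);
  block_mu : forall eps, mu k p q.1 * B1 k p eps q = B1 k p eps q;
  block_comm : forall eps eps', B1 k p eps q * B1 k p eps' q = B1 k p eps' q * B1 k p eps q;
  block_idem : forall eps, B1 k p false q * B1 k p eps q = B1 k p eps q;
  block_nil : ~~ degenerate p q -> B1 k p true q * B1 k p true q = 0;
  block_YX : forall t, (t < p)%N -> exists al be : k,
     hY k t * hX k t * B1 k p false q = al *: B1 k p false q + be *: B1 k p true q /\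
     (degenerate p q -> be = 0);
  block_Q : \sum_(t < p.-1) 'C(q.1, t.+1)%:R *:
     (hY k (p - t.+1) * hX k (p - t.+1) * B1 k p false q) = (delta : nat)%:R *: B1 k p false q;
  block_shift : forall (h : int) n,
     bk (p%:Z * h + q.1%:Z + 2 * s%:Z) (p * n) = bk (h + (delta : nat)%:Z) n;
  block_top : exists c : 'I_p -> k,
     B1 k p (~~ degenerate p q) q = mu k p q.1 * (\sum_(t < p) c t *: (hY k t * hX k t)) /\
     forall t : 'I_p, t.+1 = p -> c t != 0;
  block_Zmap : forall eps m n, Zmap p eps (hY k m * binH k 0 n * hX k m) q =
     hY k (p * m) * hL k (fun h => binz (h + 2 * s%:Z) (p * n)) * hX k (p * m) * B1 k p eps q
}.

Lemma shift_AC a s b (h : int) n : (b < p)%N -> (a + 2 * s = p + b)%N ->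
  bk (p%:Z * h + a%:Z + 2 * s%:Z) (p * n) = bk (h + 1) n.
Proof.
move=> ltb abs; have E : a%:Z + 2 * s%:Z = p%:Z + b%:Z by lia.
rewrite -addrA E (_ : p%:Z * h + (p%:Z + b%:Z) = p%:Z * (h + 1) + b%:Z); last by ring.
have := bk_lucas hp (r := 1) (h + 1) n (a := b) (b := 0).
by rewrite expn1 addn0 bin0 mulr1; apply.
Qed.

Lemma shift_BD a (h : int) n : (a < p)%N ->
  bk (p%:Z * h + a%:Z + 2 * 0%:Z) (p * n) = bk (h + 0) n.
Proof.
move=> lta; rewrite mulr0 !addr0.
have := bk_lucas hp (r := 1) h n (a := a) (b := 0).
by rewrite expn1 addn0 bin0 mulr1; apply.
Qed.

End BlockData.

(** * The polynomial psi and its factors over F_p, p odd *)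

Section PolyFacts.
Variable p : nat.
Hypotheses (p_pr : prime p) (p_odd : odd p).
Local Notation F := 'F_p.

Let p_gt0 : (0 < p)%N. Proof. exact: prime_gt0 p_pr. Qed.
Let p_gt2 : (2 < p)%N.
Proof. by have := prime_gt1 p_pr; move: p_odd; case: (p) => [|[|[|]]]. Qed.

Lemma Fp_nat_eq0 n : ((n%:R : F) == 0) = (p %| n)%N.
Proof. by rewrite -val_eqE /= val_Fp_nat // /dvdn. Qed.

Lemma two_neq0 : 2%:R != 0 :> F.
Proof. by rewrite Fp_nat_eq0 gtnNdvd. Qed.

Lemma card_Fp' : #|{: F}| = p.
Proof. by rewrite card_ord Fp_cast. Qed.

(** By Euler's criterion, its roots are the nonzero squares. *)
Definition hpol : {poly F} := 'X^((p.-1)./2) - 1.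

Let half_gt0 : (0 < (p.-1)./2)%N. Proof. lia. Qed.

(** Substituting X^2 for X is injective and turns both sides into (X^p - X)^2. *)
Lemma psi_hpol : psi p = 'X * hpol ^+ 2.
Proof.
have s2 : (1 < size ('X^2 : {poly F}))%N by rewrite size_polyXn.
apply/eqP; rewrite -subr_eq0 -(comp_poly_eq0 _ s2) rmorphB /= subr_eq0; apply/eqP.
rewrite /psi rmorph_prod /= comp_polyM comp_polyX rmorphXn /= rmorphB /= comp_Xn_poly rmorph1.
rewrite -exprM (_ : 2 * (p.-1)./2 = p.-1)%N; last by lia.
have E (i : F) : ('X - (i ^+ 2)%:P) \Po 'X^2 = ('X - i%:P) * ('X + i%:P).
  rewrite comp_polyB comp_polyX comp_polyC polyCM; ring.
under eq_bigr => i _ do rewrite E.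
rewrite big_split /= -finField_genPoly card_Fp'.
have -> : \prod_(i : F) ('X + i%:P) = 'X^p - 'X :> {poly F}.
  have -> : 'X^p = 'X^#|{: F}| :> {poly F} by rewrite card_Fp'.
  rewrite finField_genPoly (reindex_inj oppr_inj) /=.
  by apply: eq_bigr => i _; rewrite rmorphN.
have {1 2}-> : 'X^p = 'X * 'X^(p.-1) :> {poly F} by rewrite -exprS prednK.
ring.
Qed.

(** This differential equation determines the first two derivatives of [hpol] at its roots, which is
    what a computation modulo (X - s^2)^2 needs. *)
Lemma hpol_deriv : 2%:R *: ('X * hpol^`()) = - (hpol + 1).
Proof.
have -> : hpol^`() = 'X^((p.-1)./2.-1) *+ (p.-1)./2.
  by rewrite /hpol derivB derivXn -polyC1 derivC subr0.
rewrite /hpol subrK.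
rewrite mulrnAr -exprS prednK // -scaler_nat scalerA -natrM.
rewrite (_ : 2 * (p.-1)./2 = p.-1)%N; last by lia.
by rewrite -subn1 natrB // pchar_Fp_0 // sub0r scaleN1r.
Qed.

Lemma hpol_root (s : F) : s != 0 -> root hpol (s ^+ 2).
Proof.
move=> s0; rewrite rootE /hpol !hornerE -exprM (_ : 2 * (p.-1)./2 = p.-1)%N; last by lia.

have := expf_card s; rewrite card_Fp' => E.
have {}E : s * s ^+ p.-1 = s * 1 by rewrite -exprS prednK // mulr1.
have := E.
by move/(mulfI s0) => ->; rewrite subrr.
Qed.

(** The cofactor of (X - s^2)^2 in psi, and of X when s = 0. *)
Definition cofactor_psi (s : F) : {poly F} :=
  \prod_(i : F | (i != s) && (i != - s)) ('X - (i ^+ 2)%:P).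

Lemma psi_cofactor (s : F) : s != 0 ->
  psi p = ('X - (s ^+ 2)%:P) ^+ 2 * cofactor_psi s.
Proof.
move=> s0; have ns : - s != s.
  by rewrite -subr_eq0 -opprD oppr_eq0 -mulr2n -mulr_natr mulf_neq0 // two_neq0.
rewrite /psi (bigD1 s) //= (bigD1 (- s)) //= mulrA sqrrN -expr2; congr (_ * _).
Qed.

Lemma psi_cofactor0 : psi p = 'X * cofactor_psi 0.
Proof.
rewrite /psi (bigD1 0) //= expr0n /= subr0; congr (_ * _).
by apply: eq_bigl => i; rewrite oppr0 andbb.
Qed.

Lemma double_root (f : {poly F}) (a : F) : root f a -> root f^`() a ->
  exists g, f = ('X - a%:P) ^+ 2 * g.
Proof.
move=> /factor_theorem [g ->]; rewrite derivM derivXsubC mulr1 rootE !hornerE subrr mulr0 add0r.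
by move=> /eqP g0; have /factor_theorem [h ->] : root g a by [apply/rootP]; exists h; ring.
Qed.

Lemma taylor2 (f : {poly F}) (a : F) : exists (c : F) (g : {poly F}),
  f = f.[a]%:P + c%:P * ('X - a%:P) + ('X - a%:P) ^+ 2 * g.
Proof.
have ra (h : {poly F}) : root (h - h.[a]%:P) a by rewrite rootE !hornerE subrr.
have /factor_theorem [h hE] := ra f; have /factor_theorem [g gE] := ra h.
exists h.[a], g; move/eqP: hE; rewrite subr_eq => /eqP {1}->.
by move/eqP: gE; rewrite subr_eq => /eqP {1}->; ring.
Qed.

(** So 2(X + s^2) inverts the cofactor modulo (X - s^2)^2. With [hpol] = h1 (X - s^2) the cofactor
    is X h1^2; [hpol_deriv] and its derivative, evaluated at s^2, relate h1 and its derivative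
    there, and make the value and the derivative of the left-hand side vanish. *)
Lemma idem_cofactor (s : F) : s != 0 -> exists g : {poly F},
  2%:R *: ('X + (s ^+ 2)%:P) * cofactor_psi s - 1 = ('X - (s ^+ 2)%:P) ^+ 2 * g.
Proof.
move=> s0; set u := 'X - (s ^+ 2)%:P; have u0 : u != 0 by rewrite polyXsubC_eq0.
have [h1 hE] := factor_theorem _ _ (hpol_root s0); rewrite -/u in hE.
have RE : cofactor_psi s = 'X * h1 ^+ 2.
  apply: (mulfI (expf_neq0 2 u0)); rewrite -psi_cofactor // psi_hpol hE.
  by rewrite exprMn; ring.
have du : u^`() = 1 by rewrite derivXsubC.
have d1 : (1 : {poly F})^`() = 0 by rewrite -polyC1 derivC.
have D1 : 2%:R *: ('X * (h1^`() * u + h1)) = - (h1 * u + 1).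
  by have := hpol_deriv; rewrite hE derivM du mulr1.
have D2 := congr1 (@deriv F) D1.
rewrite !(derivZ, derivD, derivM, derivN, derivX, derivC, du, d1, mulr1, mul1r, addr0) in D2.
have V1 := congr1 (horner^~ (s ^+ 2)) D1; have V2 := congr1 (horner^~ (s ^+ 2)) D2.
rewrite /= !(hornerZ, hornerD, hornerM, hornerN, hornerX, hornerC, horner0, subrr, subr0,
  mulr0, add0r, mulr1) in V1 V2.
rewrite RE; apply: double_root; rewrite rootE;
  rewrite ?(derivZ, derivD, derivM, derivN, derivX, derivC, d1, derivXn) ?expr2;
  rewrite !(hornerZ, hornerD, hornerM, hornerN, hornerX, hornerC, horner0);
  move: V1 V2; move: (h1.[_]) (h1^`().[_]) => A B V1 V2; apply/eqP.
  transitivity ((2%:R * (s ^+ 2 * A)) ^+ 2 - 1); first by ring.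
  by rewrite V1; ring.
transitivity (2%:R * s ^+ 2 * A * (2%:R * (A + s ^+ 2 * (B + B)) + A)); first by ring.
by rewrite V2 addNr mulr0.
Qed.

Lemma idem_cofactor0 : exists g : {poly F}, cofactor_psi 0 - 1 = 'X * g.
Proof.
have E : cofactor_psi 0 = hpol ^+ 2.
  by apply: (mulfI (negbT (polyX_eq0 _))); rewrite -psi_cofactor0 psi_hpol.
have /factor_theorem [g gE] : root (cofactor_psi 0 - 1) 0.
  rewrite E rootE hornerD horner_exp hornerN hornerC /hpol hornerD hornerN hornerXn hornerC expr0n (gtn_eqF half_gt0) /= sub0r.
  by rewrite sqrrN expr1n subrr.
by exists g; rewrite gE subr0 mulrC.
Qed.

(** For al = (a+1)/2 this is the polynomial that represents Y^m X^m on the weights congruent to a;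
    see [ev_Npol]. *)
Definition Npol (al : F) (m : nat) : {poly F} :=
  \prod_(l < m) ('X - ((al + l%:R) ^+ 2)%:P).

Lemma Npol_recr al m : Npol al m.+1 = Npol al m * ('X - ((al + m%:R) ^+ 2)%:P).
Proof. by rewrite /Npol big_ord_recr. Qed.

Lemma Npol_monic al m : Npol al m \is monic.
Proof. exact: monic_prod_XsubC. Qed.

Lemma size_Npol al m : size (Npol al m) = m.+1.
Proof. by rewrite /Npol size_prod_XsubC /index_enum -enumT size_enum_ord. Qed.

Lemma Npol_add al s t : Npol al (s + t) = Npol al s * Npol (al + s%:R) t.
Proof.
elim: t => [|t IH]; first by rewrite addn0 /Npol [X in _ * X]big_ord0 mulr1.
by rewrite addnS !Npol_recr IH -mulrA natrD addrA.
Qed.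

Lemma Npol_psi al : Npol al p = psi p.
Proof.
rewrite /psi (reindex_inj (addrI al)) /=.
rewrite /Npol -(big_mkord predT (fun l => 'X - ((al + l%:R) ^+ 2)%:P)).
rewrite (_ : index_iota 0 p = index_iota 0 (Zp_trunc (pdiv p)).+2); last by rewrite Fp_cast.
rewrite big_mkord; apply: eq_bigr => i _.
by rewrite natr_Zp.
Qed.

(** The [Npol al t] are monic of degree t, so the expansion is found from the top degree down and
    its top coefficient is that of f. *)
Lemma Npol_expand al d (f : {poly F}) : (size f <= d)%N ->
  exists c : nat -> F, f = \sum_(t < d) (c t)%:P * Npol al t /\ ((0 < d)%N -> c d.-1 = f`_d.-1).
Proof.
elim: d f => [|d IH] f sf.
  by exists (fun=> 0); rewrite big_ord0; split=> //; apply/eqP; rewrite -size_poly_leq0.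
have [|c [cE _]] := IH (f - (f`_d)%:P * Npol al d).
  apply/leq_sizeP => j; rewrite leq_eqVlt => /orP[/eqP <-|ltj].
    have /monicP := Npol_monic al d; rewrite /lead_coef size_Npol /= => N1.
    by rewrite coefB coefCM N1 mulr1 subrr.
  rewrite coefB coefCM [f`_j]nth_default ?(leq_trans sf ltj) //.
  by rewrite [(Npol al d)`_j]nth_default ?size_Npol // mulr0 subr0.
exists (fun t => if t == d then f`_d else c t); rewrite /= eqxx; split=> //.
rewrite big_ord_recr /= eqxx.
move/eqP: cE; rewrite subr_eq => /eqP {1}->; congr (_ + _); apply: eq_bigr => t _.
by rewrite ltn_eqF.
Qed.

Lemma Fp_nat_inj m n : (m < p)%N -> (n < p)%N -> (m%:R : F) = n%:R -> m = n.
Proof.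
move=> ltm ltn /(congr1 (fun x : F => x : nat)); rewrite !val_Fp_nat //.
by rewrite !modn_small.
Qed.

(** The indices al + l, l < s, are distinct because s <= p, and none of them belongs to the factors
    left out of psi. *)
Lemma Npol_dvd_cofactor al s a : (s <= p)%N ->
  (forall l, (l < s)%N -> al + l%:R != a /\ al + l%:R != - a) ->
  exists g, cofactor_psi a = Npol al s * g.
Proof.
move=> les H.
pose L := [seq al + l%:R | l <- iota 0 s].
have uL : uniq L.
  rewrite map_inj_in_uniq ?iota_uniq // => i j; rewrite !mem_iota !add0n => /andP[_ lti] /andP[_ ltj].
  move/addrI; apply: Fp_nat_inj; exact: leq_trans les.
have NE : Npol al s = \prod_(i in L) ('X - (i ^+ 2)%:P).
  rewrite -big_uniq //= big_map /Npol -(big_mkord predT (fun l => 'X - ((al + l%:R) ^+ 2)%:P)).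
  by rewrite /index_iota subn0.
rewrite /cofactor_psi (bigID (mem L)) /=.
exists (\prod_(i | (i != a) && (i != - a) && (i \notin L)) ('X - (i ^+ 2)%:P)).
rewrite NE; congr (_ * _); apply: eq_bigl => i.
case iL : (i \in L); last by rewrite andbF.
have /mapP[l] := iL; rewrite mem_iota add0n => /andP[_ ltl] ->.
by have [-> ->] := H l ltl.
Qed.

Lemma Npol_dvd2 al m a l l' : (l < m)%N -> (l' < m)%N -> a != 0 ->
  al + l%:R = a -> al + l'%:R = - a -> exists g, Npol al m = ('X - (a ^+ 2)%:P) ^+ 2 * g.
Proof.
move=> ltl ltl' a0 E E'.
have ne : Ordinal ltl' != Ordinal ltl.
  apply/eqP => [[H]]; have : a = - a by rewrite -E' H E.
  move/eqP; rewrite -subr_eq0 opprK -mulr2n -mulr_natr mulf_eq0 (negbTE a0) /=.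
  by rewrite (negbTE two_neq0).
rewrite /Npol (bigD1 (Ordinal ltl)) //= (bigD1 (Ordinal ltl')) //= E E' sqrrN mulrA -expr2.
by eexists.
Qed.

Lemma Npol_dvd1 al m l : (l < m)%N -> al + l%:R = 0 -> exists g, Npol al m = 'X * g.
Proof.
move=> ltl E; rewrite /Npol (bigD1 (Ordinal ltl)) //= E expr0n /= subr0.
by eexists.
Qed.

Lemma Npol_neq0 al m (a : F) :
  (forall l, (l < m)%N -> al + l%:R != a /\ al + l%:R != - a) -> (Npol al m).[a ^+ 2] != 0.
Proof.
move=> H; rewrite /Npol horner_prod; apply/prodf_neq0 => l _.
rewrite !hornerE subr_sqr mulf_neq0 //.
  by have [h _] := H l (ltn_ord l); rewrite subr_eq0 eq_sym.
by have [_ h] := H l (ltn_ord l); rewrite addrC addr_eq0.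
Qed.

Lemma cofactor_monic a : cofactor_psi a \is monic.
Proof. exact: monic_prod_XsubC. Qed.

Lemma size_psi : size (psi p) = p.+1.
Proof. by rewrite -(Npol_psi 0) size_Npol. Qed.

Lemma size_cofactor a : a != 0 -> size (cofactor_psi a) = p.-1.
Proof.
move=> a0; have := size_psi; rewrite (psi_cofactor a0).
have u0 : ('X - (a ^+ 2)%:P) ^+ 2 != 0 by rewrite expf_neq0 // polyXsubC_eq0.
rewrite size_mul // ?monic_neq0 ?cofactor_monic // size_exp_XsubC /= => H; apply: succn_inj; rewrite prednK //; by case: H; rewrite add1n.
Qed.

Lemma size_cofactor0 : size (cofactor_psi 0) = p.
Proof.
have := size_psi; rewrite psi_cofactor0 size_mul ?polyX_eq0 ?monic_neq0 ?cofactor_monic //.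
by rewrite size_polyX => -[].
Qed.

End PolyFacts.

Lemma horner_alg_comm (k : comNzRingType) (A : algType k) (x y : A) f :
  x * y = y * x -> horner_alg x f * y = y * horner_alg x f.
Proof.
move=> xy; elim/poly_ind: f => [|f c IH]; first by rewrite rmorph0 mul0r mulr0.
rewrite rmorphD rmorphM /= horner_algX horner_algC mulrDl mulrDr -mulrA xy mulrA IH.
by rewrite -mulrA -scalerAl -scalerAr mul1r mulr1.
Qed.

(** * The blocks for odd p *)

Section OddBlock.
Variables (k : fieldType) (p : nat).
Hypothesis hp : p \in [pchar k].
Hypothesis p_odd : odd p.

Let p_pr : prime p. Proof. exact: pcharf_prime hp. Qed.
Let p_gt0 : (0 < p)%N. Proof. exact: prime_gt0 p_pr. Qed.
Let p_gt1 : (1 < p)%N. Proof. exact: prime_gt1 p_pr. Qed.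
Let p_neq2 : (p == 2%N) = false.
Proof. by apply/negbTE/eqP => E; move: p_odd; rewrite E. Qed.
Let two0 : 2%:R != 0 :> 'F_p. Proof. exact: two_neq0. Qed.

Local Notation F := 'F_p.
Local Notation fi := (@Fp_in k p).

HB.instance Definition _ := GRing.isZmodMorphism.Build F k fi (Fp_inB hp).
HB.instance Definition _ := GRing.isMonoidMorphism.Build F k fi (Fp_in1 hp, Fp_inM hp).

Variables (a n : nat).
Hypotheses (lt_ap : (a < p)%N) (le_n : (n <= (p.-1)./2)%N).

Let al : F := a.+1%:R / 2%:R.
Let w : hyper k := hY k 1 * hX k 1.
Let m_a := mu k p a.
Let chi : hyper k := m_a * hY k 1 * hX k 1 + (fi (al ^+ 2))%:A.
(** Evaluation at [chi] cut down to the weights congruent to a. It is multiplicative because [m_a]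
    is an idempotent commuting with [chi]. *)
Let ev (f : {poly F}) : hyper k := horner_alg chi (map_poly fi f) * m_a.
Local Notation E := (E k).

Let mu_w : m_a * w = w * m_a.
Proof.
have [_ _ H] := central1_YX hp p_gt1.
by rewrite /m_a mu_hL /w H //; apply: ipf_mu.
Qed.

Let mu_mu : m_a * m_a = m_a. Proof. exact: mu_idem. Qed.

Let mu_chi : chi * m_a = m_a * chi.
Proof.
rewrite /chi mulrDl mulrDr -!(mulrA m_a) -/w -mu_w; congr (_ + _).
by rewrite -scalerAl -scalerAr mul1r mulr1.
Qed.

Let evM f g : ev (f * g) = ev f * ev g.
Proof.
rewrite /ev rmorphM rmorphM /= -!mulrA; congr (_ * _).
by rewrite (horner_alg_comm _ mu_chi) mulrA mu_mu.
Qed.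
Let evD f g : ev (f + g) = ev f + ev g.
Proof. by rewrite /ev rmorphD rmorphD /= mulrDl. Qed.
Let evB f g : ev (f - g) = ev f - ev g.
Proof. by rewrite /ev rmorphB rmorphB /= mulrBl. Qed.
Let evC c : ev c%:P = fi c *: m_a.
Proof. by rewrite /ev map_polyC /= horner_algC -scalerAl mul1r. Qed.
Let ev_mu f : m_a * ev f = ev f.
Proof. by rewrite /ev mulrA -(horner_alg_comm _ mu_chi) -mulrA mu_mu. Qed.
Let evX : ev 'X = chi * m_a.
Proof. by rewrite /ev map_polyX horner_algX. Qed.
Let evCM c f : ev (c%:P * f) = fi c *: ev f.
Proof. by rewrite evM evC -scalerAl ev_mu. Qed.
Let ev_comm f g : ev f * ev g = ev g * ev f.
Proof. by rewrite -!evM mulrC. Qed.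
Let ev_sum (I : Type) (r : seq I) (P : pred I) (f : I -> {poly F}) :
  ev (\sum_(i <- r | P i) f i) = \sum_(i <- r | P i) ev (f i).
Proof.
apply: (big_morph ev evD); rewrite -(mulr0 'X) mulrC -(polyC0 F) evCM.
by rewrite Fp_in0 // scale0r.
Qed.

Let al2 : al *+ 2 = a.+1%:R.
Proof. by rewrite -[RHS](divfK two0) mulr_natr. Qed.

(** By [ES] the new factor on the weight a is YX - m(a+m+1). Completing the square with 2 al = a +
    1, it equals [chi] - (al + m)^2. *)
Lemma ev_Npol m : ev (Npol al m) = E m * m_a.
Proof.
elim: m => [|m IH].
  by rewrite /Npol big_ord0 -polyC1 evC Fp_in1 // scale1r E0 mul1r.
rewrite Npol_recr evM IH (ES hp) -[LHS]mulrA -[RHS]mulrA; congr (_ * _).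
have hm : hL k (fun h => h + m.+1%:Z) * m_a = (a.+1 + m)%:R *: m_a.
  rewrite (@hL_mu k p hp a _ (fun=> (a.+1 + m)%:Z)) //; first by rewrite hL_cst -scalerAl mul1r.
  - exact: ipf_add.
  - exact: ipf_cst.
  - move=> h; rewrite !rmorphD rmorphM /= (_ : p%:Z%:~R = 0 :> k); last exact: pcharf0.
    by rewrite mul0r add0r -!natrD; congr _%:R; lia.
have chi_mu : chi * m_a = w * m_a + fi (al ^+ 2) *: m_a.
  by rewrite /chi mulrDl -(mulrA m_a) -/w mu_w -mulrA mu_mu -scalerAl mul1r.
rewrite ev_mu evB evX evC chi_mu mulrBl -scalerAl hm -/w -addrA -scalerBl; congr (_ + _).
rewrite scalerA -scaleNr; congr (_ *: _).
rewrite -(Fp_inB hp) -natrM -(Fp_in_nat hp) -[RHS]sub0r -(Fp_in0 hp) -(Fp_inB hp); congr fi.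
rewrite natrM natrD -al2; ring.
Qed.

Let sj : F := n%:R.
Let j : rat := n%:R.
Let u : {poly F} := 'X - (sj ^+ 2)%:P.
Local Notation R := (cofactor_psi (p := p) sj).

Let lt_np : (n < p)%N. Proof. lia. Qed.

Lemma sj_eq0 : (sj == 0) = (n == 0%N).
Proof.
rewrite /sj (Fp_nat_eq0 p_pr); case: n lt_np => [|m] ltm; first by rewrite dvdn0.
by rewrite gtnNdvd.
Qed.

Let j_eq0 : (j == 0) = (n == 0%N).
Proof. by rewrite /j pnatr_eq0. Qed.

Lemma psi_eps0 eps : n = 0%N -> psi_eps p eps j = R.
Proof.
move=> n0; have s0 : sj = 0 by rewrite /sj n0.
have j0 : j = 0 by rewrite /j n0.
rewrite /psi_eps j0 eqxx s0; case: eps.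
  have -> : ratr 0 = 0 :> F by rewrite (ratr_nat _ 0).
  rewrite expr0n /= subr0 psi_cofactor0 // mulrC mulpK ?polyX_eq0 //.
by rewrite /cofactor_psi; apply: eq_bigl => i; rewrite oppr0 andbb.
Qed.

Lemma psi_eps_false : n != 0%N ->
  psi_eps p false j = 2%:R *: ('X + (sj ^+ 2)%:P) * R.
Proof.
move=> n0; rewrite /psi_eps j_eq0 (negbTE n0) /j ratr_nat -/sj /cofactor_psi.
rewrite [in RHS](bigD1 0) /=; last by rewrite !(eq_sym 0) oppr_eq0 sj_eq0 n0.
rewrite expr0n /= subr0 -!mulrA -!scalerAl; congr (_ *: _).
rewrite mulrCA; congr (_ * (_ * _)); apply: eq_bigl => i.
by rewrite andbC.
Qed.

Lemma psi_eps_true : n != 0%N -> psi_eps p true j = u * R.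
Proof.
move=> n0; rewrite /psi_eps /j ratr_nat -/sj.
have s0 : sj != 0 by rewrite sj_eq0.
by rewrite (psi_cofactor p_pr p_odd s0) expr2 -/u -mulrA mulrC mulpK // polyXsubC_eq0.
Qed.

Let q : pair_index := (a, j).

Lemma B1_ev eps : B1 k p eps q = ev (psi_eps p eps j).
Proof. by rewrite /B1 /q p_neq2. Qed.

(** For m = p the al + l run through F_p, so psi represents Y^p X^p, which is 0. *)
Lemma ev_psi g : ev (psi p * g) = 0.
Proof. by rewrite evM -(Npol_psi p_pr al) ev_Npol Ep // !mul0r. Qed.

Let psi_u : n != 0%N -> psi p = u ^+ 2 * R.
Proof. by move=> n0; apply: psi_cofactor => //; rewrite sj_eq0. Qed.
Let psi_X : n = 0%N -> psi p = 'X * R.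
Proof. by move=> n0; rewrite /sj n0; apply: psi_cofactor0. Qed.

(** The polynomial of B^(0) is 1 modulo (X - j^2)^2, or modulo X if j = 0, and that of B^(eps) is a
    multiple of the cofactor, so the difference of the two sides is a multiple of psi. *)
Lemma odd_idem eps : B1 k p false q * B1 k p eps q = B1 k p eps q.
Proof.
rewrite !B1_ev -evM; apply/eqP; rewrite -subr_eq0 -evB; apply/eqP.
have -> : psi_eps p false j * psi_eps p eps j - psi_eps p eps j =
    (psi_eps p false j - 1) * psi_eps p eps j by rewrite mulrBl mul1r.
have [n0|n0] := eqVneq n 0%N.
  rewrite !psi_eps0 // {1}/sj n0; have [g ->] := idem_cofactor0 p_pr p_odd.
  by rewrite mulrAC -psi_X // ev_psi.
rewrite psi_eps_false //; have s0 : sj != 0 by rewrite sj_eq0.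
have [g ->] := idem_cofactor p_pr p_odd s0.
have [g' ->] : exists g', psi_eps p eps j = R * g'.
  by case: eps; [rewrite psi_eps_true //|rewrite psi_eps_false //]; rewrite mulrC; eexists.
have -> : ('X - (sj ^+ 2)%:P) ^+ 2 * g * (R * g') = (u ^+ 2 * R) * (g * g') by rewrite /u; ring.
by rewrite -psi_u // ev_psi.
Qed.

Lemma odd_nil : n != 0%N -> B1 k p true q * B1 k p true q = 0.
Proof.
move=> n0; rewrite !B1_ev -evM psi_eps_true //.
have -> : u * R * (u * R) = u ^+ 2 * R * R by ring.
by rewrite -psi_u // ev_psi.
Qed.

Lemma odd_kill f : (n != 0%N -> exists g, f = u ^+ 2 * g) -> (n = 0%N -> exists g, f = 'X * g) ->
  ev f * B1 k p false q = 0.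
Proof.
move=> H1 H0; rewrite B1_ev -evM; have [n0|n0] := eqVneq n 0%N.
  by have [g ->] := H0 n0; rewrite psi_eps0 // mulrAC -psi_X // ev_psi.
have [g ->] := H1 n0; rewrite psi_eps_false //.
have -> : u ^+ 2 * g * (2%:R *: ('X + (sj ^+ 2)%:P) * R) =
   u ^+ 2 * R * (g * (2%:R *: ('X + (sj ^+ 2)%:P))) by ring.
by rewrite -psi_u // ev_psi.
Qed.

(** A Taylor expansion at j^2 to first order suffices, as (X - j^2)^2 kills B^(0); for j = 0 the
    linear term is already killed. *)
Lemma odd_act f : exists c : k, ev f * B1 k p false q =
  fi f.[sj ^+ 2] *: B1 k p false q + c *: B1 k p true q /\ (n = 0%N -> c = 0).
Proof.
have [c [g fE]] := taylor2 f (sj ^+ 2); rewrite -/u in fE.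
have [n0|n0] := eqVneq n 0%N.
  exists 0; split=> //; rewrite scale0r addr0 {1}fE !evD evC.
  have uX : u = 'X by rewrite /u /sj n0 expr0n /= subr0.
  have K h : ev (u * h) * B1 k p false q = 0.
    by apply: odd_kill => [|_]; [rewrite n0|exists h; rewrite uX].
  have -> : c%:P * u = u * c%:P by exact: mulrC.
  have -> : u ^+ 2 * g = u * (u * g) by ring.
  rewrite 2!mulrDl. rewrite K K !addr0 -scalerAl.
  by rewrite B1_ev ev_mu.
(* The factor 4 j^2 comes from u 2(X + j^2) R = 2 psi + 4 j^2 u R, that is, (x - j^2) e = 4 j^2
   n. *)
exists (fi c * fi (4%:R * sj ^+ 2)); split; last by move/eqP; rewrite (negbTE n0).
rewrite {1}fE !evD evC [LHS]mulrDl [X in X + _ = _]mulrDl (odd_kill (f := u ^+ 2 * g)); first last.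
- by move/eqP; rewrite (negbTE n0).
- by move=> _; exists g.
rewrite addr0 -scalerAl B1_ev ev_mu; congr (_ + _).
rewrite evCM -scalerAl -evM -scalerA; congr (_ *: _).
rewrite B1_ev psi_eps_true // psi_eps_false //.
have -> : u * (2%:R *: ('X + (sj ^+ 2)%:P) * R) =
   psi p * 2%:R + (4%:R * sj ^+ 2)%:P * (u * R).
  by rewrite psi_u // -mul_polyC polyCM /u -!(polyC_natr F); ring.
by rewrite evD ev_psi add0r evCM.
Qed.

Let YX_ev t : (t < p)%N ->
  hY k t * hX k t * B1 k p false q = (t`!%:R ^- 2) *: (ev (Npol al t) * B1 k p false q).
Proof.
move=> ltt; rewrite (YX_E hp ltt) -scalerAl ev_Npol -mulrA; congr (_ *: (_ * _)).
by rewrite B1_ev ev_mu.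
Qed.

Lemma odd_YX t : (t < p)%N -> exists al' be : k,
  [/\ hY k t * hX k t * B1 k p false q = al' *: B1 k p false q + be *: B1 k p true q,
   n = 0%N -> be = 0 & (Npol al t).[sj ^+ 2] != 0 -> al' != 0].
Proof.
move=> ltt; have [c [E c0]] := odd_act (Npol al t).
exists (t`!%:R ^- 2 * fi (Npol al t).[sj ^+ 2]), (t`!%:R ^- 2 * c); split.
- by rewrite YX_ev // E scalerDr !scalerA.
- by move/c0 ->; rewrite mulr0.
- by move=> ne0; rewrite mulf_neq0 ?(Fp_in_eq0 hp) // invr_neq0 // expf_neq0 // (fact_neq0 hp).
Qed.

Lemma odd_mu eps : mu k p q.1 * B1 k p eps q = B1 k p eps q.
Proof. by rewrite B1_ev ev_mu. Qed.

Lemma odd_comm eps eps' : B1 k p eps q * B1 k p eps' q = B1 k p eps' q * B1 k p eps q.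
Proof. by rewrite !B1_ev ev_comm. Qed.

Lemma odd_central eps : central1 p (B1 k p eps q).
Proof.
rewrite B1_ev /ev; apply: central1M; last exact: central1_mu.
apply: central1_horner; apply: central1D; last by apply: central1Z; apply: central1_1.
by rewrite -mulrA; apply: central1M; [exact: central1_mu|exact: central1_YX].
Qed.

Lemma size_psi_eps eps : (size (psi_eps p eps j) <= p)%N.
Proof.
have [n0|n0] := eqVneq n 0%N.
  by rewrite psi_eps0 // /sj n0 size_cofactor0.
have sR : size R = p.-1 by rewrite size_cofactor // sj_eq0.
case: eps.
  by rewrite psi_eps_true // (leq_trans (size_polyMleq _ _)) // size_XsubC sR; lia.
rewrite psi_eps_false // (leq_trans (size_polyMleq _ _)) // sR.
have -> : size (2%:R *: ('X + (sj ^+ 2)%:P)) = 2%N.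
  by rewrite size_scale ?size_XaddC // (Fp_nat_eq0 p_pr) gtnNdvd //; lia.
lia.
Qed.

Lemma lead_psi_eps : (psi_eps p (n != 0%N) j)`_p.-1 = 1.
Proof.
have [n0|n0] := eqVneq n 0%N.
  rewrite psi_eps0 //; have /monicP := cofactor_monic sj.
  by rewrite /lead_coef /sj n0 size_cofactor0.
have sR : size R = p.-1 by rewrite size_cofactor // sj_eq0.
rewrite psi_eps_true //; have /monicP : u * R \is monic.
  by rewrite monicMl ?monicXsubC // cofactor_monic.
rewrite /lead_coef size_monicM ?monicXsubC ?monic_neq0 ?cofactor_monic //.
by rewrite size_XsubC sR.
Qed.

Lemma ev_expand (f : {poly F}) (c : nat -> F) :
  f = \sum_(t < p) (c t)%:P * Npol al t -> ev f = m_a * \sum_(t < p) fi (c t) *: E t.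
Proof.
move=> ->; rewrite ev_sum mulr_sumr; apply: eq_bigr => t _.
by rewrite evCM ev_Npol -scalerAr E_mu.
Qed.

Lemma odd_top : exists c : 'I_p -> k,
  B1 k p (n != 0%N) q = mu k p q.1 * (\sum_(t < p) c t *: (hY k t * hX k t)) /\
  forall t : 'I_p, t.+1 = p -> c t != 0.
Proof.
have [c [cE ctop]] := Npol_expand al (size_psi_eps (n != 0%N)).
exists (fun t => fi (c t) * t`!%:R ^+ 2); split.
  rewrite B1_ev (ev_expand cE); congr (_ * _); apply: eq_bigr => t _.
  by rewrite E_YX scalerA.
move=> t tp; have -> : t = p.-1 :> nat by move: (nat_of_ord t) tp => m <-.
rewrite ctop // lead_psi_eps Fp_in1 // mul1r expf_neq0 // (fact_neq0 hp) //.
by rewrite prednK.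
Qed.

(** Here [Npol al s] divides the polynomial of B^(eps). Expanding the quotient in the
    [Npol (al + s) t] expresses B^(eps) through the [Npol al (s + t)] alone, so the coefficients
    below s vanish. *)
Lemma odd_Bexp eps s : (s < p)%N ->
  (forall l, (l < s)%N -> al + l%:R != sj /\ al + l%:R != - sj) ->
  exists c : {ffun 'I_p -> 'F_p}, Bexp k eps q c /\ forall i : 'I_p, (i < s)%N -> c i = 0.
Proof.
move=> lts H; have [g RE] := Npol_dvd_cofactor p_pr (ltnW lts) H.
have [f fE] : exists f, psi_eps p eps j = Npol al s * f.
  have [n0|n0] := eqVneq n 0%N; first by exists g; rewrite psi_eps0.
  by case: eps; [rewrite psi_eps_true //|rewrite psi_eps_false //]; rewrite RE mulrCA; eexists.
have sf : (size f <= p - s)%N.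
  have := size_psi_eps eps; rewrite fE.
  have [->|f0] := eqVneq f 0; first by rewrite size_poly0.
  by rewrite size_monicM ?Npol_monic // size_Npol /=; lia.
have [c [cE _]] := Npol_expand (al + s%:R) sf.
pose d (i : nat) := if (s <= i)%N then c (i - s)%N else 0.
have dE : psi_eps p eps j = \sum_(t < p) (d t)%:P * Npol al t.
  rewrite fE cE mulr_sumr; have -> : \sum_(t < p) (d t)%:P * Npol al t =
     \sum_(t < s + (p - s)) (d t)%:P * Npol al t by rewrite subnKC // ltnW.
  rewrite big_split_ord /= [X in _ = X + _]big1 ?add0r => [|t _]; last first.
    by rewrite /d leqNgt ltn_ord /= mul0r.
  apply: eq_bigr => t _; rewrite /d leq_addr addKn Npol_add mulrCA.
  by [].
exists [ffun i : 'I_p => d i]; split.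
  rewrite /Bexp B1_ev (ev_expand dE); congr (_ * _); apply: eq_bigr => t _.
  by rewrite ffunE.
by move=> i lti; rewrite ffunE /d leqNgt lti.
Qed.

Lemma typeA_nat : typeA p q = ~~ odd a && (p.+1 <= 2 * n + a)%N.
Proof.
rewrite /typeA /q p_neq2 /= ler_pdivrMr // ler_pdivlMr //.
have -> : j * 2 <= p%:R - 1 :> rat.
  by rewrite lerBrDr /j -natrM natr1 ler_nat; lia.
rewrite andbT; congr (_ && _); rewrite -(ler_nat rat) /j natrD natrM -[p.+1%:R]natr1.
by apply/idP/idP => ?; lra.
Qed.

Lemma typeC_nat : typeC p q = odd a && (2 * n < a)%N.
Proof.
rewrite /typeC /q p_neq2 /= ler0n /= ler_pdivlMr //; congr (_ && _).
rewrite -(ler_nat rat) /j -[(2 * n).+1%:R]natr1 natrM.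
by apply/idP/idP => ?; lra.
Qed.

Lemma sAC_nat : sAC p q = if odd a then ((p - a)./2)%N else ((p - a).+1./2)%N.
Proof. by rewrite /sAC p_neq2. Qed.

Let al_l (l : nat) : (al + l%:R) * 2%:R = (a.+1 + 2 * l)%:R.
Proof. by rewrite mulrDl mulr_natr al2 natrD natrM (mulrC 2%:R). Qed.

Lemma al_eq_sj (l : nat) : (al + l%:R == sj) = (p %| a.+1 + 2 * l + (p - 2 * n))%N.
Proof.
rewrite -(inj_eq (mulIf two0)) al_l /sj -natrM -subr_eq0 -(Fp_nat_eq0 p_pr) (natrD _ (a.+1 + 2 * l)%N).
by rewrite natrB ?(pchar_Fp_0 p_pr) ?sub0r ?(mulnC 2%N) //; lia.
Qed.

Lemma al_eq_nsj (l : nat) : (al + l%:R == - sj) = (p %| a.+1 + 2 * l + 2 * n)%N.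
Proof.
rewrite -(inj_eq (mulIf two0)) al_l mulNr -subr_eq0 opprK /sj -natrM -natrD.
by rewrite (Fp_nat_eq0 p_pr) (mulnC n).
Qed.

(** After doubling, a root j or -j means that p divides a + 1 + 2l - 2n or a + 1 + 2l + 2n. The
    bounds defining the types, together with parity, rule out every multiple. *)
Lemma odd_AC_roots l : typeA p q || typeC p q -> (l < sAC p q)%N ->
  al + l%:R != sj /\ al + l%:R != - sj.
Proof.
rewrite typeA_nat typeC_nat sAC_nat al_eq_sj al_eq_nsj => tq ltl.
split; apply/negP => /dvdnP [[|[|[|c]]]]; rewrite ?mul0n ?mul1n ?mulSn; case: ifP tq ltl => oa /=; lia.
Qed.

Lemma odd_BD_roots : typeA p q || typeC p q = false ->
  exists l l' : nat, [/\ (l < p - a)%N, (l' < p - a)%N, al + l%:R = sj & al + l'%:R = - sj].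
Proof.
rewrite typeA_nat typeC_nat => tq; case oa: (odd a) tq => /= tq.
  (* For odd a one solves a + 1 + 2l = 2n and a + 1 + 2l' = 2p - 2n; for even a, a + 1 + 2l = p + 2n
     and a + 1 + 2l' = p - 2n. *)
  exists (n - a.+1./2)%N, (p - n - a.+1./2)%N; split; try lia.
    by apply/eqP; rewrite al_eq_sj; apply/dvdnP; exists 1%N; lia.
  by apply/eqP; rewrite al_eq_nsj; apply/dvdnP; exists 2%N; lia.
exists ((p - a).-1./2 + n)%N, ((p - a).-1./2 - n)%N; split; try lia.
  by apply/eqP; rewrite al_eq_sj; apply/dvdnP; exists 2%N; lia.
by apply/eqP; rewrite al_eq_nsj; apply/dvdnP; exists 1%N; lia.
Qed.

Lemma odd_degenerate : degenerate p q = (n == 0%N).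
Proof. by rewrite /degenerate p_neq2 /= j_eq0. Qed.

Lemma odd_block : exists s delta, block k p q s delta.
Proof.
have YX t : (t < p)%N -> exists al' be : k,
    hY k t * hX k t * B1 k p false q = al' *: B1 k p false q + be *: B1 k p true q /\
    (degenerate p q -> be = 0).
  move=> ltt; have [al' [be [E1 E2 _]]] := odd_YX ltt.
  by exists al', be; split=> //; rewrite odd_degenerate => /eqP.
have nil : ~~ degenerate p q -> B1 k p true q * B1 k p true q = 0.
  by rewrite odd_degenerate; apply: odd_nil.
have top := odd_top; rewrite -odd_degenerate in top.
case tq: (typeA p q || typeC p q).
  have lts : (sAC p q < p)%N.
    by move: tq; rewrite typeA_nat typeC_nat sAC_nat; case: ifP => oa; lia.
  have s_gt0 : (0 < sAC p q)%N.
    by move: tq; rewrite typeA_nat typeC_nat sAC_nat; case: ifP => oa; lia.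
  have abs : (a + 2 * sAC p q = p + ~~ odd a)%N.
    by move: tq; rewrite typeA_nat typeC_nat sAC_nat; case: ifP => oa; lia.
  have lb : (~~ odd a <= 1)%N by case: (odd a).
  exists (sAC p q), true; split=> //.
  - exact: odd_central.
  - exact: odd_mu.
  - exact: odd_comm.
  - exact: odd_idem.
  - rewrite scale1r.
    have [al' [be [E1 E2 E3]]] := odd_YX lts.
    have {}E3 : al' != 0 by apply: E3; apply: Npol_neq0 => l ltl; apply: odd_AC_roots.
    (* On e, Y^(s) X^(s) acts as al' e + be n with al' <> 0, and either n^2 = 0 or be = 0; its
       inverse is e / al' - (be / al'^2) n. *)
    apply: (@Q_conj k p hp a (~~ odd a) (sAC p q) (B1 k p false q)
      (al'^-1 *: B1 k p false q - (be / al' ^+ 2) *: B1 k p true q)) => //.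
      exact: odd_mu.
    rewrite E1 mulrBr !mulrDl -!scalerAl -!scalerAr !odd_idem (odd_comm true) odd_idem.
    have -> : be *: (be / al' ^+ 2 *: (B1 k p true q * B1 k p true q)) = 0.
      have [n0|n0] := eqVneq n 0%N; first by rewrite (E2 n0) scale0r.
      by rewrite odd_nil // !scaler0.
    rewrite addr0 !scalerA divff // scale1r -addrA -scalerBl.
    rewrite (_ : be / al' - al' * (be / al' ^+ 2) = 0) ?scale0r ?addr0 //.
    by field.
  - by move=> h m; apply: (shift_AC hp (b := ~~ odd a)) => //; case: (odd a).
  - move=> eps m l; have [c [Hc c0]] := odd_Bexp eps lts (fun l => odd_AC_roots tq (l := l)).
    exact (@Zmap_AC k p hp eps q c m l lt_ap tq lts Hc c0).
have [l [l' [ltl ltl' El El']]] := odd_BD_roots tq.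
exists 0%N, false; split=> //.
- exact: odd_central.
- exact: odd_mu.
- exact: odd_comm.
- exact: odd_idem.
(* The coefficient vanishes if t + 1 > a. Otherwise p - t - 1 >= p - a, so the polynomial of
   Y^(p-t-1) X^(p-t-1) contains the factors at both j and -j and kills e. *)
- rewrite scale0r big1 // => t _.
  have ltt : (t.+1 < p)%N by have := ltn_ord t; lia.
  case: (leqP t.+1 a) => leta; last by rewrite bin_small // scale0r.
  rewrite YX_ev ?odd_kill ?scaler0 //; last lia.
  + move=> n0; apply: (@Npol_dvd2 p p_pr p_odd _ _ _ l l') => //; try lia.
    by rewrite sj_eq0.
  + move=> n0; apply: (@Npol_dvd1 _ _ _ l); first lia.
    by rewrite El /sj n0.
- by move=> h m; apply: shift_BD.
- by move=> eps m l0; apply: Zmap_BD.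
Qed.

End OddBlock.

(** * The three blocks for p = 2 *)

Section TwoBlock.
Variable k : fieldType.
Hypothesis hp : 2%N \in [pchar k].

Let w : hyper k := hY k 1 * hX k 1.
Let m (a : nat) := mu k 2 a.

Let two0 : 2%:R = 0 :> k. Proof. exact: pcharf0. Qed.

Lemma two_w_central : central1 2 w.
Proof. exact: (central1_YX hp). Qed.

Let mu_w a : m a * w = w * m a.
Proof. by have [_ _ H] := two_w_central; rewrite /m mu_hL H //; apply: ipf_mu. Qed.

Let mu_mu a : (a < 2)%N -> m a * m a = m a. Proof. exact: mu_idem. Qed.

(** As Y^2 X^2 = 0, [ES] gives w (w - (H + 2)) = 0, and H + 2 acts as a on [m a] in characteristic
    2. *)
Let ww a : (a < 2)%N -> w * (m a * w) = a%:R *: (m a * w).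
Proof.
move=> lta; have := ES hp 1; rewrite Ep // E1 -/w scale1r mulrBr => /esym/eqP.
rewrite subr_eq0 => /eqP E; rewrite mu_w mulrA E -mulrA.
rewrite (@hL_mu k 2 hp a _ (fun=> a%:Z)) //; first by rewrite hL_cst -scalerAl mul1r scalerAr.
- exact: ipf_add.
- exact: ipf_cst.
- move=> h; rewrite !rmorphD rmorphM /= (_ : 2%:Z%:~R = 0 :> k) //.
  by rewrite mul0r add0r addr0.
Qed.

Let ww' a : (a < 2)%N -> m a * w * (m a * w) = a%:R *: (m a * w).
Proof. by move=> lta; rewrite -mulrA ww // -scalerAr mulrA mu_mu. Qed.

Let central_w a : central1 2 (m a * w).
Proof. by apply: central1M; [exact: central1_mu|exact: two_w_central]. Qed.

Let lt2 t : (t < 2)%N -> t = 0%N \/ t = 1%N.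
Proof. by case: t => [|[|]] //; [left|right]. Qed.

Let hYX0 : hY k 0 * hX k 0 = 1. Proof. by rewrite hX0 hY0 mulr1. Qed.

Lemma two_block_0 : block k 2 (0%N, 1 / 2) 0 false.
Proof.
have Be eps : B1 k 2 eps (0%N, 1 / 2) = if eps then m 0 * w else m 0.
  by case: eps; rewrite /B1 //= -mulrA.
split=> //.
- move=> eps; rewrite Be; case: eps => //; exact: central1_mu.
- by move=> eps; rewrite Be; case: eps; rewrite ?mulrA mu_mu.
- move=> eps eps'; rewrite !Be; case: eps; case: eps' => //.
    by rewrite [RHS]mulrA mu_mu // -mulrA -mu_w mulrA mu_mu.
  by rewrite mulrA mu_mu // -mulrA -mu_w mulrA mu_mu.
- by move=> eps; rewrite !Be; case: eps; rewrite ?mulrA mu_mu.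
- by move=> _; rewrite !Be ww' // scale0r.
- move=> t /lt2 [->|->]; rewrite !Be.
    by exists 1, 0; rewrite hYX0 mul1r scale1r scale0r addr0.
  by exists 0, 1; rewrite scale1r scale0r add0r -/w mu_w.
- by rewrite /= big_ord_recl big_ord0 /= !scale0r addr0.
- by move=> h n; apply: (shift_BD hp).
- exists (fun t : 'I_2 => (t == 1%N :> nat)%:R); split.
    by rewrite Be !big_ord_recl big_ord0 /= scale0r scale1r add0r addr0.
  by move=> t [->]; rewrite oner_eq0.
- by move=> eps i n; apply: Zmap_BD.
Qed.

Lemma two_block_10 : block k 2 (1%N, 0) 1 true.
Proof.
have Be eps : B1 k 2 eps (1%N, 0) = m 1 * w.
  by rewrite /B1 //= -mulrA.
split=> //.
- by move=> eps; rewrite Be.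
- by move=> eps; rewrite Be mulrA mu_mu.
- by move=> eps; rewrite !Be ww' // scale1r.
- move=> t /lt2 [->|->]; rewrite !Be.
    by exists 1, 0; rewrite hYX0 mul1r scale1r scale0r addr0.
  by exists 1, 0; rewrite scale1r scale0r addr0 -/w ww // scale1r.
- by rewrite Be /= big_ord_recl big_ord0 /= !scale1r addr0 -/w ww // scale1r.
- by move=> h n; apply: (shift_AC hp (b := 1)).
- exists (fun t : 'I_2 => (t == 1%N :> nat)%:R); split.
    by rewrite Be !big_ord_recl big_ord0 /= scale0r scale1r add0r addr0.
  by move=> t [->]; rewrite oner_eq0.
- move=> eps i n; apply: (@Zmap_AC k 2 hp eps (1%N, 0) [ffun t : 'I_2 => (t == 1%N :> nat)%:R] i n) => //.
    rewrite /Bexp Be !big_ord_recl big_ord0 /= !ffunE /= Fp_in0 // Fp_in1 //.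
    by rewrite scale0r scale1r add0r addr0 E1.
  by move=> t; rewrite /sAC /= ltnS leqn0 => /eqP t0; rewrite ffunE t0.
Qed.

Lemma two_block_11 : block k 2 (1%N, 1) 0 false.
Proof.
have Be eps : B1 k 2 eps (1%N, 1) = m 1 * w + m 1.
  by rewrite /B1 //= -mulrA.
have wB : w * (m 1 * w + m 1) = 0.
  by rewrite mulrDr ww // scale1r -mu_w -mulr2n -scaler_nat two0 scale0r.
have mB : m 1 * (m 1 * w + m 1) = m 1 * w + m 1 by rewrite mulrDr mulrA mu_mu.
split=> //.
- by move=> eps; rewrite Be; apply: central1D => //; apply: central1_mu.
- by move=> eps; rewrite Be.
- by move=> eps; rewrite !Be mulrDl -mulrA wB mulr0 add0r.
- move=> t /lt2 [->|->]; rewrite !Be.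
    by exists 1, 0; rewrite hYX0 mul1r scale1r scale0r addr0.
  by exists 0, 0; rewrite !scale0r addr0 -/w wB.
- by rewrite Be /= big_ord_recl big_ord0 /= scale1r scale0r addr0 -/w wB.
- by move=> h n; apply: (shift_BD hp).
- exists (fun t : 'I_2 => 1); split; last by move=> t _; rewrite oner_eq0.
  rewrite Be !big_ord_recl big_ord0 /= !scale1r addr0 hYX0 -/w mulrDr mulr1.
  by rewrite addrC.
- by move=> eps i n; apply: Zmap_BD.
Qed.

End TwoBlock.

(** * The algebras A_r *)

Section Subalgebras.
Variables (k : fieldType) (A : algType k).

Record subalg (S : set A) : Prop := Subalg {
  subalg1 : S 1;
  subalgL : forall c x y, S x -> S y -> S (c *: x + y);
  subalgM : forall x y, S x -> S y -> S (x * y)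
}.

Lemma subalgP (S : set A) : GRing.subalg_closed [in S] <-> subalg S.
Proof.
split=> [[h1 h2 h3]|[h1 h2 h3]].
  split=> [|c x y|x y]; first by move: h1; rewrite inE.
    by move=> Sx Sy; have := h2 c x y; rewrite !inE; apply.
  by move=> Sx Sy; have := h3 x y; rewrite !inE; apply.
split; first by rewrite inE.
  by move=> c x y; rewrite !inE; apply: h2.
by move=> x y; rewrite !inE; apply: h3.
Qed.

Section Closure.
Variables (S : set A) (sS : subalg S).
Lemma subalg0 : S 0.
Proof. by have := subalgL sS (-1) (subalg1 sS) (subalg1 sS); rewrite scaleN1r addNr. Qed.
Lemma subalgD x y : S x -> S y -> S (x + y).
Proof. by move=> Sx Sy; rewrite -[x]scale1r; apply: subalgL. Qed.
Lemma subalgZ c x : S x -> S (c *: x).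
Proof. by move=> Sx; rewrite -[_ *: _]addr0; apply: subalgL => //; apply: subalg0. Qed.
Lemma subalgB x y : S x -> S y -> S (x - y).
Proof. by move=> Sx Sy; rewrite addrC -scaleN1r; apply: subalgL. Qed.
Lemma subalg_sum (I : Type) (r : seq I) (P : pred I) (F : I -> A) :
  (forall i, P i -> S (F i)) -> S (\sum_(i <- r | P i) F i).
Proof. by move=> H; apply: big_ind => //; [exact: subalg0|exact: subalgD]. Qed.
Lemma subalg_horner x f : S x -> S (horner_alg x f).
Proof.
move=> Sx; elim/poly_ind: f => [|f c IH]; first by rewrite rmorph0; apply: subalg0.
rewrite rmorphD rmorphM /= horner_algX horner_algC.
by apply: subalgD; [exact: subalgM|apply: subalgZ; exact: subalg1].
Qed.
End Closure.

Lemma subalg_genP (T : set A) : subalg (subalg_gen T).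
Proof.
split=> [|c x y Sx Sy|x y Sx Sy] B [/subalgP sB TB].
- exact: subalg1.
- by apply: subalgL => //; [apply: Sx|apply: Sy]; split=> //; apply/subalgP.
- by apply: subalgM => //; [apply: Sx|apply: Sy]; split=> //; apply/subalgP.
Qed.
Lemma subalg_gen_in (T : set A) x : T x -> subalg_gen T x.
Proof. by move=> Tx B [_ TB]; apply: TB. Qed.
Lemma subalg_gen_min (T S : set A) : subalg S -> (forall x, T x -> S x) ->
  forall x, subalg_gen T x -> S x.
Proof. by move=> sS TS x; apply; split=> //; apply/subalgP. Qed.

End Subalgebras.

Section Frobenius.
Variables (k : fieldType) (p : nat).
Hypothesis hp : p \in [pchar k].

Let p_pr : prime p. Proof. exact: pcharf_prime hp. Qed.
Let p_gt0 : (0 < p)%N. Proof. exact: prime_gt0 p_pr. Qed.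
Let p_gt1 : (1 < p)%N. Proof. exact: prime_gt1 p_pr. Qed.
Let q_gt0 r : (0 < p ^ r)%N. Proof. by rewrite expn_gt0 p_gt0. Qed.

Local Notation bk := (@bk k).
Local Notation U := (hyper k).

(** By Lucas this reduces to (n1+1) binom(c,n1+1) = (c - n1) binom(c,n1), where c is the quotient of
    the weight by p^r. As n1 + 1 is invertible in k, binom(H,n) is built digit by digit from the
    binom(H,p^i). *)
Lemma binH_step r n1 n0 : (n0 < p ^ r)%N -> (n1.+1 < p)%N ->
  n1.+1%:R *: binH k 0 (p ^ r * n1.+1 + n0) =
  binH k 0 (p ^ r * n1 + n0) * (binH k 0 (p ^ r) - n1%:R *: 1).
Proof.
move=> ltn0 ltn1; rewrite !binH0E.
have -> : hL k (binz^~ (p ^ r)%N) - n1%:R *: 1 = hL k (fun h => binz h (p ^ r)%N + (- n1%:Z)).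
  rewrite hLD; [|exact: ipf_binz|exact: ipf_cst].
  by rewrite hL_cst rmorphN scaleNr.
rewrite -hLM; [|exact: ipf_binz|exact: ipfD (ipf_binz _) (ipf_cst _)].
rewrite -[n1.+1%:R]/(n1.+1%:Z%:~R) -hLZ; last exact: ipf_binz.
apply: (hL_congr hp); [exact: ipfM (ipf_cst _) (ipf_binz _)| |].
  exact: ipfM (ipf_binz _) (ipfD (ipf_binz _) (ipf_cst _)).
move=> h; have [c [b [ltb ->]]] := int_divp h (q_gt0 r).
rewrite !rmorphM rmorphD /= -![(binz _ _)%:~R]/(bk _ _).
rewrite !(bk_lucas hp) //.
have := bk_lucas hp c 1 ltb (q_gt0 r); rewrite muln1 addn0 bin0 mulr1 => ->.
have := congr1 (fun z : int => z%:~R : k) (binzS c n1); rewrite !rmorphM rmorphB /=.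
rewrite -![(binz _ _)%:~R]/(bk _ _) => E1.
have -> : bk c 1 = c%:~R by have := binzS c 0; rewrite /bk binz0 mul1r subr0 mulr1 => ->.
rewrite mulrA E1; rewrite rmorphN /=; ring.
Qed.

Lemma binH_subalg (S : set U) r : subalg S ->
  (forall i, (i < r)%N -> S (binH k 0 (p ^ i))) ->
  forall n, (n < p ^ r)%N -> S (binH k 0 n).
Proof.
move=> sS; elim: r => [|r IH] H n.
  rewrite expn0 ltnS leqn0 => /eqP ->; rewrite binH0E (@hL1 k (binz^~ 0%N)).
  - exact: subalg1.
  - exact: ipf_binz.
  - by move=> h; rewrite binz0.
move=> ltn; rewrite (divn_eq n (p ^ r)) mulnC.
have : (n %/ p ^ r < p)%N by rewrite ltn_divLR // -expnS.
have := ltn_pmod n (q_gt0 r); move: (n %/ p ^ r)%N (n %% p ^ r)%N => n1 n0 lt0.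
elim: n1 => [|n1 IH1] lt1.
  by rewrite muln0 add0n; apply: IH => // i lti; apply: H; apply: ltnW.
have n10 : n1.+1%:R != 0 :> k by rewrite -(dvdn_pcharf hp) gtnNdvd.
rewrite -[binH _ _ _]scale1r -(mulVf n10) -scalerA binH_step //.
apply: subalgZ => //; apply: subalgM => //; first by apply: IH1; apply: ltnW.
by apply: subalgB => //; [exact: H|apply: subalgZ => //; exact: subalg1].
Qed.

Lemma hL_subalg (S : set U) r F : subalg S ->
  (forall i, (i < r)%N -> S (binH k 0 (p ^ i))) -> ipf F -> per k p r F -> S (hL k F).
Proof.
move=> sS H iF pF; rewrite (hL_per hp iF pF).
apply: (subalg_sum sS) => n _; apply: subalgZ => //.
exact: (binH_subalg sS H).
Qed.

Lemma bin_digit i m : (p ^ i <= m)%N -> (m < p ^ i.+1)%N -> 'C(m, p ^ i)%:R != 0 :> k.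
Proof.
move=> le lt.
have := bk_lucas hp (m %/ p ^ i)%N%:Z 1 (ltn_pmod m (q_gt0 i)) (q_gt0 i).
rewrite muln1 addn0 bin0 mulr1 -PoszM -PoszD mulnC -divn_eq !bk_nat bin1 => ->.
rewrite -(dvdn_pcharf hp) gtnNdvd //; first by rewrite divn_gt0.
by rewrite ltn_divLR // -expnS.
Qed.

(** If p^i is the largest power of p below or equal to m, binom(m,p^i) is the leading digit of m,
    hence invertible in k, and D m is a multiple of D (p^i) D (m - p^i). *)
Lemma divided_power_subalg (S : set U) (D : nat -> U) r : subalg S -> D 0%N = 1 ->
  (forall m n, D m * D n = 'C(m + n, m)%:R *: D (m + n)%N) ->
  (forall i, (i < r)%N -> S (D (p ^ i)%N)) -> forall m, (m < p ^ r)%N -> S (D m).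
Proof.
move=> sS D0 DM H; elim/ltn_ind => m IH ltm.
have [->|m_gt0] := posnP m; first by rewrite D0; apply: subalg1.
pose i := trunc_log p m.
have le : (p ^ i <= m)%N by apply: trunc_logP.
have lt : (m < p ^ i.+1)%N by apply: trunc_log_ltn.
have ltir : (i < r)%N.
  by rewrite -(ltn_exp2l _ _ p_gt1) (leq_ltn_trans le).
have := DM (p ^ i)%N (m - p ^ i)%N; rewrite subnKC // => E.
have c0 := bin_digit le lt.
rewrite -[D m]scale1r -(mulVf c0) -scalerA -E.
apply: subalgZ => //; apply: subalgM => //; first exact: H.
have := q_gt0 i; move: le; set q := (p ^ i)%N => le q0.
by apply: IH; [rewrite ltn_subrL q0 m_gt0|rewrite (leq_ltn_trans (leq_subr _ _))].
Qed.

Lemma Ur_hX r m : (m < p ^ r)%N -> @Ur k p r (hX k m).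
Proof.
apply: divided_power_subalg; [exact: subalg_genP|exact: hX0|exact: hXM|].
by move=> i lti; apply: subalg_gen_in; left; exists i.
Qed.
Lemma Ur_hY r m : (m < p ^ r)%N -> @Ur k p r (hY k m).
Proof.
apply: divided_power_subalg; [exact: subalg_genP|exact: hY0|exact: hYM|].
by move=> i lti; apply: subalg_gen_in; right; exists i.
Qed.

Lemma per_xy r n c t : (t < p ^ r)%N -> per k p r (fun h => binz (h - n%:Z - c%:Z + 2 * t%:Z) t).
Proof.
move=> lt h d; rewrite -[LHS]/(bk _ _) -[RHS]/(bk _ _) -(bk_per hp (h - n%:Z - c%:Z + 2 * t%:Z) d lt).
by congr bk; ring.
Qed.

(** This is the last term of X^(p^i) Y^(p^i). The other terms involve binomials of degree below p^i,
    which have period p^i and so are generated by the binom(H,p^i') with i' < i. *)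
Lemma Ur_binH r i : (i < r)%N -> @Ur k p r (binH k 0 (p ^ i)).
Proof.
have sU := subalg_genP ([set hX k (p ^ i)%N | i in `I_r] `|` [set hY k (p ^ i)%N | i in `I_r]).
elim/ltn_ind: i => i IH lti; have ltq : (p ^ i < p ^ r)%N by rewrite ltn_exp2l.
have := hXY k (p ^ i) (p ^ i); rewrite big_ord_recr /= /ydv leqnn subnn hX0 hY0 mul1r mulr1.
move=> /esym/(canRL (addKr _)) E.
have -> : binH k 0 (p ^ i) = hL k (fun h => binz (h - (p ^ i)%N%:Z - (p ^ i)%N%:Z + 2 * (p ^ i)%N%:Z) (p ^ i)).
  by rewrite binH0E; congr hL; apply/funext => h; congr binz; ring.
rewrite E addrC; apply: (subalgB sU).
  by apply: (subalgM sU); [exact: Ur_hX|exact: Ur_hY].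
apply: (subalg_sum sU) => t _; have ltt := ltn_ord t; rewrite ltnW //.
have lts : (p ^ i - t < p ^ r)%N by rewrite (leq_ltn_trans (leq_subr _ _)).
apply: (subalgM sU); last exact: Ur_hX.
apply: (subalgM sU); first exact: Ur_hY.
apply: (hL_subalg (r := i) sU); [|exact: ipf_xy|exact: per_xy].
by move=> i' lti'; apply: IH => //; apply: ltn_trans lti.
Qed.

(* This is [calAr k p r], but only the inclusion is needed. *)
Definition Ap (r : nat) : set U :=
  subalg_gen ([set binH k 0 (p ^ i)%N | i in `I_r] `|`
              [set hY k (p ^ i)%N * hX k (p ^ i)%N | i in `I_r]).

Lemma Ap_subalg r : subalg (Ap r). Proof. exact: subalg_genP. Qed.
Lemma Ap_binH r i : (i < r)%N -> Ap r (binH k 0 (p ^ i)).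
Proof. by move=> lti; apply: subalg_gen_in; left; exists i. Qed.
Lemma Ap_YX r i : (i < r)%N -> Ap r (hY k (p ^ i) * hX k (p ^ i)).
Proof. by move=> lti; apply: subalg_gen_in; right; exists i. Qed.
Lemma Ap_hL r F : ipf F -> per k p r F -> Ap r (hL k F).
Proof. exact: (hL_subalg (Ap_subalg r) (@Ap_binH r)). Qed.
Lemma Ap_mono r s x : (r <= s)%N -> Ap r x -> Ap s x.
Proof.
move=> le; apply: subalg_gen_min; first exact: Ap_subalg.
move=> _ [[i lti <-]|[i lti <-]]; [apply: Ap_binH|apply: Ap_YX]; exact: leq_trans le.
Qed.

Lemma Ap_calAr r x : Ap r x -> calAr k p r x.
Proof.
move=> Ax; split; move: x Ax; apply: subalg_gen_min; try exact: subalg_genP.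
  move=> _ [[i _ <-]|[i _ <-]]; apply: subalg_gen_in; [left|right]; by exists i.
have sU := subalg_genP ([set hX k (p ^ i)%N | i in `I_r] `|` [set hY k (p ^ i)%N | i in `I_r]).
move=> _ [[i lti <-]|[i lti <-]]; first exact: Ur_binH.
apply: (subalgM sU); apply: subalg_gen_in; [right|left]; by exists i.
Qed.

Definition Vgen (r : nat) : set U :=
  [set x | exists m n l, [/\ (m < p ^ r)%N, (n < p ^ r)%N, (l < p ^ r)%N &
     x = hY k m * binH k 0 n * hX k l]].
Definition Wgen (r : nat) : set U :=
  [set x | exists m n, [/\ (m < p ^ r)%N, (n < p ^ r)%N & x = hY k m * binH k 0 n * hX k m]].

Lemma Vspan_term r m F l : (m < p ^ r)%N -> (l < p ^ r)%N -> ipf F -> per k p r F ->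
  kspan (Vgen r) (hY k m * hL k F * hX k l).
Proof.
move=> ltm ltl iF pF; rewrite (hL_per hp iF pF) mulr_sumr mulr_suml.
apply: kspan_sum => n _; rewrite -scalerAr -scalerAl; apply: kspanZ; apply: kspan_gen.
by exists m, n, l; split.
Qed.

Lemma Wspan_term r m F : (m < p ^ r)%N -> ipf F -> per k p r F ->
  kspan (Wgen r) (hY k m * hL k F * hX k m).
Proof.
move=> ltm iF pF; rewrite (hL_per hp iF pF) mulr_sumr mulr_suml.
apply: kspan_sum => n _; rewrite -scalerAr -scalerAl; apply: kspanZ; apply: kspan_gen.
by exists m, n; split.
Qed.

(** The remainder i + j - p^r is smaller than i, so Lucas gives 0. Hence products of divided powers
    below p^r never leave that range. *)
Lemma bin_carry r i j : (i < p ^ r)%N -> (j < p ^ r)%N -> (p ^ r <= i + j)%N ->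
  'C(i + j, i)%:R = 0 :> k.
Proof.
move=> lti ltj le; pose c := (i + j - p ^ r)%N.
have ltc : (c < p ^ r)%N by rewrite /c; lia.
have := bk_lucas hp 1 0 ltc lti; rewrite muln0 add0n bk0 mul1r mulr1 -PoszD.
rewrite (_ : p ^ r + c = i + j)%N; last by rewrite /c; lia.
rewrite bk_nat => ->; rewrite bin_small // /c; lia.
Qed.

Lemma perM r F G : per k p r F -> per k p r G -> per k p r (fun h => F h * G h).
Proof. by move=> pF pG h c; rewrite !rmorphM /= pF pG. Qed.
Lemma per_shift r F c : per k p r F -> per k p r (fun h => F (h + c)).
Proof. by move=> pF h d; rewrite addrAC pF. Qed.
Lemma per_binz0 r n : (n < p ^ r)%N -> per k p r (binz^~ n).
Proof. by move=> lt h d; apply: (bk_per hp). Qed.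

Lemma Vspan_mulX r i x : (i < p ^ r)%N -> kspan (Vgen r) x -> kspan (Vgen r) (hX k i * x).
Proof.
move=> lti; apply: (kspan_map (f := fun x => hX k i * x)); first exact: linear_mull.
move=> _ [m [n [l [ltm ltn ltl ->]]]]; rewrite !mulrA hXY !mulr_suml.
apply: kspan_sum => t _; rewrite /ydv; case: ifP => [let_|_]; last first.
  by rewrite !mul0r; apply: kspan0.
have ltt := ltn_ord t.
rewrite binH0E -(mulrA (_ * hL k _)) hX_L; last exact: ipf_binz.
rewrite mulrA -(mulrA (hY k _)) -hLM; last 2 first.
- exact: ipf_xy.
- exact: ipf_shift (ipf_binz _).
rewrite -mulrA hXM -scalerAr; case: (leqP (p ^ r) (i - t + l)) => le.
  by rewrite (bin_carry _ _ le) ?scale0r //; [exact: kspan0|lia].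
apply: kspanZ; apply: Vspan_term => //; first lia.
  exact: ipfM (ipf_xy _ _ _) (ipf_shift _ (ipf_binz _)).
apply: perM; first by apply: per_xy; lia.
exact: per_shift (per_binz0 _).
Qed.

Lemma Vspan_mulY r i x : (i < p ^ r)%N -> kspan (Vgen r) x -> kspan (Vgen r) (hY k i * x).
Proof.
move=> lti; apply: (kspan_map (f := fun x => hY k i * x)); first exact: linear_mull.
move=> _ [m [n [l [ltm ltn ltl ->]]]]; rewrite !mulrA hYM -!scalerAl.
case: (leqP (p ^ r) (i + m)) => le.
  by rewrite (bin_carry _ _ le) ?scale0r //; exact: kspan0.
by apply: kspanZ; apply: kspan_gen; exists (i + m)%N, n, l.
Qed.

Lemma Ur_Vspan r x : @Ur k p r x -> kspan (Vgen r) x.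
Proof.
move=> Ux; rewrite -[x]mulr1.
have V1 : kspan (Vgen r) 1.
  apply: kspan_gen; exists 0%N, 0%N, 0%N; split=> //.
  rewrite hX0 hY0 mul1r mulr1 binH0E (@hL1 k (binz^~ 0%N)) //; first exact: ipf_binz.
  by move=> h; rewrite binz0.
suff H : forall v, kspan (Vgen r) v -> kspan (Vgen r) (x * v) by apply: H.
move: x Ux; apply: (subalg_gen_min (S := [set x | forall v, kspan (Vgen r) v -> kspan (Vgen r) (x * v)])).
  split=> [v|c x y Hx Hy v Hv|x y Hx Hy v Hv] /=; first by rewrite mul1r.
    by rewrite mulrDl -scalerAl; apply: kspanD; [apply: kspanZ; apply: Hx|apply: Hy].
  by rewrite -mulrA; apply: Hx; apply: Hy.
move=> _ [[i lti <-]|[i lti <-]] v Hv; have ltq : (p ^ i < p ^ r)%N by rewrite ltn_exp2l.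
  exact: Vspan_mulX.
exact: Vspan_mulY.
Qed.

Lemma calA_comm x F : @calA k p x -> ipf F -> x * hL k F = hL k F * x.
Proof.
move=> Ax iF; move: x Ax.
apply: (subalg_gen_min (S := [set x | x * hL k F = hL k F * x])).
  split=> [|c x y /= Hx Hy|x y /= Hx Hy] /=; first by rewrite mul1r mulr1.
    by rewrite mulrDl mulrDr -scalerAl -scalerAr Hx Hy.
  by rewrite -mulrA Hy mulrA Hx mulrA.
move=> _ [[i _ <-]|[i _ <-]] /=; first by rewrite binH0E; apply: hLC => //; apply: ipf_binz.
exact: (hYX_hL hp).
Qed.

Lemma Vspan_box r x : kspan (Vgen r) x ->
  exists c : 'I_(p ^ r) -> 'I_(p ^ r) -> 'I_(p ^ r) -> k,
    x = \sum_m \sum_n \sum_l c m n l *: (hY k m * binH k 0 n * hX k l).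
Proof.
elim=> [|a _ v [m [n [l [ltm ltn ltl ->]]]] _ [c ->]].
  exists (fun _ _ _ => 0); rewrite big1 // => m _; rewrite big1 // => n _; rewrite big1 // => l _.
  by rewrite scale0r.
exists (fun m' n' l' => a * ((m' == Ordinal ltm) && (n' == Ordinal ltn) && (l' == Ordinal ltl))%:R + c m' n' l').
symmetry; transitivity (\sum_(m' < p ^ r) \sum_(n' < p ^ r) \sum_(l' < p ^ r)
   (a * ((m' == Ordinal ltm) && (n' == Ordinal ltn) && (l' == Ordinal ltl))%:R) *:
     (hY k m' * binH k 0 n' * hX k l') + \sum_(m' < p ^ r) \sum_(n' < p ^ r) \sum_(l' < p ^ r)
      c m' n' l' *: (hY k m' * binH k 0 n' * hX k l')).
  rewrite -big_split; apply: eq_bigr => m' _ /=; rewrite -big_split; apply: eq_bigr => n' _ /=.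
  by rewrite -big_split; apply: eq_bigr => l' _ /=; rewrite scalerDl.
congr (_ + _).
rewrite (bigD1 (Ordinal ltm)) //= [X in _ + X]big1 ?addr0; last first.
  move=> m' /negbTE ->; rewrite big1 // => n' _; rewrite big1 // => l' _.
  by rewrite mulr0 scale0r.
rewrite (bigD1 (Ordinal ltn)) //= [X in _ + X]big1 ?addr0; last first.
  move=> n' /negbTE ->; rewrite big1 // => l' _.
  by rewrite andbF mulr0 scale0r.
rewrite (bigD1 (Ordinal ltl)) //= [X in _ + X]big1 ?addr0; last first.
  by move=> l' /negbTE ->; rewrite andbF mulr0 scale0r.
by rewrite !eqxx mulr1.
Qed.

Lemma binz_indep N (c : 'I_N -> k) :
  (forall h : int, \sum_n c n * bk h n = 0) -> forall n, c n = 0.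
Proof.
move=> H; suff K m (n : 'I_N) : n = m :> nat -> c n = 0 by move=> n; apply: K.
elim/ltn_ind: m n => m IH n nm; have := H n%:Z.
rewrite (bigD1 n) //= big1 ?addr0; first by rewrite bk_nat binn mulr1.
move=> i ne; rewrite bk_nat; case: (ltngtP i n) => [lt|lt|/val_inj E].
- by rewrite (IH i _ i) ?mul0r // -nm.
- by rewrite bin_small // mulr0.
- by rewrite E eqxx in ne.
Qed.

Lemma phi_basis_hL m l h a n b F : ipf F ->
  phi m l h (hY k a * binH k 0 n * hX k b * hL k F) =
  ((m == a) && (l == b))%:R * (bk h n * (F (h - 2 * b%:Z))%:~R).
Proof.
move=> iF; have iF' : ipf (fun h => F (h - 2 * b%:Z)) by exact: ipf_shift.
have -> : hY k a * binH k 0 n * hX k b * hL k F =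
    hY k a * hL k (fun h => binz h n * F (h - 2 * b%:Z)) * hX k b.
  rewrite hLM //; last exact: ipf_binz.
  by rewrite -[LHS]mulrA hX_L // binH0E !mulrA.
rewrite phi_term; last exact: ipfM (ipf_binz _) iF'.
by rewrite rmorphM.
Qed.

Lemma phi_hL_basis m l h a n b F : ipf F ->
  phi m l h (hL k F * (hY k a * binH k 0 n * hX k b)) =
  ((m == a) && (l == b))%:R * (bk h n * (F (h - 2 * a%:Z))%:~R).
Proof.
move=> iF; have iF' : ipf (fun h => F (h - 2 * a%:Z)) by exact: ipf_shift.
have -> : hL k F * (hY k a * binH k 0 n * hX k b) =
    hY k a * hL k (fun h => F (h - 2 * a%:Z) * binz h n) * hX k b.
  rewrite hLM //; last exact: ipf_binz.
  by rewrite !mulrA hL_Y // binH0E.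
rewrite phi_term; last exact: ipfM iF' (ipf_binz _).
by rewrite rmorphM [X in _ * X]mulrC.
Qed.

(* An element of [calA] commutes with all [binom(H - c, 2 d)], so it has weight
   zero and only the terms with [m = l] survive. *)
Lemma calAr_Wspan r x : calAr k p r x -> kspan (Wgen r) x.
Proof.
move=> [Ax Ux]; have [c xE] := Vspan_box (Ur_Vspan Ux).
have c0 m n l : m != l -> c m n l = 0.
  move=> ne; apply: (@binz_indep _ (fun n => c m n l)) => h.
  (* The coordinate (m,l,h) of x F(H) = F(H) x: moving F across X^(l) translates it by -2l on one
     side, and across Y^(m) by -2m on the other. *)
  have K F : ipf F -> (\sum_n0 c m n0 l * bk h n0) * ((F (h - 2 * l%:Z))%:~R - (F (h - 2 * m%:Z))%:~R) = 0.
    move=> iF; have := congr1 (phi m l h) (calA_comm Ax iF).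
    rewrite xE !mulr_suml !mulr_sumr !phi_sum.
    have T1 (m' : 'I_(p ^ r)) : phi m l h ((\sum_(n0 < p ^ r) \sum_(l' < p ^ r)
        c m' n0 l' *: (hY k m' * binH k 0 n0 * hX k l')) * hL k F) =
        (m' == m)%:R * (\sum_(n0 < p ^ r) c m' n0 l * bk h n0 * (F (h - 2 * l%:Z))%:~R).
      rewrite mulr_suml phi_sum mulr_sumr; apply: eq_bigr => n0 _.
      rewrite mulr_suml phi_sum (bigD1 l) //= big1 ?addr0.
        by rewrite -scalerAl phiZ phi_basis_hL // eqxx andbT (eq_sym (m : nat)) mulrCA -mulrA.
      move=> l' nl; rewrite -scalerAl phiZ phi_basis_hL //.
      by rewrite (_ : (l == l' :> nat) = false) ?andbF ?mul0r ?mulr0 //; apply/negbTE; rewrite eq_sym.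
    have T2 (m' : 'I_(p ^ r)) : phi m l h (hL k F * (\sum_(n0 < p ^ r) \sum_(l' < p ^ r)
        c m' n0 l' *: (hY k m' * binH k 0 n0 * hX k l'))) =
        (m' == m)%:R * (\sum_(n0 < p ^ r) c m' n0 l * bk h n0 * (F (h - 2 * m'%:Z))%:~R).
      rewrite mulr_sumr phi_sum mulr_sumr; apply: eq_bigr => n0 _.
      rewrite mulr_sumr phi_sum (bigD1 l) //= big1 ?addr0.
        by rewrite -scalerAr phiZ phi_hL_basis // eqxx andbT (eq_sym (m : nat)) mulrCA -mulrA.
      move=> l' nl; rewrite -scalerAr phiZ phi_hL_basis //.
      by rewrite (_ : (l == l' :> nat) = false) ?andbF ?mul0r ?mulr0 //; apply/negbTE; rewrite eq_sym.
    under eq_bigr => m' _ do rewrite T1.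
    under [RHS]eq_bigr => m' _ do rewrite T2.
    rewrite (bigD1 m) //= [X in _ + X = _]big1 ?addr0; last by move=> i /negbTE ->; rewrite mul0r.
    rewrite [RHS](bigD1 m) //= [X in _ = _ + X]big1 ?addr0; last by move=> i /negbTE ->; rewrite mul0r.
    rewrite eqxx !mul1r -!mulr_suml => /eqP; rewrite -subr_eq0 -mulrBr.
    by move/eqP.
  have fin F : ipf F -> (F (h - 2 * l%:Z))%:~R - (F (h - 2 * m%:Z))%:~R != 0 :> k ->
      \sum_(n0 < p ^ r) c m n0 l * bk h n0 = 0.
    by move=> iF nz; have /eqP := K F iF; rewrite mulf_eq0 (negbTE nz) orbF => /eqP.
  have nml : (m : nat) != l by [].
  (* The weights h - 2l and h - 2m may agree modulo p, so F = H would not separate them. A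
     translated binomial of degree 2|l - m| takes the values 0 and 1 there. *)
  case: (ltngtP m l) nml => // [ltml|ltlm] _.
  - apply: (fin (fun h' => binz (h' + (- (h - 2 * l%:Z))) (2 * (l - m)))); first exact: ipf_binzD.
    rewrite subrr (_ : h - 2 * m%:Z + - (h - 2 * l%:Z) = (2 * (l - m))%N%:Z); last by lia.
    rewrite !binz_nat binn bin_small ?sub0r ?oppr_eq0 ?oner_eq0 //.
    by rewrite muln_gt0 /= subn_gt0.
  - apply: (fin (fun h' => binz (h' + (- (h - 2 * m%:Z))) (2 * (m - l)))); first exact: ipf_binzD.
    rewrite subrr (_ : h - 2 * l%:Z + - (h - 2 * m%:Z) = (2 * (m - l))%N%:Z); last by lia.
    rewrite !binz_nat binn bin_small ?subr0 ?oner_eq0 //.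
    by rewrite muln_gt0 /= subn_gt0.
rewrite xE; apply: kspan_sum => m _; apply: kspan_sum => n _; rewrite (bigD1 m) //= big1 ?addr0.
  by apply: kspanZ; apply: kspan_gen; exists m, n.
by move=> l ne; rewrite c0 ?scale0r // eq_sym.
Qed.

End Frobenius.

(** * Induction on r *)

Lemma sum_shift (V : nmodType) (f : int -> V) (q : nat) :
  (forall h, f (h + q%:Z) = f h) -> forall c : int, \sum_(h < q) f (h%:Z + c) = \sum_(h < q) f h%:Z.
Proof.
move=> pf.
have step (c : int) : \sum_(h < q) f (h%:Z + (c + 1)) = \sum_(h < q) f (h%:Z + c).
  case: q pf => [|q] pf; first by rewrite !big_ord0.
  rewrite big_ord_recr [RHS]big_ord_recl /= addrC; congr (_ + _).
    by rewrite -(pf (0%:Z + c)); congr f; lia.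
  by apply: eq_bigr => i _; congr f; rewrite /bump /=; lia.
elim/int_ind => [|n IH|n IH].
- by apply: eq_bigr => i _; rewrite addr0.
- have -> : n.+1%:Z = n%:Z + 1 by lia.
  by rewrite step IH.
- by rewrite -step (_ : - n.+1%:Z + 1 = - n%:Z) ?IH //; lia.
Qed.

Lemma ipf_affine F (a b : int) : ipf F -> ipf (fun h => F (a * h + b)).
Proof.
move=> [P hP]; exists (P \Po (a%:~R *: 'X + b%:~R%:P)) => h.
by rewrite horner_comp hornerD hornerZ hornerX hornerC -intrM -intrD hP.
Qed.

Section Tower.
Variables (k : fieldType) (p : nat).
Hypothesis hp : p \in [pchar k].

Let p_pr : prime p. Proof. exact: pcharf_prime hp. Qed.
Let p_gt0 : (0 < p)%N. Proof. exact: prime_gt0 p_pr. Qed.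
Let p_gt1 : (1 < p)%N. Proof. exact: prime_gt1 p_pr. Qed.
Let q_gt0 r : (0 < p ^ r)%N. Proof. by rewrite expn_gt0 p_gt0. Qed.

Local Notation bk := (@bk k).
Local Notation U := (hyper k).
Local Notation Bl eps L := (Brec k p (zip eps L)).

Lemma block_exists q : calP p q -> exists s delta, block k p q s delta.
Proof.
rewrite /calP; case: eqP => [p2|pn2].
  move: hp; rewrite p2 => hp2; rewrite !inE => /or3P[] /eqP ->.
  - by exists 0%N, false; apply: two_block_0.
  - by exists 1%N, true; apply: two_block_10.
  - by exists 0%N, false; apply: two_block_11.
case: q => a j /= /andP[lta /mapP[n]]; rewrite mem_iota add0n => /andP[_ ltn] ->.
apply: (odd_block hp) => //.
by have := even_prime p_pr => -[].
Qed.

Lemma B1_subalg (S : set U) eps q : subalg S -> (forall a, S (mu k p a)) ->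
  S (hY k 1 * hX k 1) -> S (B1 k p eps q).
Proof.
move=> sS Sm Sw; case: q => a j /=.
have SmY b : S (mu k p b * hY k 1 * hX k 1) by rewrite -mulrA; apply: subalgM.
rewrite /B1; case: ifP => p2.
  case: ifP => a0; first by case: ifP.
  by case: ifP => j0 //; apply: subalgD.
apply: subalgM => //; apply: subalg_horner => //; apply: subalgD => //.
by apply: subalgZ => //; apply: subalg1.
Qed.

Lemma Ap_B1 r eps q : (0 < r)%N -> @Ap k p r (B1 k p eps q).
Proof.
move=> r0; apply: (@Ap_mono k p 1) => //; apply: (B1_subalg _ _ (Ap_subalg k p 1)).
  by move=> a; rewrite mu_hL; apply: (Ap_hL hp); [exact: ipf_mu|exact: mu_per].
by have := @Ap_YX k p 1 0 isT; rewrite expn0.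
Qed.

Definition wzero : set U := [set x | exists m n, x = hY k m * binH k 0 n * hX k m].

Record block_hom (q : pair_index) (delta : bool) (G : U -> U) : Prop := BlockHom {
  bh_lin : linear G;
  bhM : forall x y, G (x * y) = G x * G y;
  bh1 : G 1 = B1 k p false q;
  bh_term : forall F F' m l, ipf F -> ipf F' -> twist k p q.1 delta F F' ->
    G (hY k m * hL k F * hX k l) = hY k (p * m) * hL k F' * hX k (p * l) * B1 k p false q;
  bh_comm : forall eps z, G z * B1 k p eps q = B1 k p eps q * G z;
  bh_Zmap : forall eps z, kspan wzero z -> Zmap p eps z q = G z * B1 k p eps q;
  bh_basis : exists s, (forall m n l, G (hY k m * binH k 0 n * hX k l) =
    hY k (p * m) * hL k (fun h => binz (h + 2 * s%:Z) (p * n)) * hX k (p * l) * B1 k p false q)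
    /\ forall (h : int) n, bk (p%:Z * h + q.1%:Z + 2 * s%:Z) (p * n) = bk (h + (delta : nat)%:Z) n
}.

Lemma block_hom_exists q s delta : block k p q s delta -> exists G, block_hom q delta G.
Proof.
move=> bq; have [lt cen mu_ com idem nil YX Q sh top Z] := bq.
have [G [Glin Gb]] := hyper_lift (fun m n l => hY k (p * m) *
   hL k (fun h => binz (h + 2 * s%:Z) (p * n)) * hX k (p * l) * B1 k p false q).
have [eX eY eL] := cen false.
exists G; split=> //.
- exact: (GM hp lt eX eY eL (mu_ false) (idem false) Q sh Glin Gb).
- exact: (G1 Gb).
- move=> F F' m l iF iF' tw; exact: (G_term hp lt eX (mu_ false) sh Glin Gb).
- move=> eps; have [bX bY bL] := cen eps.
  apply: (@eqG k (fun z => G z * B1 k p eps q) (fun z => B1 k p eps q * G z)).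
  + exact: (linear_compf (linear_mulr _) Glin).
  + exact: (linear_compf (linear_mull _) Glin).
  move=> m F l iF.
  have [F' iF' tw] := twist_exists sh iF.
  rewrite (G_term hp lt eX (mu_ false) sh Glin Gb m l iF iF' tw).
  rewrite -[LHS]mulrA com [LHS]mulrA [RHS]mulrA; congr (_ * _).
  set b := B1 k p eps q.
  by rewrite -!mulrA -bX !mulrA -(mulrA _ _ b) -bL // !mulrA bY.
- move=> eps; apply: linear_ext_span.
  + exact: ZmapD.
  + exact: (linear_compf (linear_mulr _) Glin).
  by move=> _ [m [n ->]]; rewrite Z Gb -!mulrA idem.
- by exists s.
Qed.

Lemma Wgen_wzero r x : kspan (@Wgen k p r) x -> kspan wzero x.
Proof. by apply: kspan_sub => _ [m [n [_ _ ->]]]; apply: kspan_gen; exists m, n. Qed.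

Lemma Ap_Wspan r x : @Ap k p r x -> kspan (@Wgen k p r) x.
Proof. by move=> Ax; apply: (calAr_Wspan hp); apply: (Ap_calAr hp). Qed.

Section Step.
Variables (q : pair_index) (s : nat) (delta : bool) (G : U -> U).
Hypotheses (bq : block k p q s delta) (bG : block_hom q delta G).

Let binH00 : binH k 0 0 = 1.
Proof. by rewrite binH0E hL1 //; [exact: ipf_binz|move=> h; rewrite binz0]. Qed.

(** On generators, G gives binom(H+2s,p^(i+1)) e and Y^(p^(i+1)) X^(p^(i+1)) e; the translated
    binomial has period p^(r+1), which places it in the larger algebra. *)
Lemma bh_Ap r z : @Ap k p r z -> @Ap k p r.+1 (G z).
Proof.
have sA := Ap_subalg k p r.+1; have eA := @Ap_B1 r.+1 false q isT.
apply: (subalg_gen_min (S := [set z | @Ap k p r.+1 (G z)])).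
  split=> [|c x y /= Hx Hy|x y /= Hx Hy] /=; first by rewrite (bh1 bG).
    by rewrite (bh_lin bG); apply: (subalgL sA).
  by rewrite (bhM bG); apply: (subalgM sA).
have [s' [Gb _]] := bh_basis bG.
move=> _ [[i lti <-]|[i lti <-]] /=.
  have := Gb 0%N (p ^ i)%N 0%N; rewrite muln0 hY0 hX0 !mul1r !mulr1 => ->.
  apply: (subalgM sA) => //; apply: (Ap_hL hp); first exact: ipf_binzD.
  apply: per_binz => //; rewrite -expnS ltn_exp2l //; exact: leq_ltn_trans lti _.
have := Gb (p ^ i)%N 0%N (p ^ i)%N; rewrite binH00 mulr1 muln0 hL1; last 2 first.
- exact: ipf_binzD.
- by move=> h; rewrite binz0.
by rewrite mulr1 => ->; apply: (subalgM sA) => //; rewrite -expnS; apply: Ap_YX.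
Qed.

(** With m = p m1 + m0, the factor Y^(m0) X^(m0) e is a combination of e and n, and what remains is
    a value of G on an element of level r. *)
Lemma step_span r m n : (m < p ^ r.+1)%N -> (n < p ^ r.+1)%N ->
  exists z al be, [/\ kspan (@Wgen k p r) z, degenerate p q -> be = 0 &
    hY k m * binH k 0 n * hX k m * B1 k p false q =
    G z * (al *: B1 k p false q + be *: B1 k p true q)].
Proof.
move=> ltm ltn; pose m1 := (m %/ p)%N; pose m0 := (m %% p)%N.
have lt0 : (m0 < p)%N by rewrite ltn_pmod.
have mE : m = (p * m1 + m0)%N by rewrite mulnC -divn_eq.
have lt1 : (m1 < p ^ r)%N by rewrite ltn_divLR // -expnSr.
have [al [be [E be0]]] := block_YX bq lt0.
pose F1 (h : int) := binz (h + 2 * m0%:Z) n.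
(* Chosen so that [F1] is a twist of [F2], that is, F2(h + delta) = F1(ph + a). The factor p lowers
   the period from p^(r+1) to p^r. *)
pose F2 (h : int) := F1 (p%:Z * h + (q.1%:Z - p%:Z * (delta : nat)%:Z)).
have iF1 : ipf F1 by exact: ipf_binzD.
have iF2 : ipf F2 by exact: ipf_affine.
have pF2 : per k p r F2.
  move=> h c; rewrite /F2 /F1 -[LHS]/(bk _ _) -[RHS]/(bk _ _) -[RHS](bk_per hp _ c ltn).
  by congr bk; rewrite expnS PoszM; ring.
have tw : twist k p q.1 delta F2 F1.
  by move=> h; rewrite /F2; congr (F1 _)%:~R; ring.
exists (hY k m1 * hL k F2 * hX k m1), al, be; split=> //.
  exact: (Wspan_term hp).
rewrite (bh_term bG _ _ iF2 iF1 tw) -[RHS]mulrA mulrDr -!scalerAr.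
have [eX eY eL] := block_central bq false.
have id eps := block_idem bq eps.
rewrite !id -E mE.
rewrite -(hYp_add hp) // -(hXp_add hp) //.
have [w1 w2 w3] := central1_YX hp lt0.
transitivity (hY k (p * m1) * (hY k m0 * hL k (binz^~ n)) * hX k m0 * hX k (p * m1) * B1 k p false q).
  by rewrite binH0E !mulrA.
rewrite hY_L; last exact: ipf_binz.
transitivity (hY k (p * m1) * hL k F1 * (hY k m0 * hX k m0 * hX k (p * m1)) * B1 k p false q).
  by rewrite !mulrA.
by rewrite w1 !mulrA.
Qed.

(** On a list of length one [Brec] is [B1] and not a value of [Zmap]; both cases fit one formula
    because G 1 = B^(0) and B^(0) B^(eps) = B^(eps). *)
Lemma Brec_cons e eps L : kspan wzero (Bl eps L) ->
  Bl (e :: eps) (q :: L) = G (Bl eps L) * B1 k p e q.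
Proof.
rewrite /=; case: (zip eps L) => [|x l] H; last by rewrite (bh_Zmap bG).
by rewrite /= (bh1 bG) (block_idem bq).
Qed.

(* The sum over a full period does not see translations of [H]. *)
Definition theta (r : nat) (x : U) : k^o :=
  \sum_(h < p ^ r) phi (p ^ r).-1 (p ^ r).-1 h%:Z x.

Lemma theta_linear r : linear (theta r).
Proof.
move=> c x y; rewrite /theta -[RHS]/(c * _ + _) mulr_sumr -big_split /=.
by apply: eq_bigr => h _; rewrite phiD phiZ.
Qed.

Lemma term_YX m t F : (t < p)%N -> ipf F ->
  hY k (p * m) * hL k F * hX k (p * m) * (mu k p q.1 * (hY k t * hX k t)) =
  hY k (p * m + t) * hL k (fun h => F (h - 2 * t%:Z) * binz (h - 2 * t%:Z + (- q.1%:Z - 1)) p.-1)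
    * hX k (p * m + t).
Proof.
move=> ltt iF; have [m1 m2 m3] := central1_mu hp q.1.
have [w1 w2 w3] := central1_YX hp ltt.
transitivity (hY k (p * m) * (hL k F * mu k p q.1) * (hY k t * hX k t) * hX k (p * m)).
  rewrite -!mulrA; congr (_ * (_ * _)).
  by rewrite mulrA -m1 -mulrA -w1 -[hY k t * _ * _]mulrA.
rewrite mu_hL -hLM //; last exact: ipf_mu.
rewrite -(hYp_add hp) // -(hXp_add hp) //.
transitivity (hY k (p * m) * (hL k (fun h => F h * binz (h + (- q.1%:Z - 1)) p.-1) * hY k t)
  * hX k t * hX k (p * m)); first by rewrite !mulrA.
rewrite hL_Y; last exact: ipfM iF (ipf_mu _ _).
by rewrite !mulrA.
Qed.

(** From pm + t = p^(r+1) - 1 with t < p one gets m = p^r - 1 and t = p - 1, so [theta] sees only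
    the nonzero top coefficient of the block. The translations by 2(p-1) and by delta disappear in
    sums over full periods. *)
Lemma theta_step : exists2 c : k, c != 0 & forall r z, kspan (@Wgen k p r) z ->
  theta r.+1 (G z * B1 k p (~~ degenerate p q) q) = c * theta r z.
Proof.
have [c [topE c0]] := block_top bq.
have lt1 : (p.-1 < p)%N by rewrite prednK.
exists (c (Ordinal lt1)); first by apply: c0; rewrite /= prednK.
have [s' [Gb shift]] := bh_basis bG.
move=> r z; apply: (linear_ext_span (f := fun z => theta r.+1 (G z * B1 k p (~~ degenerate p q) q))
   (g := fun z => c (Ordinal lt1) *: theta r z)).
- by move=> a x y; rewrite (bh_lin bG) mulrDl -scalerAl theta_linear.
- by move=> a x y; rewrite theta_linear scalerDr !scalerA mulrC.
move=> _ [m [n [ltm ltn ->]]]; rewrite Gb -(mulrA _ (B1 k p false q)) (block_idem bq) topE.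
set f := fun h : int => binz (h + 2 * s'%:Z) (p * n).
have If : ipf f by exact: ipf_binzD.
have T h : phi (p ^ r.+1).-1 (p ^ r.+1).-1 h (hY k (p * m) * hL k f * hX k (p * m) *
   (mu k p q.1 * \sum_(t < p) c t *: (hY k t * hX k t))) =
   (m == (p ^ r).-1)%:R * (c (Ordinal lt1) * (bk (h - 2 * p.-1%:Z + 2 * s'%:Z) (p * n) *
     bk (h - 2 * p.-1%:Z + (- q.1%:Z - 1)) p.-1)).
  rewrite !mulr_sumr phi_sum (bigD1 (Ordinal lt1)) //= big1 ?addr0.
    rewrite -!scalerAr phiZ term_YX // phi_term; last first.
      exact: ipfM (ipf_shift _ If) (ipf_muB _ _ _).
    rewrite mulrCA rmorphM andbb; congr (_ * _); congr (_%:R); congr nat_of_bool.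
    have := q_gt0 r; rewrite expnS => q0; apply/eqP/eqP => [E|->]; nia.
  move=> t ne; rewrite -!scalerAr phiZ term_YX // phi_term; last first.
    exact: ipfM (ipf_shift _ If) (ipf_muB _ _ _).
  rewrite (_ : ((p ^ r.+1).-1 == (p * m + t)%N) = false) ?mul0r ?mulr0 //.
  have nt : (t : nat) != p.-1 by apply: contra ne => /eqP E; apply/eqP/val_inj.
  apply/negbTE/negP => /eqP E; have := q_gt0 r; have := ltn_ord t; rewrite expnS in E.
  by move: (nat_of_ord t) nt E => t' nt E; nia.
rewrite /theta; under eq_bigr => h _ do rewrite T.
have T2 h : phi (p ^ r).-1 (p ^ r).-1 h (hY k m * binH k 0 n * hX k m) =
    (m == (p ^ r).-1)%:R * bk h n.
  by rewrite binH0E phi_term ?andbb 1?eq_sym //; exact: ipf_binz.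
under [in RHS]eq_bigr => h _ do rewrite T2.
rewrite -!mulr_sumr -[c _ *: _]/(c _ * _) mulrCA.
case: eqP => mE; last by rewrite !mul0r mulr0.
rewrite !mul1r; congr (_ * _).
(* The summand as a function of the translated weight y = h - 2(p-1). Its second factor keeps only y
   congruent to a, so a sum over p^(r+1) weights becomes one over p^r. *)
pose g (y : int) : k := bk (y + 2 * s'%:Z) (p * n) * bk (y + (- q.1%:Z - 1)) p.-1.
have ltpn : (p * n < p ^ r.+1)%N by rewrite expnS ltn_pmul2l.
have gper h : g (h + (p ^ r.+1)%N%:Z) = g h.
  rewrite /g; congr (_ * _).
    rewrite addrAC -[(p ^ r.+1)%N%:Z]mulr1; exact: (bk_per hp).
  rewrite addrAC -[(p ^ r.+1)%N%:Z]mulr1; apply: (bk_per hp).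
  by rewrite (leq_trans lt1) // -{1}[p]expn1 leq_exp2l.
have := sum_shift gper (- (2 * p.-1%:Z)); rewrite {1}/g => ->.
have lta := block_lt bq.
pose g' (h : int) : k := bk h n.
have g'per h : g' (h + (p ^ r)%N%:Z) = g' h.
  by rewrite /g' -[(p ^ r)%N%:Z]mulr1; apply: (bk_per hp).
transitivity (\sum_(h < p ^ r) g' (h%:Z + (delta : nat)%:Z)); last by rewrite (sum_shift g'per).
rewrite expnS (sum_ord_mul p (p ^ r) (fun t => g t%:Z)); apply: eq_bigr => h _.
have gE (t : nat) : (t < p)%N -> g (p * h + t)%N%:Z =
    bk (p%:Z * h%:Z + t%:Z + 2 * s'%:Z) (p * n) * (t == q.1)%:R.
  by move=> ltt; rewrite /g PoszD PoszM (mu_val hp).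
rewrite (bigD1 (Ordinal lta)) //= big1 ?addr0.
  by rewrite gE // eqxx mulr1 shift.
move=> t ne; rewrite gE // (_ : (t == q.1 :> nat) = false) ?mulr0 //.
by apply/negbTE; apply: contra ne => /eqP E; apply/eqP/val_inj.
Qed.

End Step.

End Tower.

(** * Radicals and socles *)

Section SetMul.
Variables (k : fieldType) (A : algType k).
Implicit Types (J M S : set A).

Lemma zmod_closedP S : GRing.zmod_closed [in S] <-> S 0 /\ forall x y, S x -> S y -> S (x - y).
Proof.
split=> [[h0 hB]|[h0 hB]]; split; rewrite ?inE // in h0 *.
  by move=> x y Sx Sy; have := hB x y; rewrite !inE; apply.
by move=> x y; rewrite !inE; apply: hB.
Qed.

Lemma setmul_in J M x m : J x -> M m -> setmul J M (x * m).
Proof. by move=> Jx Mm S [_]; apply; exists x => //; exists m. Qed.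

Lemma setmul_zmod J M : setmul J M 0 /\ forall x y, setmul J M x -> setmul J M y -> setmul J M (x - y).
Proof.
split=> [S [/zmod_closedP[] //]|x y Hx Hy S HS].
have /zmod_closedP[_ SB] := HS.1.
by apply: SB; [apply: Hx|apply: Hy].
Qed.

Lemma setmul_sum J M (I : Type) (s : seq I) (P : pred I) (F : I -> A) :
  (forall i, P i -> setmul J M (F i)) -> setmul J M (\sum_(i <- s | P i) F i).
Proof.
have [S0 SB] := setmul_zmod J M.
move=> H; apply: big_ind => // x y Hx Hy; rewrite -[y]opprK; apply: (SB) => //.
by rewrite -[- y]add0r; apply: SB.
Qed.

Lemma setmul_min J M S : S 0 -> (forall x y, S x -> S y -> S (x - y)) ->
  (forall x m, J x -> M m -> S (x * m)) -> forall z, setmul J M z -> S z.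
Proof.
move=> S0 SB H z; apply; split; first exact/zmod_closedP.
by move=> _ [x Jx [m Mm <-]]; apply: H.
Qed.

End SetMul.

(** * Radical and socle filtrations of modules spanned by squarefree monomials *)

Section BooleanBasis.
Import boot.fintype boot.finset.
Local Open Scope set_scope.
Variables (k : fieldType) (A : algType k) (R : set A) (sR : subalg R).
Variables (I : finType) (D : {set I}) (B : {set I} -> A).
Implicit Types (S T U : {set I}) (c : {set I} -> k).

Hypothesis RB : forall S, S \subset D -> R (B S).
Hypothesis BM : forall S T, S \subset D -> T \subset D ->
  B S * B T = if [disjoint S & T]%B then B (S :|: T) else 0.
Hypothesis BD : B D != 0.

Definition comb c : A := \sum_(S : {set I} | S \subset D) c S *: B S.

Hypothesis Rcomb : forall x, R x -> exists c, x * B set0 = comb c.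

Lemma comb0 : comb (fun=> 0) = 0.
Proof. by rewrite /comb big1 // => S _; rewrite scale0r. Qed.
Lemma combB c c' : comb c - comb c' = comb (fun S => c S - c' S).
Proof. by rewrite /comb -sumrB; apply: eq_bigr => S _; rewrite scalerBl. Qed.
Lemma combZ a c : a *: comb c = comb (fun S => a * c S).
Proof. by rewrite /comb scaler_sumr; apply: eq_bigr => S _; rewrite scalerA. Qed.
Lemma comb1 S a : S \subset D -> comb (fun T => if T == S then a else 0) = a *: B S.
Proof.
move=> sSD; rewrite /comb (bigD1 S) //= eqxx big1 ?addr0 // => T /andP[_ /negbTE ->].
by rewrite scale0r.
Qed.

Lemma comb_mulB U c : U \subset D ->
  comb c * B U = comb (fun T => if U \subset T then c (T :\: U) else 0).
Proof.
move=> sUD; rewrite /comb mulr_suml (bigID (fun S => [disjoint S & U]%B)) /=.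
rewrite [X in _ + X]big1 ?addr0; last first.
  by move=> S /andP[sSD /negbTE dSU]; rewrite -scalerAl BM // dSU scaler0.
rewrite [RHS](bigID (fun S => U \subset S)) /= [X in _ = _ + X]big1 ?addr0; last first.
  by move=> S /andP[_ /negbTE ->]; rewrite scale0r.
rewrite (reindex_onto (fun T => T :\: U) (fun S => S :|: U)) /=; last first.
  move=> S /andP[sSD dSU]; rewrite setDUl setDv setU0.
  by apply/setDidPl.
apply: eq_big => [T|T /andP[/andP[sTD dTU] /eqP E]].
  apply/andP/andP => [[/andP[sTD dTU] /eqP E]|[sTD sUT]].
    split; last by rewrite -E subsetUr.
    by rewrite -E subUset sUD sTD.
  have E : (T :\: U) :|: U = T by rewrite setUC setDE setUIr setUCr setIT; apply/setUidPr.
  rewrite E; split=> //; apply/andP; split; first exact: subset_trans (subsetDl _ _) sTD.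
  by rewrite -setI_eq0 setIDAC setDIl setDv setI0.
have sUT : U \subset T by rewrite -E subsetUr.
by rewrite sUT -scalerAl BM // dTU E.
Qed.

Lemma BC S T : S \subset D -> T \subset D -> B S * B T = B T * B S.
Proof. by move=> sS sT; rewrite !BM // disjoint_sym setUC. Qed.

Lemma mulB_comb U c : U \subset D -> B U * comb c = comb c * B U.
Proof.
move=> sUD; rewrite /comb mulr_suml mulr_sumr; apply: eq_bigr => S sSD.
by rewrite -scalerAr -scalerAl BC.
Qed.

(** Multiply by the monomial of the complement of S in D. Only subsets of S survive; the proper ones
    have coefficient 0 by induction on the cardinal, and S itself yields a multiple of B D <> 0. *)
Lemma comb_inj c : comb c = 0 -> forall S, S \subset D -> c S = 0.
Proof.
move=> c0 S; move: {2}#|S|.+1 (ltnSn #|S|) => n; elim: n S => // n IH S ltS sSD.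
have sDS : D :\: S \subset D by exact: subsetDl.
have := comb_mulB c sDS; rewrite c0 mul0r => /esym/eqP.
rewrite /comb (bigD1 D) //= sDS big1 ?addr0; last first.
  move=> T /andP[sTD TD]; case: ifP => sT; last by rewrite scale0r.
  have sTS : T :\: (D :\: S) \proper S.
    rewrite properEneq; apply/andP; split.
      apply: contra TD => /eqP E; rewrite eqEsubset sTD /=.
      apply/subsetP => x xD; case: (boolP (x \in S)) => xS.
        by move: xS; rewrite -{1}E => /setDP[].
      by apply: (subsetP sT); rewrite in_setD xS.
    apply/subsetP => x /setDP[xT]; rewrite in_setD negb_and negbK (subsetP sTD _ xT) orbF //.
  rewrite IH ?scale0r //; first exact: leq_trans (proper_card sTS) _.
  exact: subset_trans (proper_sub sTS) sSD.
rewrite setDDr setDv set0U (setIidPr sSD) scaler_eq0 (negbTE BD) orbF.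
by move=> /eqP.
Qed.

Lemma comb_eq c c' : comb c = comb c' -> forall S, S \subset D -> c S = c' S.
Proof.
move=> E S sSD; apply/eqP; rewrite -subr_eq0; apply/eqP.
by apply: (@comb_inj (fun S => c S - c' S)) => //; rewrite -combB E subrr.
Qed.

Definition sp (P : pred {set I}) : set A :=
  [set x | exists2 c, (forall S, S \subset D -> c S != 0 -> P S) & x = comb c]%classic.

Implicit Types (P Q W : pred {set I}).

Lemma sp0 P : sp P 0.
Proof. by exists (fun=> 0); [move=> S _; rewrite eqxx|rewrite comb0]. Qed.
Lemma spB P x y : sp P x -> sp P y -> sp P (x - y).
Proof.
move=> [c Pc ->] [c' Pc' ->]; rewrite combB; exists (fun S => c S - c' S) => // S sSD.
case: (eqVneq (c S) 0) => [->|]; last by move=> /(Pc _ sSD).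
by rewrite sub0r oppr_eq0; apply: Pc'.
Qed.
Lemma spN P x : sp P x -> sp P (- x).
Proof. by rewrite -[- x]sub0r; apply: spB; apply: sp0. Qed.
Lemma spD P x y : sp P x -> sp P y -> sp P (x + y).
Proof. by move=> Px Py; rewrite -[y]opprK; apply: spB => //; apply: spN. Qed.
Lemma spZ P a x : sp P x -> sp P (a *: x).
Proof.
move=> [c Pc ->]; rewrite combZ; exists (fun S => a * c S) => // S sSD.
by rewrite mulf_eq0 => /norP[_]; apply: Pc.
Qed.
Lemma sp_B P S : S \subset D -> P S -> sp P (B S).
Proof.
move=> sSD PS; rewrite -[B S]scale1r -comb1 //; exists (fun T => if T == S then 1 else 0) => // T _.
by case: (T =P S) => [->//|_]; rewrite eqxx.
Qed.
Lemma sp_sub P Q x : (forall S, S \subset D -> P S -> Q S) -> sp P x -> sp Q x.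
Proof. by move=> PQ [c Pc ->]; exists c => // S sSD /(Pc _ sSD); apply: PQ. Qed.
Lemma eq_sp P Q : (forall S, S \subset D -> P S = Q S) -> sp P = sp Q.
Proof. by move=> E; apply/seteqP; split=> x; apply: sp_sub => S sSD; rewrite E. Qed.
Lemma sp_ind P (K : set A) : K 0 -> (forall x y, K x -> K y -> K (x + y)) ->
  (forall a S, S \subset D -> P S -> K (a *: B S)) -> forall x, sp P x -> K x.
Proof.
move=> K0 KD KB _ [c Pc ->]; apply: big_ind => // S sSD.
by case: (eqVneq (c S) 0) => [->|/(Pc _ sSD)]; [rewrite scale0r|apply: KB].
Qed.

Lemma spM P Q W x y :
  (forall S T, S \subset D -> T \subset D -> P S -> Q T -> [disjoint S & T]%B -> W (S :|: T)) ->
  sp P x -> sp Q y -> sp W (x * y).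
Proof.
move=> H sx sy; move: x sx; apply: sp_ind => [|u v Hu Hv|a S sSD PS]; first by rewrite mul0r; apply: sp0.
  by rewrite mulrDl; apply: spD.
move: y sy; apply: sp_ind => [|u v Hu Hv|b T sTD QT]; first by rewrite mulr0; apply: sp0.
  by rewrite mulrDr; apply: spD.
rewrite -scalerAl -scalerAr; do 2!apply: spZ.
rewrite BM //; case: ifP => dST; last exact: sp0.
by apply: sp_B; [rewrite subUset sSD|apply: H].
Qed.

Lemma R_sp P x : sp P x -> R x.
Proof.
apply: sp_ind => [|u v|a S sSD _]; [exact: (subalg0 sR)|exact: (subalgD sR)|].
by apply: (subalgZ sR); apply: RB.
Qed.

Let e := B set0.
Lemma eB S : S \subset D -> e * B S = B S.
Proof. by move=> sSD; rewrite BM ?sub0set // disjoints_subset sub0set set0U. Qed.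
Lemma e_sp P x : sp P x -> e * x = x.
Proof.
apply: (sp_ind (K := fun x => e * x = x)) => [|u v Hu Hv|a S sSD _]; first by rewrite mulr0.
  by rewrite mulrDr Hu Hv.
by rewrite -scalerAr eB.
Qed.

Lemma R_e x : R x -> sp predT (x * e).
Proof. by move=> /Rcomb[c ->]; exists c. Qed.

(** As e is a left identity on the span, R acts there through the elements x e, which [Rcomb]
    describes. *)
Lemma sp_actE P x y : sp P y -> x * y = (x * e) * y.
Proof. by move=> Py; rewrite -mulrA (e_sp Py). Qed.

Definition rk n : pred {set I} := fun S => (n <= #|S|)%N.

Lemma sp_top n x : (#|D| < n)%N -> sp (rk n) x -> x = 0.
Proof.
move=> ltn; apply: (sp_ind (K := fun x => x = 0)) => [|u v -> ->|a S sSD]; rewrite ?addr0 //.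
by move=> le; have := leq_trans ltn (leq_trans le (subset_leq_card sSD)); rewrite ltnn.
Qed.

Lemma disj_card S T : [disjoint S & T]%B -> #|S :|: T| = (#|S| + #|T|)%N.
Proof. by move=> d; rewrite cardsU (disjoint_setI0 d) cards0 subn0. Qed.

Lemma spM_rk m n x y : sp (rk m) x -> sp (rk n) y -> sp (rk (m + n)%N) (x * y).
Proof. by apply: spM => S T _ _ mS nT d; rewrite /rk disj_card // leq_add. Qed.

(* The [x] in [R] with [sp (rk 1) (x * e)] form a maximal left ideal. *)
Lemma jacobson_e x : jacobson R x -> sp (rk 1) (x * e).
Proof.
move=> [Rx]; pose I0 := [set x | R x /\ sp (rk 1) (x * e)]%classic.
move=> /(_ I0) -[] //; split=> [||J' [J'R /zmod_closedP[J'0 J'B] J'M] I0J' J'nR].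
- split=> [y []//||a y Ra [Ry sy]].
    apply/zmod_closedP; split; first by split; [exact: (subalg0 sR)|rewrite mul0r; exact: sp0].
    move=> u v [Ru su] [Rv sv]; split; first exact: (subalgB sR).
    by rewrite mulrBl; apply: spB.
  split; first exact: (subalgM sR).
  rewrite -mulrA (sp_actE _ sy); apply: spM (R_e Ra) sy => S T _ _ _ nT d.
  by rewrite /rk disj_card // addnC ltn_addr.
- move=> E; have : I0 1 by rewrite E; exact: (subalg1 sR).
  move=> [_]; rewrite mul1r => -[c Pc].
  rewrite -[X in X = _]scale1r -comb1 ?sub0set // => /comb_eq/(_ set0 (sub0set _)).
  by rewrite eqxx => E1; have := Pc _ (sub0set D); rewrite -E1 oner_eq0 /rk cards0 => /(_ isT).
apply/seteqP; split=> // y J'y; split; first exact: J'R.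
have Ry := J'R _ J'y; have [c yE] := Rcomb Ry.
case: (eqVneq (c set0) 0) => [c0|cn0].
  exists c => // S _ cS; rewrite /rk card_gt0; apply: contra cS => /eqP ->; exact/eqP.
case: J'nR; apply/seteqP; split=> // z Rz.
(* When the coefficient of the empty set is nonzero, y differs from that scalar by an element of
   [I0], so J' contains an invertible scalar and equals R. *)
have I0y : I0 (y - c set0 *: 1).
  split; first by apply: (subalgB sR) => //; apply: (subalgZ sR); exact: (subalg1 sR).
  rewrite mulrBl -scalerAl mul1r yE -comb1 ?sub0set // combB.
  exists (fun S => c S - (if S == set0 then c set0 else 0)) => // S _.
  by rewrite /rk card_gt0; case: (S =P set0) => [->|//]; rewrite subrr eqxx.
have J'c : J' (c set0 *: 1) by rewrite -[_ *: 1](subKr y); apply: J'B => //; apply: I0J'.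
have -> : z = ((c set0)^-1 *: z) * (c set0 *: 1).
  by rewrite -scalerAl -scalerAr scalerA mulVf // scale1r mulr1.
by apply: J'M => //; apply: (subalgZ sR).
Qed.

(* A maximal left ideal [L] without [B S] contains [1 - x * B S] for some [x], and
   [x * B S] is nilpotent. *)
Lemma jacobson_B S : S \subset D -> (0 < #|S|)%N -> jacobson R (B S).
Proof.
move=> sSD S0; split; first exact: RB.
move=> L [[LR /zmod_closedP[L0 LB] LM] LnR Lmax]; apply: contrapT => LnS.
have LD x y : L x -> L y -> L (x + y).
  move=> Lx Ly; rewrite -[y]opprK; apply: (LB) => //.
  by rewrite -[- y]add0r; apply: LB.
pose L' := [set z | exists y x, [/\ L y, R x & z = y + x * B S]]%classic.
have L'id : left_ideal R L'.
  split.
  - move=> _ [y [x [Ly Rx ->]]]; apply: (subalgD sR); first exact: LR.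
    by apply: (subalgM sR) => //; apply: RB.
  - apply/zmod_closedP; split; first by exists 0, 0; rewrite mul0r addr0; split=> //; apply: (subalg0 sR).
    move=> _ _ [y [x [Ly Rx ->]]] [y' [x' [Ly' Rx' ->]]]; exists (y - y'), (x - x').
    by split; [exact: LB|exact: (subalgB sR)|rewrite mulrBl opprD addrACA].
  move=> a _ Ra [y [x [Ly Rx ->]]]; exists (a * y), (a * x).
  by split; [exact: LM|exact: (subalgM sR)|rewrite mulrDr mulrA].
have LL' : L `<=` L' by move=> y Ly; exists y, 0; rewrite mul0r addr0; split=> //; apply: (subalg0 sR).
have L'S : L' (B S) by exists 0, 1; rewrite mul1r add0r; split=> //; apply: (subalg1 sR).
have L'R : L' = R by apply: contrapT => nR; apply: LnS; rewrite -(Lmax _ L'id LL' nR).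
have : L' 1 by rewrite L'R; apply: (subalg1 sR).
move=> [y [x [Ly Rx E]]].
have sS : sp (rk 1) (B S) by apply: sp_B.
have sxS : sp (rk 1) (x * B S).
  rewrite (sp_actE _ sS); apply: spM (R_e Rx) sS => U T _ _ _ nT d.
  by rewrite /rk disj_card // addnC ltn_addr.
(* From 1 = y + x B S with y in L one has u = u y + u x B S, and the last term has larger rank.
   Ranks above #|D| give 0, where the induction starts. *)
have key n u : sp (rk (#|D|.+1 - n)%N) u -> L u.
  elim: n u => [|n IH] u su; first by rewrite (sp_top _ su) // subn0.
  rewrite -[u]mulr1 E mulrDr; apply: LD; first by apply: LM => //; apply: R_sp su.
  apply: IH; apply: sp_sub (spM_rk su sxS) => T _; rewrite /rk; lia.
have L1 : L 1.
  rewrite E; apply: LD => //; apply: (key #|D|.+1); apply: sp_sub sxS => T _.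
  by rewrite /rk subnn.
apply: LnR; apply/seteqP; split=> // z Rz; rewrite -[z]mulr1; exact: LM.
Qed.

Lemma ideal_pow_e n x : ideal_pow R (jacobson R) n x -> sp (rk n) (x * e).
Proof.
elim: n x => [|n IH] x /=; first by move=> /R_e; apply: sp_sub.
move: x; apply: setmul_min => [|x y Hx Hy|x m Jx Pm].
- by rewrite mul0r; apply: sp0.
- by rewrite mulrBl; apply: spB.
have sm := IH _ Pm; rewrite -mulrA (sp_actE _ sm) -add1n.
exact: spM_rk (jacobson_e Jx) sm.
Qed.

(** One splits off a singleton at a time: B S = B [set s] B (S :\ s), and the first factor lies in
    the radical. *)
Lemma ideal_pow_B n S : S \subset D -> (n <= #|S|)%N -> ideal_pow R (jacobson R) n (B S).
Proof.
elim: n S => [|n IH] S sSD /= le; first exact: RB.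
have /card_gt0P[s sS] : (0 < #|S|)%N by apply: leq_trans le.
have s1 : [set s] \subset D by rewrite sub1set (subsetP sSD).
have s2 : S :\ s \subset D by exact: subset_trans (subsetDl _ _) sSD.
have -> : B S = B [set s] * B (S :\ s).
  rewrite BM // setD1K // ifT //.
  by rewrite disjoints1 setD11.
apply: setmul_in; first by apply: jacobson_B => //; rewrite cards1.
by apply: IH => //; move: le; rewrite (cardsD1 s S) sS.
Qed.

Section Cyclic.
Variables (S0 : {set I}) (sS0 : S0 \subset D).

Lemma cyclic_sp : cyclic_mod R (B S0) = sp (fun S => S0 \subset S).
Proof.
have s0 : sp (fun S => S0 \subset S) (B S0) by apply: sp_B.
apply/seteqP; split=> x.
  move=> [y Ry <-]; rewrite (sp_actE _ s0); apply: spM (R_e Ry) s0 => S T _ _ _ sT _.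
  exact: subset_trans sT (subsetUr _ _).
apply: sp_ind => [|u v [y Ry <-] [z Rz <-]|a S sSD sS0S].
- by exists 0; [exact: (subalg0 sR)|rewrite mul0r].
- by exists (y + z); [exact: (subalgD sR)|rewrite mulrDl].
have s1 : S :\: S0 \subset D by exact: subset_trans (subsetDl _ _) sSD.
exists (a *: B (S :\: S0)); first by apply: (subalgZ sR); apply: RB.
rewrite -scalerAl BM // ifT; last by rewrite disjoints_subset setDE subsetIr.
by rewrite setUC setDE setUIr setUCr setIT (setUidPr sS0S).
Qed.

Local Notation M := (cyclic_mod R (B S0)).

Lemma radpow_sp i : radpow R i M =
  sp (fun S => (S0 \subset S) && (#|S0| + i <= #|S|)%N).
Proof.
case: i => [|i].
  rewrite /= cyclic_sp; apply: eq_sp => S sSD; rewrite addn0.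
  by case: (boolP (S0 \subset S)) => //= s; rewrite subset_leq_card.
rewrite [LHS]/(setmul (ideal_pow R (jacobson R) i.+1) M); apply/seteqP; split=> x.
  move: x; apply: setmul_min; [exact: sp0|exact: spB|] => x m Px.
  rewrite cyclic_sp => sm; rewrite (sp_actE _ sm).
  apply: spM (ideal_pow_e Px) sm => S T sSD sTD leS sT d.
  rewrite (subset_trans sT (subsetUr _ _)) disj_card // addnC leq_add //.
  exact: subset_leq_card.
move: x => _ [c Pc ->]; apply: setmul_sum => S sSD.
have [cS0|cSn0] := eqVneq (c S) 0; first by rewrite cS0 scale0r; case: (setmul_zmod (ideal_pow R (jacobson R) i.+1) M).
have /andP[s le] := Pc _ sSD cSn0.
have s1 : S :\: S0 \subset D by exact: subset_trans (subsetDl _ _) sSD.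
have -> : c S *: B S = B (S :\: S0) * (c S *: B S0).
  rewrite -scalerAr BM // ifT; last by rewrite disjoints_subset setDE subsetIr.
  by rewrite setUC setDE setUIr setUCr setIT (setUidPr s).
apply: setmul_in; first by apply: ideal_pow_B => //; rewrite cardsD (setIidPr s); lia.
by exists (c S *: 1); [apply: (subalgZ sR); apply: (subalg1 sR)|rewrite -scalerAl mul1r].
Qed.

(** If c S <> 0 with #|S| + n <= #|D|, the monomial of the complement of S in D lies in the n-th
    power of the radical and moves c S to the coefficient of B D, so the product is nonzero.
    Conversely, ranks add up to more than #|D|. *)
Lemma socpow_sp n : (0 < n)%N -> socpow R n M =
  sp (fun S => (S0 \subset S) && (#|D| < #|S| + n)%N).
Proof.
case: n => // n _; rewrite [LHS]/([set m | M m /\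
  forall x, ideal_pow R (jacobson R) n.+1 x -> x * m = 0]%classic) cyclic_sp.
apply/seteqP; split=> [m [[c Pc ->] km]|m sm].
  exists c => // S sSD cS; rewrite Pc //= ltnNge; apply: contra cS => le.
  have sDS : D :\: S \subset D by exact: subsetDl.
  have := km (B (D :\: S)); rewrite mulB_comb // comb_mulB // => H.
  have := comb_inj (H _) (subxx D); rewrite sDS setDDr setDv set0U (setIidPr sSD) => -> //.
  by apply: ideal_pow_B => //; rewrite cardsD (setIidPr sSD); have := subset_leq_card sSD; lia.
split; first by apply: sp_sub sm => S _ /andP[].
move=> x Px; rewrite (sp_actE _ sm); apply: (@sp_top #|D|.+1) => //.
apply: spM (ideal_pow_e Px) sm => S T sSD sTD; rewrite /rk => leS /andP[_ leT] d.
by rewrite disj_card //; lia.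
Qed.

(** Both sides are spanned by the same monomials: #|S0| + i <= #|S| is #|D| < #|S| + n for n = #|D|
    + 1 - #|S0| - i, and the bound on i keeps n positive. *)
Lemma radpow_socpow i : (i <= #|D| - #|S0|)%N ->
  radpow R i M = socpow R (#|D| + 1 - #|S0| - i)%N M.
Proof.
move=> le; have := subset_leq_card sS0 => le0; rewrite radpow_sp socpow_sp; last by lia.
by apply: eq_sp => S sSD; congr (_ && _); lia.
Qed.

End Cyclic.

(** The only subset with #|D| < #|S| + 1 is D, so the socle is equal to the module generated by B D
    and the isomorphism is the identity. *)
Lemma socle_iso S0 : S0 \subset D ->
  mod_iso R (socpow R 1 (cyclic_mod R (B S0))) (cyclic_mod R (B D)).
Proof.
move=> sS0; exists id; split=> //; rewrite (socpow_sp sS0) // (cyclic_sp (subxx D)).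
rewrite (@eq_sp _ (fun S => D \subset S)); first by split=> // x Mx; exists x.
move=> S sSD; rewrite addn1 ltnS; apply/andP/idP => [[_ le]|sDS].
  by have /eqP -> : S == D by rewrite eqEcard sSD.
by split; [exact: subset_trans sDS|exact: subset_leq_card].
Qed.

End BooleanBasis.

(** * Products of the elements B^(eps) *)

Section Products.
Variables (k : fieldType) (p : nat).
Hypothesis hp : p \in [pchar k].

Let p_pr : prime p. Proof. exact: pcharf_prime hp. Qed.

Local Notation U := (hyper k).
Local Notation Bl eps L := (Brec k p (zip eps L)).

Lemma Brec_Ap eps L : all (calP p) L -> size eps = size L -> @Ap k p (size L) (Bl eps L).
Proof.
elim: L eps => [|q L IH] [|b eps] //=; first by move=> _ _; exact: (subalg1 (Ap_subalg k p 0)).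
move=> /andP[/(block_exists hp)[s [delta bq]] PL] [sz]; have [G bG] := block_hom_exists hp bq.
have A0 := IH _ PL sz.
rewrite -[X in _ X]/(Bl (b :: eps) (q :: L)) (Brec_cons bq bG); last first.
  by apply: (Wgen_wzero (p := p) (r := size L)); apply: Ap_Wspan.
by apply: (subalgM (Ap_subalg _ _ _)); [exact: (bh_Ap hp bG A0)|exact: (Ap_B1 hp)].
Qed.

Lemma Brec_wzero eps L : all (calP p) L -> size eps = size L -> kspan (@wzero k) (Bl eps L).
Proof. by move=> PL sz; apply: (Wgen_wzero (p := p) (r := size L)); apply: (Ap_Wspan hp); apply: Brec_Ap. Qed.

(** The condition of [calX], stated on sequences to allow induction on the list of pairs. *)
Definition adm (L : seq pair_index) (eps : seq bool) :=
  (size eps == size L) && all (fun x => x.1 ==> ~~ degenerate p x.2) (zip eps L).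

Lemma adm_cons q L b eps : adm (q :: L) (b :: eps) = (b ==> ~~ degenerate p q) && adm L eps.
Proof. by rewrite /adm /= eqSS andbCA. Qed.
Lemma adm_size L eps : adm L eps -> size eps = size L.
Proof. by case/andP => /eqP. Qed.

(** At each level G(x) b G(y) b' = G(xy) b b', so the rules e n = n and n^2 = 0 of the first block
    combine with the product on the remaining ones. *)
Lemma Brec_mul L eps eps' : all (calP p) L -> adm L eps -> adm L eps' ->
  Bl eps L * Bl eps' L = if has (fun x => x.1 && x.2) (zip eps eps') then 0
     else Bl [seq x.1 || x.2 | x <- zip eps eps'] L.
Proof.
elim: L eps eps' => [|q L IH] [|b eps] [|b' eps'] // PL; first by rewrite /= mul1r.
rewrite !adm_cons => /andP[db aeps] /andP[db' aeps'].
have {PL} /andP[/(block_exists hp)[s [delta bq]] PL] := PL.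
have [G bG] := block_hom_exists hp bq.
have [sz sz'] := (adm_size aeps, adm_size aeps').
have szz : size [seq x.1 || x.2 | x <- zip eps eps'] = size L.
  by rewrite size_map size_zip sz sz' minnn.
have wz e : size e = size L -> kspan (@wzero k) (Bl e L) by apply: Brec_wzero.
rewrite (Brec_cons bq bG _ (wz _ sz)) (Brec_cons bq bG _ (wz _ sz')).
rewrite [zip (b :: _) _]/= [map _ _]/= (Brec_cons bq bG _ (wz _ szz)).
rewrite -[LHS]mulrA (mulrA (B1 k p b q)) -(bh_comm bG) -mulrA.
rewrite [LHS]mulrA -(bhM bG) IH //=.
case: (has _ _); last rewrite orbF.
  have G0 : G 0 = 0 by have := bh_lin bG (-1) 0 0; rewrite scaler0 addr0 scaleN1r addNr.
  by rewrite orbT G0 mul0r.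
case: b db => /= [db|_]; last by rewrite (block_idem bq).
case: b' db' => /= [_|_]; first by rewrite (block_nil bq) // mulr0.
by rewrite (block_comm bq) (block_idem bq).
Qed.

Definition admB L : set U := [set x | exists2 eps, adm L eps & x = Bl eps L].

(** By [step_span], x e = G(z)(al e + be n) for the first block. Multiplicativity of G leaves z
    times the element with all eps zero on the tail of the list, to which induction applies. *)
Lemma Wspan_Brec L x : all (calP p) L -> kspan (@Wgen k p (size L)) x ->
  kspan (admB L) (x * Bl (nseq (size L) false) L).
Proof.
elim: L x => [|q L IH] x PL.
  apply: (kspan_map (f := fun x => x * _)); first exact: linear_mulr.
  move=> _ [m [n [+ + ->]]]; rewrite expn0 !ltnS !leqn0 => /eqP -> /eqP ->.
  rewrite binH0E hL1; [|exact: ipf_binz|by move=> h; rewrite binz0].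
  by rewrite hY0 hX0 !mul1r; apply: kspan_gen; exists [::].
have {PL} /andP[/(block_exists hp)[s [delta bq]] PL] := PL.
have [G bG] := block_hom_exists hp bq.
have wz e : size e = size L -> kspan (@wzero k) (Bl e L) by apply: Brec_wzero.
rewrite [nseq _ _]/= (Brec_cons bq bG _ (wz _ (size_nseq _ _))).
apply: (kspan_map (f := fun x => x * _)); first exact: linear_mulr.
move=> _ [m [n [ltm ltn ->]]].
have [z [al [be [Wz be0 E]]]] := step_span hp bq bG ltm ltn.
rewrite (bh_comm bG) mulrA E -mulrA mulrDl -!scalerAl -!(bh_comm bG) mulrDr -!scalerAr !mulrA -(bhM bG).
have K b : (b ==> ~~ degenerate p q) ->
    kspan (admB (q :: L)) (G (z * Bl (nseq (size L) false) L) * B1 k p b q).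
  move=> db; apply: (kspan_map (f := fun x => G x * B1 k p b q)) (IH z PL Wz).
    exact: (linear_compf (linear_mulr _) (bh_lin bG)).
  move=> _ [eps ae ->]; apply: kspan_gen; exists (b :: eps); first by rewrite adm_cons db.
  by rewrite (Brec_cons bq bG _ (wz _ (adm_size ae))).
apply: kspanD; first by apply: kspanZ; apply: K.
have [dq|ndq] := boolP (degenerate p q); last by apply: kspanZ; apply: K.
by rewrite be0 // scale0r; apply: kspan0.
Qed.

(** By [theta_step], [theta] of this element is the product of the top coefficients of its blocks,
    starting from the value 1 on the empty list. *)
Lemma Brec_top_neq0 L : all (calP p) L -> Bl [seq ~~ degenerate p q | q <- L] L != 0.
Proof.
move=> PL; suff : @theta k p (size L) (Bl [seq ~~ degenerate p q | q <- L] L) != 0.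
  apply: contra => /eqP ->; apply/eqP.
  have := @theta_linear k p (size L) (-1) (0 : U) 0; rewrite scaler0 addr0 scaleN1r addNr.
  exact.
elim: L PL => [|q L IH] /= PL.
  rewrite /theta expn0 big_ord1 /=.
  have -> : (1 : U) = hY k 0 * hL k (binz^~ 0%N) * hX k 0.
    by rewrite hY0 hX0 mul1r mulr1 hL1 //; [exact: ipf_binz|move=> h; rewrite binz0].
  by rewrite phi_term ?eqxx ?mul1r ?binz0 ?oner_eq0 //; exact: ipf_binz.
have {PL} /andP[/(block_exists hp)[s [delta bq]] PL] := PL.
have [G bG] := block_hom_exists hp bq; have [c c0 E] := theta_step hp bq bG.
have sz : size [seq ~~ degenerate p q | q <- L] = size L by rewrite size_map.
rewrite -[X in theta _ _ X]/(Bl (~~ degenerate p q :: [seq ~~ degenerate p q | q <- L]) (q :: L)).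
rewrite (Brec_cons bq bG _ (Brec_wzero PL sz)) E; last by apply: (Ap_Wspan hp); apply: Brec_Ap.
by rewrite mulf_neq0 // IH.
Qed.

End Products.

(** * Subsets of indices in place of bit vectors, and the conclusion *)

Section Tuples.
Import boot.fintype boot.finset.
Local Open Scope set_scope.
Variables (k : fieldType) (p : nat).
Hypothesis hp : p \in [pchar k].
Variables (r : nat) (aj : r.-tuple pair_index).
Hypothesis haj : forall i : 'I_r, calP p (tnth aj i).
Implicit Types (S T : {set 'I_r}).

Definition bits (S : {set 'I_r}) : r.-tuple bool := [tuple i \in S | i < r].
Definition nondeg : {set 'I_r} := [set i | ~~ degenerate p (tnth aj i)].

Lemma bitsE S : bits S = [seq i \in S | i <- enum 'I_r] :> seq bool.
Proof. by rewrite /= -(map_tnth_enum (bits S)); apply: eq_map => i; rewrite tnth_mktuple. Qed.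
Lemma zip_bits S T : zip (bits S) (bits T) = [seq (i \in S, i \in T) | i <- enum 'I_r].
Proof. by rewrite !bitsE zip_map. Qed.
Lemma zip_bits_aj S : zip (bits S) aj = [seq (i \in S, tnth aj i) | i <- enum 'I_r].
Proof. by rewrite bitsE -{1}(map_tnth_enum aj) zip_map. Qed.
Lemma bitsK (eps : r.-tuple bool) : bits [set i | tnth eps i] = eps.
Proof. by apply: eq_from_tnth => i; rewrite tnth_mktuple inE. Qed.

Lemma adm_bits S : adm p aj (bits S) = (S \subset nondeg).
Proof.
rewrite /adm !size_tuple eqxx zip_bits_aj all_map /=.
apply/allP/subsetP => [H i iS|H i _ /=].
  by rewrite inE; have := H i (etrans (mem_enum _ _) isT); rewrite /= iS.
by apply/implyP => /H; rewrite inE.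
Qed.

Lemma hamming_bits S : hamming (bits S) = #|S|.
Proof. by rewrite /hamming bitsE count_map cardE -size_filter enumT. Qed.

Lemma calP_all : all (calP p) aj.
Proof. by apply/(all_tnthP) => i; apply: haj. Qed.

Definition BS S := Bvec k p (bits S) aj.

Lemma BS_mul S T : S \subset nondeg -> T \subset nondeg ->
  BS S * BS T = if [disjoint S & T]%B then BS (S :|: T) else 0.
Proof.
rewrite -!adm_bits => aS aT; rewrite /BS /Bvec (Brec_mul hp calP_all aS aT).
rewrite zip_bits has_map -map_comp.
have -> : has (preim (fun i => (i \in S, i \in T)) (fun x => x.1 && x.2)) (enum 'I_r)
    = ~~ [disjoint S & T]%B.
  rewrite -setI_eq0; apply/hasP/set0Pn => [[i _ /= iST]|[i iST]]; exists i.
  - by rewrite inE.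
  - by rewrite mem_enum.
  by move: iST; rewrite inE.
rewrite -if_neg negbK; case: ifP => // _; congr (Brec k p (zip _ _)).
by rewrite bitsE; apply: eq_map => i /=; rewrite inE.
Qed.

Lemma bits_nondeg : bits nondeg = tau p aj.
Proof.
by apply: eq_from_tnth => i; rewrite tnth_mktuple tnth_map inE.
Qed.

Lemma calAr_comb x : calAr k p r x -> exists c, x * BS set0 = comb nondeg BS c.
Proof.
move=> /(calAr_Wspan hp) Wx.
have b0 : bits set0 = nseq r false :> seq bool.
  rewrite bitsE -[RHS](congr1 (nseq^~ false) (size_enum_ord r)).
    by elim: (enum _) => //= i s ->; rewrite inE.
have := @Wspan_Brec k p hp aj x calP_all; rewrite size_tuple => /(_ Wx).
rewrite -b0 -/(Bvec k p (bits set0) aj) -/(BS set0).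
elim=> [|a _ v [eps ae ->] _ [c ->]]; first by exists (fun=> 0); rewrite comb0.
have sz : size eps == r by rewrite (adm_size ae) size_tuple.
pose S := [set i | tnth (Tuple sz) i].
have bS : bits S = Tuple sz := bitsK _.
have sS : S \subset nondeg by rewrite -adm_bits bS.
exists (fun T => (if T == S then a else 0) + c T).
rewrite -[eps]/(val (Tuple sz)) -bS -/(Bvec k p (bits S) aj) -/(BS S) -(comb1 BS a sS).
by rewrite /comb -big_split /=; apply: eq_bigr => T _; rewrite scalerDl.
Qed.

Lemma calAr_subalg : subalg (calAr k p r).
Proof.
have s1 := subalg_genP (range (fun i => binH k 0 (p ^ i)%N) `|`
              range (fun i => hY k (p ^ i)%N * hX k (p ^ i)%N))%classic.
have s2 := subalg_genP ([set hX k (p ^ i)%N | i in `I_r] `|` [set hY k (p ^ i)%N | i in `I_r])%classic.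
split=> [|c x y [x1 x2] [y1 y2]|x y [x1 x2] [y1 y2]].
- by split; [exact: (subalg1 s1)|exact: (subalg1 s2)].
- by split; [exact: (subalgL s1)|exact: (subalgL s2)].
- by split; [exact: (subalgM s1)|exact: (subalgM s2)].
Qed.

Lemma BS_calAr S : calAr k p r (BS S).
Proof.
apply: (Ap_calAr hp); rewrite -{1}(size_tuple aj); apply: (Brec_Ap hp); first exact: calP_all.
by rewrite !size_tuple.
Qed.

Lemma BS_top : BS nondeg != 0.
Proof. by rewrite /BS bits_nondeg; apply: (Brec_top_neq0 hp); apply: calP_all. Qed.

End Tuples.

Theorem theorem3p12 (k : closedFieldType) (p : nat) (hp : p \in [pchar k])
    (r : nat) (hr : (1 <= r)%N) (aj : r.-tuple pair_index)
    (haj : forall i : 'I_r, calP p (tnth aj i))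
    (eps : r.-tuple bool) (heps : calX p aj eps) :
  let R := calAr k p r in
  let M := cyclic_mod R (Bvec k p eps aj) in
  let w := wmax p aj in
  let W := hamming eps in
  (forall i : nat, (i <= w - W)%N ->
     radpow R i M = socpow R (w + 1 - W - i)%N M) /\
  mod_iso R (socpow R 1 M) (simple_mod k p aj).
Proof.
pose D := nondeg p aj; pose S0 := [set i | tnth eps i]%SET.
have wE : wmax p aj = #|D|.
  rewrite -hamming_bits bits_nondeg /hamming count_map; exact: eq_count.
have sS0 : S0 \subset D.
  apply/boot.fintype.subsetP => i; rewrite !inE => ei; apply/negP => /heps; by rewrite ei.
rewrite /simple_mod -bits_nondeg wE -(bitsK eps) -/S0 hamming_bits.
have RB (S : {set 'I_r}) (_ : S \subset D) := BS_calAr hp haj S.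
have BM := BS_mul hp haj; have BD := BS_top hp haj; have Rc := calAr_comb hp haj.
have sR := @calAr_subalg k p r.
split=> [i le|].
  exact: (radpow_socpow sR RB BM BD Rc sS0 le).
exact: (socle_iso sR RB BM BD Rc sS0).
Qed.
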